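(* Let $T=\{t_j\}_{j=1}^n$ and $T'=\{t'_k\}_{k=1}^m$ be two disjoint finite sets of distinct positive numbers. Let $h$ be analytic on $\mathbb{C}\setminus\mathbb{R}_+$ with $|h(-1)|=1$, satisfying for some $K>0$, $a,b,c_j,d_k\ge0$ and $r\in\mathbb{R}$ $$\log|h(\lambda)|\le\frac{K}{|\lambda|^r}\,\frac{(1+|\lambda|)^b}{\operatorname{dist}^a(\lambda,\mathbb{R}_+)}\,\frac{\prod_{j=1}^n|\lambda-t_j|^{c_j}}{\prod_{k=1}^m|\lambda-t'_k|^{d_k}}, \qquad \lambda\in\mathbb{C}\setminus\mathbb{R}_+.$$ Let $s:=3a-2b+2r-2\sum_{j=1}^n c_j+2\sum_{k=1}^m d_k$. Then for each $\varepsilon>0$ there is a positive number $C$, depending on all the parameters involved, such that $$\sum_{\zeta\in Z(h)}\operatorname{dist}^{a+1+\varepsilon}(\zeta,\mathbb{R}_+)\,\frac{|\zeta|^{s_1}}{(1+|\zeta|)^{s_2}}\cdot\frac{\prod_{k=1}^m|\zeta-t'_k|^{(d_k-1+\varepsilon)_+}}{\prod_{j=1}^n|\zeta-t_j|^{\min(a,c_j)}}\le C\cdot K,$$ where $$s_1:=\frac{\{-2r-a\}_{a,\varepsilon}-a-1-\varepsilon}{2},\qquad s_2:=a+1+\varepsilon+\frac{\{-2r-a\}_{a,\varepsilon}+\{s\}_{a,\varepsilon}}{2}-\sum_{j=1}^n\min(a,c_j)+\sum_{k=1}^m(d_k-1+\varepsilon)_+.$$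
   Context: $\mathbb{R}_+$ is the nonnegative real semi-axis, so $\mathbb{C}\setminus\mathbb{R}_+$ is the plane cut along it. $Z(h)$ denotes the zero set of $h$, counted with multiplicities; $a_+:=\max(a,0)$. For real $u$ write $u=u_+-u_-$ with $u_\pm\ge0$ the positive and negative parts, and for $c\ge0$, $\varepsilon>0$ set $\{u\}_{c,\varepsilon}:=(u_--1+\varepsilon)_+-\min(c,u_+)$. *)

(* Defs.v *)
From Stdlib Require Import Reals List.
From Coquelicot Require Import Coquelicot.
Open Scope R_scope.

Definition in_Rplus (z : C) : Prop := Im z = 0 /\ 0 <= Re z.

Definition dist_Rplus (z : C) : R :=
  if Rle_dec 0 (Re z) then Rabs (Im z) else Cmod z.

Fixpoint rsum (n : nat) (f : nat -> R) : R :=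
  match n with O => 0 | S k => rsum k f + f k end.
Fixpoint rprod (n : nat) (f : nat -> R) : R :=
  match n with O => 1 | S k => rprod k f * f k end.

Definition ppart (x : R) : R := Rmax x 0.
Definition npart (x : R) : R := Rmax (- x) 0.

Definition brace (u c eps : R) : R :=
  ppart (npart u - 1 + eps) - Rmin c (ppart u).

Definition analytic_on_slit (h : C -> C) : Prop :=
  forall z : C, ~ in_Rplus z ->
    exists rho : R, 0 < rho /\ exists coef : nat -> C,
      forall w : C, Cmod (Cminus w z) < rho ->
        is_series (fun k => Cmult (coef k) (pow_n (Cminus w z) k)) (h w).

Definition zero_order (h : C -> C) (z : C) (mu : nat) : Prop :=
  exists rho : R, 0 < rho /\ exists coef : nat -> C,
    (forall w : C, Cmod (Cminus w z) < rho ->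
        is_series (fun k => Cmult (coef k) (pow_n (Cminus w z) k)) (h w)) /\
    (forall k, (k < mu)%nat -> coef k = RtoC 0) /\ coef mu <> RtoC 0.

Definition growth_bound (n m : nat) (t t' c d : nat -> R) (a b r K : R) (l : C) : R :=
  K / Rpower (Cmod l) r * Rpower (1 + Cmod l) b / Rpower (dist_Rplus l) a
  * rprod n (fun j => Rpower (Cmod (Cminus l (RtoC (t j)))) (c j))
  / rprod m (fun k => Rpower (Cmod (Cminus l (RtoC (t' k)))) (d k)).

Definition s_par (n m : nat) (c d : nat -> R) (a b r : R) : R :=
  3 * a - 2 * b + 2 * r - 2 * rsum n c + 2 * rsum m d.

Definition s1_par (a r eps : R) : R :=
  (brace (- 2 * r - a) a eps - a - 1 - eps) / 2.

Definition s2_par (n m : nat) (c d : nat -> R) (a b r eps : R) : R :=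
  a + 1 + eps + (brace (- 2 * r - a) a eps + brace (s_par n m c d a b r) a eps) / 2
  - rsum n (fun j => Rmin a (c j)) + rsum m (fun k => ppart (d k - 1 + eps)).

Definition zero_weight (n m : nat) (t t' c d : nat -> R) (a b r eps : R) (z : C) : R :=
  Rpower (dist_Rplus z) (a + 1 + eps)
  * Rpower (Cmod z) (s1_par a r eps) / Rpower (1 + Cmod z) (s2_par n m c d a b r eps)
  * rprod m (fun k => Rpower (Cmod (Cminus z (RtoC (t' k)))) (ppart (d k - 1 + eps)))
  / rprod n (fun j => Rpower (Cmod (Cminus z (RtoC (t j)))) (Rmin a (c j))).

(** sum over a finite list of (zero, multiplicity) pairs, counted with multiplicity *)
Definition zsum (w : C -> R) (zs : list (C * nat)) : R :=
  fold_right (fun p acc => INR (snd p) * w (fst p) + acc) 0 zs.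

(* Main.v *)
Require Import Defs.
From Stdlib Require Import Reals List.
From Coquelicot Require Import Coquelicot.
From Stdlib Require Import Lra Lia Classical ClassicalEpsilon Arith.
Open Scope R_scope.

(** Pull [h] back to the upper half plane by [f w = h (w * w)]: the base point
    becomes [i], and the growth bound becomes [(Im w)^-a] times powers of the
    distances to finitely many real points [tau j] (and, after [w := - 1 / w],
    the same near infinity).  For a dyadic box of zeros at distance [rho] from
    [tau i] and height at least [h], compare [ln |f|], plus half the Green
    potential of these zeros, with an explicit harmonic majorant on the domain
    that stays off small discs around all [tau j], off the disc of radius
    [rho / 32] around [tau i], and above the cone
    [Im w = c (h / rho) |w - tau i| / (n + 1)], where [rho] is of order [2^-n].
    Sums of Poisson kernels correct the Green functions so that they become
    nonpositive on the boundary of this domain, without losing more than a factor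
    at [i].  The maximum principle then bounds the number of zeros in the box,
    and summing over boxes gives two geometric series, convergent because
    [q > a + 1] and [q + e i > max 1 (a - u i)]. *)

(** * Taylor expansions of analytic functions *)

(** For [a > 0] the factor [(Im w) ^ - a] blows up along the whole real axis, faster than any
    positive harmonic function of the half plane can, so [ln |f|] gets no global majorant and every
    box needs a domain of its own. Above the cone of slope [k = c (h / rho) / (n + 1)], with
    [v = |w - tau i|], one has [(Im w) ^ - a <= k ^ - a v ^ - a]. What remains is a power of the
    distance to one point, dominated by Poisson kernels with poles at the depths [2 L / 2 ^ q],
    [q <= n], below that point. The divisor [n + 1] pays for the [n + 1] kernels that correct the
    Green functions along the cone: their sum at [i] must stay below a fixed fraction of the Green
    function. The price is a factor [(n + 1) ^ (1 + a)] in the count. With [gam = max 1 (a - u i)],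
    a box holding [M] zeros satisfies [h M <= C K (n + 1) ^ (1 + a) (h / rho) ^ - a rho ^ (1 -
    gam)]. Weighting each zero by [h ^ q rho ^ (e i)] and putting [h = rho / 2 ^ l] leaves
    [2 ^ (- l (q - 1 - a))] and [rho ^ (q + e i - gam)]; hence the two conditions on [q]. The
    bracket exponents of the theorem are built to meet the second one at [0] and at infinity. *)

Lemma is_series_Cmod_lim (u : nat -> C) (l : C) :
  @is_series C_AbsRing C_NormedModule u l ->
  forall e, 0 < e -> exists N, forall n, (N <= n)%nat ->
    Cmod (Cminus (@sum_n C_AbelianMonoid u n) l) < e.
Proof.
  intros H e he.
  unfold is_series in H.
  destruct (proj1 (filterlim_locally_ball_norm _ _) H (mkposreal e he)) as [N HN].
  exists N. intros n hn. exact (HN n hn).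
Qed.

Lemma bounded_from_tail (u : nat -> R) (B : R) (N : nat) :
  (forall k, (N <= k)%nat -> u k <= B) -> exists B', 0 <= B' /\ forall k, u k <= B'.
Proof.
  revert B. induction N as [|N IH]; intros B H.
  - exists (Rmax B 0). split; [apply Rmax_r|]. intros k.
    eapply Rle_trans; [apply (H k); lia | apply Rmax_l].
  - apply (IH (Rmax B (u N))). intros k hk.
    destruct (Nat.eq_dec k N) as [->|hne]; [apply Rmax_r|].
    eapply Rle_trans; [apply (H k); lia | apply Rmax_l].
Qed.

Lemma sum_n_SC (u : nat -> C) n :
  @sum_n C_AbelianMonoid u (S n) = Cplus (@sum_n C_AbelianMonoid u n) (u (S n)).
Proof. exact (sum_Sn u n). Qed.

Lemma pow_n_Cpow (z : C) (k : nat) : @pow_n C_Ring z k = Cpow z k.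
Proof. induction k as [|k IH]; simpl; [reflexivity|]. rewrite IH; reflexivity. Qed.

Lemma Cmod_minus_sym (x y : C) : Cmod (Cminus x y) = Cmod (Cminus y x).
Proof. rewrite <- Cmod_opp. f_equal. ring. Qed.

Lemma Cmod_triangle_minus (x y z : C) : Cmod (Cminus x z) <= Cmod (Cminus x y) + Cmod (Cminus y z).
Proof. replace (Cminus x z) with (Cplus (Cminus x y) (Cminus y z)) by ring. apply Cmod_triangle. Qed.

(** The subtracted term is what lets the induction close: with [p = x ^ (S n + j)] the next term is
    at most [B * p], and [B * p <= 2 * B * p - 2 * B * (x * p)] because [x <= / 2]. *)
Lemma geometric_tail (u : nat -> C) (B x : R) (n : nat) :
  0 <= B -> 0 <= x <= /2 ->
  (forall k, Cmod (u k) <= B * x ^ k) ->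
  forall j, Cmod (Cminus (@sum_n C_AbelianMonoid u (n + j)) (@sum_n C_AbelianMonoid u n))
     <= 2 * B * x ^ S n - 2 * B * x ^ (S n + j).
Proof.
  intros hB hx Hu. induction j as [|j IH].
  - rewrite Nat.add_0_r. replace (S n + 0)%nat with (S n) by lia.
    replace (Cminus _ _) with (RtoC 0) by ring. rewrite Cmod_0. lra.
  - replace (n + S j)%nat with (S (n + j)) by lia. rewrite sum_n_SC.
    replace (Cminus _ _) with
      (Cplus (Cminus (@sum_n C_AbelianMonoid u (n + j)) (@sum_n C_AbelianMonoid u n)) (u (S (n + j)))) by ring.
    eapply Rle_trans; [apply Cmod_triangle|].
    specialize (Hu (S (n + j))).
    replace (S n + S j)%nat with (S (S n + j)) by lia.
    change (S (n + j)) with (S n + j)%nat in Hu |- *.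
    rewrite <- (tech_pow_Rmult x (S n + j)).
    remember (x ^ (S n + j)) as p eqn:Ep. remember (x ^ S n) as p0.
    assert (0 <= p) by (rewrite Ep; apply pow_le; lra).
    assert (0 <= B * p) by (apply Rmult_le_pos; lra).
    assert (0 <= B * p * (1 - 2 * x)) by (apply Rmult_le_pos; lra).
    lra.
Qed.

(** Convergence at the single point [z + rho / 2] bounds [|a k| (rho / 2) ^ k]. For [|s| < rho / 4]
    the terms are then dominated by a geometric series of ratio at most [/ 2]. *)
Lemma power_series_remainder (a : nat -> C) (h : C -> C) (z : C) (rho : R) (n : nat) :
  0 < rho ->
  (forall w : C, Cmod (Cminus w z) < rho ->
     is_series (fun k => Cmult (a k) (pow_n (Cminus w z) k)) (h w)) ->
  exists M r, 0 < r /\ 0 <= M /\ forall s, Cmod s < r ->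
    Cmod (Cminus (h (Cplus z s)) (@sum_n C_AbelianMonoid (fun k => Cmult (a k) (Cpow s k)) n))
      <= M * Cmod s ^ S n.
Proof.
  intros hr Hs.
  assert (HS : forall s, Cmod s < rho ->
     @is_series C_AbsRing C_NormedModule (fun k => Cmult (a k) (Cpow s k)) (h (Cplus z s))).
  { intros s hs. assert (E : Cminus (Cplus z s) z = s) by ring.
    pose proof (Hs (Cplus z s)) as H. rewrite E in H.
    eapply is_series_ext; [|apply H; exact hs].
    intros k. simpl. rewrite pow_n_Cpow. reflexivity. }
  (* From some index on, two consecutive partial sums lie within [1] of the limit, so their
     difference, a single term, is at most [2]. *)
  assert (HB : exists B, 0 <= B /\ forall k, Cmod (a k) * (rho / 2) ^ k <= B).
  { assert (h0 : Cmod (RtoC (rho / 2)) < rho) by (rewrite Cmod_R, Rabs_pos_eq; lra).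
    destruct (is_series_Cmod_lim _ _ (HS _ h0) 1 Rlt_0_1) as [N HN].
    apply (bounded_from_tail _ 2 (S N)). intros k hk.
    destruct k as [|k]; [lia|].
    assert (h1 := HN k ltac:(lia)). assert (h2 := HN (S k) ltac:(lia)).
    rewrite sum_n_SC in h2.
    replace ((rho / 2) ^ S k) with (Cmod (Cpow (RtoC (rho / 2)) (S k)))
      by (rewrite Cmod_pow, Cmod_R, Rabs_pos_eq by lra; reflexivity).
    rewrite <- Cmod_mult.
    set (S1 := @sum_n C_AbelianMonoid _ k) in *. set (t := Cmult (a (S k)) _) in *.
    replace t with (Cplus (Cminus (Cplus S1 t) (h (Cplus z (RtoC (rho/2)))))
                          (Copp (Cminus S1 (h (Cplus z (RtoC (rho/2))))))) by ring.
    eapply Rle_trans; [apply Cmod_triangle|]. rewrite Cmod_opp. lra. }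
  destruct HB as [B [hB0 HB]].
  exists (2 * B * (2 / rho) ^ S n), (rho / 4).
  assert (hq : 0 < 2 / rho) by (apply Rdiv_lt_0_compat; lra).
  split; [lra|split].
  { apply Rmult_le_pos; [lra|]. apply pow_le; lra. }
  intros s hs.
  set (x := Cmod s * (2 / rho)).
  assert (hx : 0 <= x <= / 2).
  { split; [apply Rmult_le_pos; [apply Cmod_ge_0|lra]|]. unfold x.
    apply Rle_trans with (rho / 4 * (2 / rho)); [apply Rmult_le_compat_r; lra|].
    right; field; lra. }
  assert (hterm : forall k, Cmod (Cmult (a k) (Cpow s k)) <= B * x ^ k).
  { intros k. rewrite Cmod_mult, Cmod_pow.
    replace (Cmod s ^ k) with ((rho / 2) ^ k * x ^ k).
    2:{ rewrite <- Rpow_mult_distr. f_equal. unfold x. field. lra. }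
    rewrite <- Rmult_assoc. apply Rmult_le_compat_r; [apply pow_le; lra|apply HB]. }
  replace (2 * B * (2 / rho) ^ S n * Cmod s ^ S n) with (2 * B * x ^ S n).
  2:{ unfold x. rewrite Rpow_mult_distr. ring. }
  apply Rle_plus_epsilon. intros e he.
  destruct (is_series_Cmod_lim _ _ (HS s ltac:(lra)) e he) as [N HN].
  specialize (HN (n + N)%nat ltac:(lia)).
  pose proof (geometric_tail _ B x n hB0 hx hterm N) as HT.
  eapply Rle_trans; [apply (Cmod_triangle_minus _ (@sum_n C_AbelianMonoid (fun k => Cmult (a k) (Cpow s k)) (n + N)))|].
  rewrite Cmod_minus_sym in HN.
  assert (0 <= 2 * B * x ^ (S n + N)).
  { apply Rmult_le_pos; [lra|apply pow_le; lra]. }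
  lra.
Qed.

(** * Calculus of Landau remainders and second-order jets *)

(** Landau's [E s = O(|s| ^ k)] as [s] tends to [0]. For [k >= 1] the bound at [s = 0] itself forces
    [E 0 = 0]; this is how a zero of positive order is later seen to differ from the base point. *)
Definition small (k : nat) (E : C -> C) : Prop :=
  exists M r, 0 < r /\ 0 <= M /\ forall s, Cmod s < r -> Cmod (E s) <= M * Cmod s ^ k.

(** Second-order Taylor expansion with cubic remainder: all that the maximum principle uses of analyticity. *)
Definition jet (f : C -> C) (z : C) : Prop :=
  exists c1 c2, small 3 (fun s =>
    Cminus (f (Cplus z s)) (Cplus (f z) (Cplus (Cmult c1 s) (Cmult c2 (Cmult s s))))).

(** An upper bound on [|f|] near [z]: the form in which a zero competes with the logarithmic pole of
    a Green function. *)
Definition vanishes_to (f : C -> C) (z : C) (m : nat) : Prop :=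
  small m (fun s => f (Cplus z s)).

Lemma power_series_at_center (a : nat -> C) (h : C -> C) (z : C) (rho : R) :
  0 < rho ->
  (forall w : C, Cmod (Cminus w z) < rho ->
     is_series (fun k => Cmult (a k) (pow_n (Cminus w z) k)) (h w)) -> h z = a O.
Proof.
  intros hr H.
  destruct (power_series_remainder a h z rho 0 hr H) as [M [r [h0 [hM Hr]]]].
  specialize (Hr (RtoC 0) ltac:(rewrite Cmod_0; exact h0)).
  rewrite sum_O, Cmod_0 in Hr. simpl in Hr. rewrite Rmult_0_l, Rmult_0_r in Hr.
  assert (E : Cmod (Cminus (h (Cplus z (RtoC 0))) (Cmult (a O) (RtoC 1))) = 0)
    by (apply Rle_antisym; [exact Hr|apply Cmod_ge_0]).
  apply Cmod_eq_0 in E. replace (Cplus z (RtoC 0)) with z in E by ring.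
  replace (h z) with (Cplus (Cminus (h z) (Cmult (a O) (RtoC 1))) (a O)) by ring.
  rewrite E. ring.
Qed.

Lemma analytic_jet (h : C -> C) (z : C) : analytic_on_slit h -> ~ in_Rplus z -> jet h z.
Proof.
  intros Ha hz. destruct (Ha z hz) as [rho [hr [a H]]].
  pose proof (power_series_at_center a h z rho hr H) as E0.
  destruct (power_series_remainder a h z rho 2 hr H) as [M [r [h0 [hM Hr]]]].
  exists (a 1%nat), (a 2%nat), M, r. split; [exact h0|split;[exact hM|]].
  intros s hs. specialize (Hr s hs). rewrite !sum_n_SC, sum_O in Hr. rewrite E0.
  simpl in Hr.
  match goal with |- Cmod ?X <= _ => match type of Hr with Cmod ?Y <= _ => replace X with Y end end.
  - exact Hr.
  - ring.
Qed.

Lemma zero_order_vanishes (h : C -> C) (z : C) (m : nat) :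
  (1 <= m)%nat -> zero_order h z m -> vanishes_to h z m.
Proof.
  intros hm [rho [hr [a [H [Hk _]]]]].
  destruct m as [|m]; [lia|].
  destruct (power_series_remainder a h z rho m hr H) as [M [r [h0 [hM Hr]]]].
  exists M, r. split; [exact h0|split;[exact hM|]]. intros s hs. specialize (Hr s hs).
  replace (@sum_n C_AbelianMonoid (fun k => Cmult (a k) (Cpow s k)) m) with (RtoC 0) in Hr.
  - replace (h (Cplus z s)) with (Cminus (h (Cplus z s)) (RtoC 0)) by ring. exact Hr.
  - assert (G : forall j, (j <= m)%nat -> RtoC 0 = @sum_n C_AbelianMonoid (fun k => Cmult (a k) (Cpow s k)) j).
    { induction j as [|j IH]; intros hj.
      - rewrite sum_O, Hk by lia. ring.
      - rewrite sum_n_SC, <- IH, Hk by lia. ring. }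
    apply G. lia.
Qed.

Lemma small_ext k (E G : C -> C) : (forall s, E s = G s) -> small k E -> small k G.
Proof. intros H [M [r [h0 [hM Hr]]]]. exists M, r. split; [|split]; auto. intros s hs. rewrite <- H. auto. Qed.

Lemma small_plus k (E G : C -> C) : small k E -> small k G -> small k (fun s => Cplus (E s) (G s)).
Proof.
  intros [M [r [h0 [hM Hr]]]] [M' [r' [h0' [hM' Hr']]]].
  exists (M + M'), (Rmin r r'). split; [apply Rmin_pos; auto|split;[lra|]].
  intros s hs. assert (Cmod s < r) by (eapply Rlt_le_trans; [exact hs|apply Rmin_l]).
  assert (Cmod s < r') by (eapply Rlt_le_trans; [exact hs|apply Rmin_r]).
  eapply Rle_trans; [apply Cmod_triangle|]. rewrite Rmult_plus_distr_r.
  apply Rplus_le_compat; auto.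
Qed.

Lemma small_mult i j (E G : C -> C) : small i E -> small j G -> small (i + j) (fun s => Cmult (E s) (G s)).
Proof.
  intros [M [r [h0 [hM Hr]]]] [M' [r' [h0' [hM' Hr']]]].
  exists (M * M'), (Rmin r r'). split; [apply Rmin_pos; auto|split;[apply Rmult_le_pos; auto|]].
  intros s hs. assert (Cmod s < r) by (eapply Rlt_le_trans; [exact hs|apply Rmin_l]).
  assert (Cmod s < r') by (eapply Rlt_le_trans; [exact hs|apply Rmin_r]).
  rewrite Cmod_mult, pow_add.
  replace (M * M' * (Cmod s ^ i * Cmod s ^ j)) with ((M * Cmod s ^ i) * (M' * Cmod s ^ j)) by ring.
  apply Rmult_le_compat; auto using Cmod_ge_0.
Qed.

Lemma small_weaken i j (E : C -> C) : (j <= i)%nat -> small i E -> small j E.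
Proof.
  intros hij [M [r [h0 [hM Hr]]]].
  exists M, (Rmin r 1). split; [apply Rmin_pos; lra|split;[auto|]].
  intros s hs. assert (Cmod s < r) by (eapply Rlt_le_trans; [exact hs|apply Rmin_l]).
  assert (Cmod s < 1) by (eapply Rlt_le_trans; [exact hs|apply Rmin_r]).
  eapply Rle_trans; [apply Hr; auto|]. apply Rmult_le_compat_l; [auto|].
  replace i with (j + (i - j))%nat by lia. rewrite pow_add.
  rewrite <- (Rmult_1_r (Cmod s ^ j)) at 2.
  pose proof (Cmod_ge_0 s).
  apply Rmult_le_compat_l; [apply pow_le; auto|].
  rewrite <- (pow1 (i - j)). apply pow_incr. lra.
Qed.

Lemma small_const (c : C) : small 0 (fun _ => c).
Proof.
  exists (Cmod c), 1. split; [lra|split;[apply Cmod_ge_0|]]. intros. simpl. lra.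
Qed.

Lemma small_id : small 1 (fun s => s).
Proof. exists 1, 1. split; [lra|split;[lra|]]. intros. simpl. lra. Qed.

Lemma small_scal k (c : C) (E : C -> C) : small k E -> small k (fun s => Cmult c (E s)).
Proof. intros H. apply (small_mult 0 k _ _ (small_const c) H). Qed.

Lemma small_comp k (E sg : C -> C) : small k E -> small 1 sg -> small k (fun s => E (sg s)).
Proof.
  intros [M [r [h0 [hM Hr]]]] [M' [r' [h0' [hM' Hr']]]].
  (* The divisor [M' + 1] keeps the quotient meaningful when [M' = 0]. *)
  exists (M * M' ^ k), (Rmin r' (r / (M' + 1))).
  assert (0 < r / (M' + 1)) by (apply Rdiv_lt_0_compat; lra).
  split; [apply Rmin_pos; auto|split;[apply Rmult_le_pos; auto; apply pow_le; auto|]].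
  intros s hs. assert (hs1 : Cmod s < r') by (eapply Rlt_le_trans; [exact hs|apply Rmin_l]).
  assert (hs2 : Cmod s < r / (M' + 1)) by (eapply Rlt_le_trans; [exact hs|apply Rmin_r]).
  specialize (Hr' s hs1). simpl in Hr'. rewrite Rmult_1_r in Hr'.
  pose proof (Cmod_ge_0 s).
  assert (Cmod (sg s) < r).
  { apply (Rmult_lt_compat_r (M' + 1)) in hs2; [|lra].
    unfold Rdiv in hs2. rewrite Rmult_assoc, Rinv_l, Rmult_1_r in hs2 by lra. nra. }
  eapply Rle_trans; [apply Hr; auto|]. rewrite Rmult_assoc, <- Rpow_mult_distr.
  apply Rmult_le_compat_l; [auto|]. apply pow_incr. split; [apply Cmod_ge_0|auto].
Qed.

Lemma small_taylor (c1 c2 : C) (E : C -> C) : small 3 E ->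
  small 1 (fun s => Cplus (Cplus (Cmult c1 s) (Cmult c2 (Cmult s s))) (E s)).
Proof.
  intros H. apply small_plus; [apply small_plus|].
  - apply small_scal, small_id.
  - apply small_scal. apply (small_weaken 2 1); [lia|]. apply (small_mult 1 1); apply small_id.
  - apply (small_weaken 3 1); [lia|exact H].
Qed.

Lemma jet_small1 f z : jet f z -> small 1 (fun s => Cminus (f (Cplus z s)) (f z)).
Proof.
  intros [c1 [c2 H]]. eapply small_ext; [|apply (small_taylor c1 c2 _ H)]. intros s; simpl. ring.
Qed.

Lemma jet_ext f g z : (forall w, f w = g w) -> jet f z -> jet g z.
Proof.
  intros H [c1 [c2 [M [r [h0 [hM Hr]]]]]]. exists c1, c2, M, r. split;[|split]; auto.
  intros s hs. rewrite <- !H. auto.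
Qed.

(** With [sg s = F (z + s) - F z = d1 s + O(s^2)], the quadratic error is [c2 (sg^2 - d1^2 s^2) = c2
    (sg - d1 s) (sg + d1 s)], a product of an [O(s^2)] and an [O(s)]. *)
Lemma jet_comp (h F : C -> C) (z : C) : jet F z -> jet h (F z) -> jet (fun w => h (F w)) z.
Proof.
  intros HF. pose proof (jet_small1 F z HF) as Hsg. destruct HF as [d1 [d2 HF]].
  intros [c1 [c2 Hh]].
  exists (Cmult c1 d1), (Cplus (Cmult c1 d2) (Cmult c2 (Cmult d1 d1))).
  set (sg := fun s => Cminus (F (Cplus z s)) (F z)) in *.
  pose proof (small_comp _ _ _ Hh Hsg) as H1. unfold sg in H1 at 1.
  set (EF := fun s => Cminus (F (Cplus z s)) (Cplus (F z) (Cplus (Cmult d1 s) (Cmult d2 (Cmult s s))))) in *.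
  assert (H2 : small 2 (fun s => Cplus (Cmult d2 (Cmult s s)) (EF s))).
  { apply small_plus; [apply small_scal, (small_mult 1 1); apply small_id|].
    apply (small_weaken 3); [lia|exact HF]. }
  assert (H3 : small 1 (fun s => Cplus (sg s) (Cmult d1 s))).
  { apply small_plus; [exact Hsg|apply small_scal, small_id]. }
  pose proof (small_plus _ _ _ H1 (small_plus _ _ _ (small_scal 3 c1 _ HF)
     (small_scal 3 c2 _ (small_mult 2 1 _ _ H2 H3)))) as H4.
  eapply small_ext; [|exact H4]. intros s. unfold sg, EF. simpl.
  replace (Cplus (F z) (Cminus (F (Cplus z s)) (F z))) with (F (Cplus z s)) by ring.
  ring.
Qed.

Lemma jet_const c z : jet (fun _ => c) z.
Proof.
  exists (RtoC 0), (RtoC 0). apply (small_ext 3 (fun _ => RtoC 0)).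
  - intros s; ring.
  - exists 0, 1. split; [lra|split;[lra|]]. intros. rewrite Cmod_0. lra.
Qed.

Lemma jet_id z : jet (fun w => w) z.
Proof.
  exists (RtoC 1), (RtoC 0). apply (small_ext 3 (fun _ => RtoC 0)).
  - intros s; ring.
  - exists 0, 1. split; [lra|split;[lra|]]. intros. rewrite Cmod_0. lra.
Qed.

Lemma jet_plus f g z : jet f z -> jet g z -> jet (fun w => Cplus (f w) (g w)) z.
Proof.
  intros [c1 [c2 H]] [d1 [d2 G]]. exists (Cplus c1 d1), (Cplus c2 d2).
  eapply small_ext; [|exact (small_plus _ _ _ H G)]. intros s; simpl. ring.
Qed.

Lemma jet_mult f g z : jet f z -> jet g z -> jet (fun w => Cmult (f w) (g w)) z.
Proof.
  intros Hf Hg.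
  pose proof (jet_small1 _ _ Hf) as Sf. pose proof (jet_small1 _ _ Hg) as Sg.
  destruct Hf as [c1 [c2 H]], Hg as [d1 [d2 G]].
  exists (Cplus (Cmult (f z) d1) (Cmult c1 (g z))),
    (Cplus (Cplus (Cmult (f z) d2) (Cmult c2 (g z))) (Cmult c1 d1)).
  set (Ef := fun s => Cminus (f (Cplus z s)) _) in H.
  set (Eg := fun s => Cminus (g (Cplus z s)) _) in G.
  assert (Hf2 : small 2 (fun s => Cplus (Cmult c2 (Cmult s s)) (Ef s))).
  { apply small_plus; [apply small_scal, (small_mult 1 1); apply small_id|].
    apply (small_weaken 3); [lia|exact H]. }
  assert (Hg2 : small 2 (fun s => Cplus (Cmult d2 (Cmult s s)) (Eg s))).
  { apply small_plus; [apply small_scal, (small_mult 1 1); apply small_id|].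
    apply (small_weaken 3); [lia|exact G]. }
  (* (c1 s + A)(d1 s + B) - c1 d1 s^2 = A (g(z+s)-g z) + c1 s B *)
  pose proof (small_plus _ _ _ (small_mult 2 1 _ _ Hf2 Sg)
     (small_mult 1 2 _ _ (small_scal 1 c1 _ small_id) Hg2)) as H1.
  pose proof (small_plus _ _ _ H1 (small_plus _ _ _ (small_scal 3 (f z) _ G) (small_scal 3 (g z) _ H))) as H2.
  eapply small_ext; [|exact H2]. intros s; unfold Ef, Eg; simpl. ring.
Qed.

(** The remainder is explicit, [- s^3 / (z^3 (z + s))], and [|z + s| >= |z| / 2] on the chosen
    disc. *)
Lemma jet_inv z : z <> RtoC 0 -> jet (fun w => Cinv w) z.
Proof.
  intros hz. assert (hz0 := proj1 (Cmod_gt_0 z) hz).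
  exists (Copp (Cinv (Cmult z z))), (Cinv (Cmult z (Cmult z z))).
  exists (2 / Cmod z ^ 4), (Cmod z / 2).
  split; [lra|split].
  { apply Rlt_le, Rdiv_lt_0_compat; [lra|apply pow_lt; auto]. }
  intros s hs.
  assert (hzs : Cmod z / 2 <= Cmod (Cplus z s)).
  { pose proof (Cmod_triangle (Cplus z s) (Copp s)) as T. rewrite Cmod_opp in T.
    replace (Cplus (Cplus z s) (Copp s)) with z in T by ring. lra. }
  assert (hzs0 : Cplus z s <> RtoC 0) by (apply Cmod_gt_0; lra).
  replace (Cminus _ _) with (Cdiv (Copp (Cmult s (Cmult s s))) (Cmult (Cmult z (Cmult z z)) (Cplus z s))).
  2:{ field. auto. }
  rewrite Cmod_div.
  2:{ apply Cmult_neq_0; auto. apply Cmult_neq_0; auto. apply Cmult_neq_0; auto. }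
  rewrite Cmod_opp, !Cmod_mult.
  pose proof (Cmod_ge_0 s) as hs0.
  set (x := Cmod s) in *. set (y := Cmod z) in *. set (t := Cmod (Cplus z s)) in *.
  replace (x * (x * x) / (y * (y * y) * t)) with (x ^ 3 / (y ^ 3) * / t) by (field; lra).
  replace (2 / y ^ 4 * x ^ 3) with (x ^ 3 / y ^ 3 * (2 / y)) by (field; lra).
  apply Rmult_le_compat_l.
  - apply Rmult_le_pos; [apply pow_le; auto|apply Rlt_le, Rinv_0_lt_compat, pow_lt; auto].
  - replace (2 / y) with (/ (y / 2)) by (field; lra). apply Rinv_le_contravar; lra.
Qed.

Lemma jet_shift c z : jet (fun w => Cminus w c) z.
Proof. apply (jet_plus (fun w => w) (fun _ => Copp c)); [apply jet_id|apply jet_const]. Qed.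

Lemma jet_inv_comp f z : jet f z -> f z <> RtoC 0 -> jet (fun w => Cinv (f w)) z.
Proof. intros Hf h0. apply (jet_comp Cinv f); [exact Hf|apply jet_inv; exact h0]. Qed.

Lemma vanishes_to_comp (h F : C -> C) z m : jet F z -> vanishes_to h (F z) m ->
  vanishes_to (fun w => h (F w)) z m.
Proof.
  intros HF Hh. pose proof (small_comp _ _ _ Hh (jet_small1 _ _ HF)) as H.
  eapply small_ext; [|exact H]. intros s; simpl. f_equal. ring.
Qed.

(** Since [1], [-1], [i], [-i] and their squares sum to [0], the linear and quadratic terms of a Taylor
    expansion cancel in [cross], so it is [O(r^3)] for [Im g] and [ln |g|], while it is [4 r^2] for [|w|^2]. *)
Definition cross (F : C -> R) (z : C) (r : R) : R :=
  F (Cplus z (RtoC r)) + F (Cminus z (RtoC r)) + F (Cplus z (Cmult Ci (RtoC r)))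
  + F (Cminus z (Cmult Ci (RtoC r))) - 4 * F z.

(** For a twice continuously differentiable [F] the quotient [cross F z r / r ^ 2] tends to the
    Laplacian, so this is a pointwise form of harmonicity free of derivatives. *)
Definition harm (F : C -> R) (z : C) : Prop :=
  exists M r0, 0 < r0 /\ 0 <= M /\ forall r, 0 < r < r0 -> Rabs (cross F z r) <= M * r ^ 3.

Lemma harm_ext F G z : (forall w, F w = G w) -> harm F z -> harm G z.
Proof.
  intros H [M [r0 [h0 [hM Hr]]]]. exists M, r0. split;[|split]; auto.
  intros r hr. unfold cross. rewrite <- !H. apply Hr; auto.
Qed.

Lemma harm_plus F G z : harm F z -> harm G z -> harm (fun w => F w + G w) z.
Proof.
  intros [M [r [h0 [hM Hr]]]] [M' [r' [h0' [hM' Hr']]]].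
  exists (M + M'), (Rmin r r'). split; [apply Rmin_pos; auto|split;[lra|]].
  intros s [hs0 hs]. assert (s < r) by (eapply Rlt_le_trans; [exact hs|apply Rmin_l]).
  assert (s < r') by (eapply Rlt_le_trans; [exact hs|apply Rmin_r]).
  replace (cross _ z s) with (cross F z s + cross G z s) by (unfold cross; ring).
  eapply Rle_trans; [apply Rabs_triang|]. rewrite Rmult_plus_distr_r.
  apply Rplus_le_compat; auto.
Qed.

Lemma harm_scal c F z : harm F z -> harm (fun w => c * F w) z.
Proof.
  intros [M [r [h0 [hM Hr]]]]. exists (Rabs c * M), r.
  split; [auto|split;[apply Rmult_le_pos; auto; apply Rabs_pos|]].
  intros s hs. replace (cross _ z s) with (c * cross F z s) by (unfold cross; ring).
  rewrite Rabs_mult, Rmult_assoc. apply Rmult_le_compat_l; [apply Rabs_pos|auto].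
Qed.

Lemma harm_const c z : harm (fun _ => c) z.
Proof.
  exists 0, 1. split;[lra|split;[lra|]]. intros. unfold cross.
  replace (c + c + c + c - 4 * c) with 0 by ring. rewrite Rabs_R0. lra.
Qed.

Lemma Cmod_RtoC_pos r : 0 < r -> Cmod (RtoC r) = r.
Proof. intros. rewrite Cmod_R. apply Rabs_pos_eq. lra. Qed.

(** [l] stands for [Im] or [Re]. Additivity moves the four increments inside [l], where the linear
    terms cancel in opposite pairs and the quadratic ones because [Ci] squares to [-1]; only the
    four cubic errors survive. *)
Lemma harm_of_expansion (F : C -> R) (l : C -> R) (z c1 c2 : C) :
  (forall x y, l (Cplus x y) = l x + l y) ->
  small 3 (fun s => RtoC (F (Cplus z s) - F z - l (Cplus (Cmult c1 s) (Cmult c2 (Cmult s s))))) ->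
  harm F z.
Proof.
  intros Hl [M [r0 [h0 [hM Hr]]]]. exists (4 * M), r0. split;[auto|split;[lra|]].
  intros r [hr hr0].
  set (t := fun s => Cplus (Cmult c1 s) (Cmult c2 (Cmult s s))).
  set (e := fun s => F (Cplus z s) - F z - l (t s)).
  assert (He : forall s, Cmod s = r -> Rabs (e s) <= M * r ^ 3).
  { intros s hs. specialize (Hr s ltac:(lra)). rewrite Cmod_R, hs in Hr. exact Hr. }
  set (s1 := RtoC r). set (s2 := Copp (RtoC r)). set (s3 := Cmult Ci (RtoC r)). set (s4 := Copp (Cmult Ci (RtoC r))).
  assert (m1 : Cmod s1 = r) by (apply Cmod_RtoC_pos; auto).
  assert (m2 : Cmod s2 = r) by (unfold s2; rewrite Cmod_opp; apply Cmod_RtoC_pos; auto).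
  assert (m3 : Cmod s3 = r) by (unfold s3; rewrite Cmod_mult, Cmod_Ci, Cmod_RtoC_pos; auto; ring).
  assert (m4 : Cmod s4 = r) by (unfold s4; rewrite Cmod_opp; exact m3).
  pose proof (He s1 m1). pose proof (He s2 m2). pose proof (He s3 m3). pose proof (He s4 m4).
  assert (l0 : l (RtoC 0) = 0).
  { pose proof (Hl (RtoC 0) (RtoC 0)) as E. replace (Cplus (RtoC 0) (RtoC 0)) with (RtoC 0) in E by ring. lra. }
  assert (Esum : l (t s1) + l (t s2) + l (t s3) + l (t s4) = 0).
  { rewrite <- !Hl, <- l0. f_equal. unfold t, s1, s2, s3, s4.
    assert (Eii : Cmult Ci Ci = Copp (RtoC 1)) by (apply injective_projections; simpl; ring).
    replace (Cmult (Cmult Ci (RtoC r)) (Cmult Ci (RtoC r))) with (Cmult (Cmult Ci Ci) (Cmult (RtoC r) (RtoC r))) by ring.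
    replace (Cmult (Copp (Cmult Ci (RtoC r))) (Copp (Cmult Ci (RtoC r)))) with (Cmult (Cmult Ci Ci) (Cmult (RtoC r) (RtoC r))) by ring.
    rewrite Eii. ring. }
  replace (cross F z r) with (e s1 + e s2 + e s3 + e s4).
  - unfold Rabs in *. repeat destruct Rcase_abs in *; lra.
  - unfold cross, e.
    change (Cminus z (RtoC r)) with (Cplus z s2). change (Cminus z (Cmult Ci (RtoC r))) with (Cplus z s4).
    fold s3. fold s1. lra.
Qed.

Lemma small_real k (E : C -> R) (G : C -> C) : (forall s, Rabs (E s) <= Cmod (G s)) -> small k G -> small k (fun s => RtoC (E s)).
Proof.
  intros H [M [r [h0 [hM Hr]]]]. exists M, r. split;[|split]; auto. intros s hs.
  rewrite Cmod_R. eapply Rle_trans; [apply H|auto].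
Qed.

Lemma Im_le_Cmod (z : C) : Rabs (Im z) <= Cmod z.
Proof. eapply Rle_trans; [apply Rmax_r|apply (Rmax_Cmod z)]. Qed.

Lemma harm_Im g z : jet g z -> harm (fun w => Im (g w)) z.
Proof.
  intros [c1 [c2 H]].
  apply (harm_of_expansion _ Im z c1 c2).
  - reflexivity.
  - eapply small_real; [|exact H]. intros s. simpl.
    eapply Rle_trans; [|apply Im_le_Cmod]. right. f_equal. unfold Cminus, Cplus, Copp, Im; simpl. ring.
Qed.

(** The difference has derivative [t * t / (1 + t)], which is at most [2 q^2] in modulus between [0]
    and [q]; the mean value theorem supplies the third factor [q]. *)
Lemma ln_1p_bounds q : Rabs q <= / 2 -> Rabs (ln (1 + q) - (q - q * q / 2)) <= 2 * Rabs q ^ 3.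
Proof.
  intros hq0. assert (hq := hq0). apply Rabs_le_between in hq.
  set (g := fun t => ln (1 + t) - (t - t * t / 2)).
  assert (Hd : forall t, - / 2 <= t <= /2 -> is_derive g t (t * t / (1 + t))).
  { intros t ht. unfold g. auto_derive; [lra|]. field. lra. }
  assert (g0 : g 0 = 0) by (unfold g; rewrite Rplus_0_r, ln_1; field).
  assert (hmm : forall x, Rmin 0 q <= x <= Rmax 0 q -> - /2 <= x <= /2 /\ Rabs x <= Rabs q).
  { intros x hx. destruct (Rle_dec 0 q).
    - rewrite Rmin_left, Rmax_right in hx by lra. split; [lra|]. rewrite !Rabs_pos_eq; lra.
    - rewrite Rmin_right, Rmax_left in hx by lra. split; [lra|]. rewrite !Rabs_left1; lra. }
  destruct (MVT_gen g 0 q (fun t => t * t / (1 + t))) as [x [hx E]].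
  - intros x hx. apply Hd, hmm. lra.
  - intros x hx. apply derivable_continuous_pt. exists (x * x / (1 + x)).
    apply is_derive_Reals, Hd, hmm, hx.
  - fold (g q). rewrite g0, !Rminus_0_r in E. rewrite E.
    destruct (hmm x hx) as [hx2 hx3].
    rewrite Rabs_mult. simpl. rewrite Rmult_1_r.
    replace (2 * (Rabs q * (Rabs q * Rabs q))) with ((2 * (Rabs q * Rabs q)) * Rabs q) by ring.
    apply Rmult_le_compat_r; [apply Rabs_pos|].
    unfold Rdiv. rewrite !Rabs_mult, (Rabs_pos_eq (/ (1 + x))) by (apply Rlt_le, Rinv_0_lt_compat; lra).
    rewrite Rmult_comm. apply Rmult_le_compat.
    + apply Rlt_le, Rinv_0_lt_compat; lra.
    + apply Rmult_le_pos; apply Rabs_pos.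
    + rewrite <- (Rinv_inv 2). apply Rinv_le_contravar; lra.
    + apply Rmult_le_compat; auto using Rabs_pos.
Qed.

(** With [e = x + i y], [r = |e|], one has [|1 + e|^2 = 1 + q] for [q = 2 x + r^2], and
    [(q - q^2 / 2) / 2] equals [Re (e - e^2 / 2)] up to [x r^2 + r^4 / 4]. Since [|q| <= 13/6 r],
    the logarithm costs [(13/6)^3 r^3]; the constant [60] is generous. *)
Lemma ln_Cmod_expansion (e : C) : Cmod e <= / 6 ->
  Rabs (ln (Cmod (Cplus (RtoC 1) e)) - Re (Cminus e (Cmult (RtoC (/2)) (Cmult e e)))) <= 60 * Cmod e ^ 3.
Proof.
  intros he. pose proof (Cmod_ge_0 e) as hr0.
  destruct e as [x y]. set (r := Cmod (x, y)) in *.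
  assert (hr2 : r ^ 2 = x * x + y * y).
  { unfold r. rewrite Cmod2_alt. simpl. ring. }
  assert (hx : Rabs x <= r) by exact (re_le_Cmod (x, y)).
  set (q := 2 * x + r ^ 2).
  assert (hqr : Rabs q <= 13 / 6 * r).
  { unfold q. eapply Rle_trans; [apply Rabs_triang|].
    rewrite Rabs_mult, (Rabs_pos_eq 2) by lra. rewrite (Rabs_pos_eq (r ^ 2)) by (apply pow_le; auto). nra. }
  assert (hq : Rabs q <= /2) by lra.
  pose proof (ln_1p_bounds q hq) as HL.
  assert (E : ln (Cmod (Cplus (RtoC 1) (x, y))) = / 2 * ln (1 + q)).
  { unfold Cmod. simpl. rewrite <- Rpower_sqrt.
    - unfold Rpower. rewrite ln_exp. f_equal. f_equal. unfold q. rewrite hr2. ring.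
    - apply Rabs_le_between in hq. unfold q in hq. rewrite hr2 in hq. nra. }
  rewrite E.
  assert (E2 : / 2 * ln (1 + q) - Re (Cminus (x, y) (Cmult (RtoC (/ 2)) (Cmult (x, y) (x, y))))
     = / 2 * (ln (1 + q) - (q - q * q / 2)) - (x * r ^ 2 + r ^ 4 / 4)).
  { simpl. replace (r * (r * (r * (r * 1)))) with ((r ^ 2) * (r^2)) by ring. unfold q. simpl in hr2 |- *. rewrite hr2. field. }
  rewrite E2. unfold Rminus at 1. eapply Rle_trans; [apply Rabs_triang|].
  rewrite Rabs_Ropp, Rabs_mult, (Rabs_pos_eq (/2)) by lra.
  assert (H1 : Rabs q ^ 3 <= (13/6 * r)^3) by (apply pow_incr; split; [apply Rabs_pos|exact hqr]).
  assert (H2 : Rabs (x * r ^ 2 + r ^ 4 / 4) <= 2 * r ^ 3).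
  { eapply Rle_trans; [apply Rabs_triang|]. rewrite Rabs_mult.
    rewrite (Rabs_pos_eq (r ^ 2)) by (apply pow_le; auto).
    rewrite (Rabs_pos_eq (r ^ 4 / 4)) by (apply Rmult_le_pos; [apply pow_le; auto|lra]).
    assert (0 <= r ^ 2) by (apply pow_le; auto). assert (0 <= r ^ 3) by (apply pow_le; auto).
    replace (r ^ 3) with (r * r ^ 2) by ring. replace (r ^ 4) with (r * (r * r ^ 2)) by ring.
    assert (Rabs x * r ^ 2 <= r * r ^ 2) by (apply Rmult_le_compat_r; auto).
    assert (r * (r * r ^ 2) <= 1 * (r * r ^ 2)).
    { apply Rmult_le_compat_r; [apply Rmult_le_pos; auto|lra]. }
    nra. }
  assert (0 <= r ^ 3) by (apply pow_le; auto).
  replace ((13/6*r)^3) with ((13/6)^3 * r ^ 3) in H1 by ring.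
  simpl ((13/6)^3) in H1. lra.
Qed.

(** Factor [g (z + s) = g z (1 + e (z + s))] with [e] vanishing at [z]. Up to a constant [ln |g|] is
    then [ln |1 + e|], which agrees to third order with the real part of [e - e^2 / 2], and that
    function has a jet. *)
Lemma harm_ln_Cmod g z : jet g z -> g z <> RtoC 0 -> harm (fun w => ln (Cmod (g w))) z.
Proof.
  intros Hj h0.
  set (e := fun w => Cmult (Cinv (g z)) (Cminus (g w) (g z))).
  assert (He : jet e z).
  { apply (jet_mult (fun _ => Cinv (g z))); [apply jet_const|].
    apply (jet_plus g (fun _ => Copp (g z))); [exact Hj|apply jet_const]. }
  assert (HG : jet (fun w => Cminus (e w) (Cmult (RtoC (/2)) (Cmult (e w) (e w)))) z).
  { apply (jet_ext (fun w => Cplus (e w) (Cmult (RtoC (- /2)) (Cmult (e w) (e w))))).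
    - intros w. rewrite RtoC_opp. ring.
    - apply jet_plus; [exact He|]. apply (jet_mult (fun _ => RtoC (- /2))); [apply jet_const|].
      apply jet_mult; exact He. }
  destruct HG as [c1 [c2 HG]].
  assert (ez : e z = RtoC 0) by (unfold e; ring).
  assert (Hes : small 1 (fun s => e (Cplus z s))).
  { eapply small_ext; [|apply (jet_small1 _ _ He)]. intros s. simpl. rewrite ez. ring. }
  apply (harm_of_expansion _ Re z c1 c2); [reflexivity|].
  assert (HL : small 3 (fun t => RtoC (ln (Cmod (Cplus (RtoC 1) t)) - Re (Cminus t (Cmult (RtoC (/2)) (Cmult t t)))))).
  { exists 60, (/6). split; [lra|split;[lra|]]. intros t ht. rewrite Cmod_R. apply ln_Cmod_expansion. lra. }
  pose proof (small_comp _ _ _ HL Hes) as H1.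
  destruct (small_plus _ _ _ H1 (small_real 3 (fun s => Re (Cminus
      (Cminus (e (Cplus z s)) (Cmult (RtoC (/2)) (Cmult (e (Cplus z s)) (e (Cplus z s)))))
      (Cplus (Cminus (e z) (Cmult (RtoC (/2)) (Cmult (e z) (e z)))) (Cplus (Cmult c1 s) (Cmult c2 (Cmult s s))))
      )) _ (fun s => re_le_Cmod _) HG)) as [M [r [hr [hM HM]]]].
  destruct Hes as [M1 [r1 [hr1 [hM1 Hes]]]].
  (* Within [r2] one has [|e| < 1], so [1 + e] is nonzero and the logarithm of the product
     splits. *)
  set (r2 := / (2 * (M1 + 1))).
  assert (hr2 : 0 < r2) by (apply Rinv_0_lt_compat; lra).
  exists M, (Rmin r (Rmin r1 r2)). split; [repeat apply Rmin_pos; auto|split;[auto|]].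
  intros s hs.
  assert (hsr : Cmod s < r) by (eapply Rlt_le_trans; [exact hs|apply Rmin_l]).
  assert (hs1 : Cmod s < r1) by (eapply Rlt_le_trans; [exact hs|eapply Rle_trans;[apply Rmin_r|apply Rmin_l]]).
  assert (hs2 : Cmod s < r2) by (eapply Rlt_le_trans; [exact hs|eapply Rle_trans;[apply Rmin_r|apply Rmin_r]]).
  specialize (HM s hsr). specialize (Hes s hs1).
  assert (hem : Cmod (e (Cplus z s)) < 1).
  { simpl in Hes. rewrite Rmult_1_r in Hes. pose proof (Cmod_ge_0 s).
    apply (Rmult_lt_compat_r (2 * (M1 + 1))) in hs2; [|lra]. unfold r2 in hs2. rewrite Rinv_l in hs2 by lra. nra. }
  rewrite <- RtoC_plus in HM.
  eapply Rle_trans; [|exact HM]. right. f_equal. f_equal.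
  assert (Eg : g (Cplus z s) = Cmult (g z) (Cplus (RtoC 1) (e (Cplus z s)))).
  { unfold e. field. exact h0. }
  rewrite Eg, Cmod_mult, ln_mult.
  - rewrite ez. simpl. ring.
  - apply Cmod_gt_0; exact h0.
  - apply Rlt_le_trans with (1 - Cmod (e (Cplus z s))); [lra|].
    pose proof (Cmod_triangle (Cplus (RtoC 1) (e (Cplus z s))) (Copp (e (Cplus z s)))) as T.
    rewrite Cmod_opp in T. replace (Cplus (Cplus (RtoC 1) (e (Cplus z s))) (Copp (e (Cplus z s)))) with (RtoC 1) in T by ring.
    rewrite Cmod_1 in T. lra.
Qed.

(** * The maximum principle *)

Definition cont (F : C -> R) (w : C) : Prop :=
  forall e, 0 < e -> exists r, 0 < r /\ forall v, Cmod (Cminus v w) < r -> Rabs (F v - F w) < e.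

Lemma cont_ext F G w : (forall v, F v = G v) -> cont F w -> cont G w.
Proof. intros H HF e he. destruct (HF e he) as [r [hr Hr]]. exists r; split; auto. intros v hv. rewrite <- !H. auto. Qed.

Lemma cont_const c w : cont (fun _ => c) w.
Proof. intros e he. exists 1. split; [lra|]. intros. rewrite Rminus_diag, Rabs_R0. exact he. Qed.

Lemma cont_plus F G w : cont F w -> cont G w -> cont (fun v => F v + G v) w.
Proof.
  intros HF HG e he. destruct (HF (e/2) ltac:(lra)) as [r [hr Hr]]. destruct (HG (e/2) ltac:(lra)) as [r' [hr' Hr']].
  exists (Rmin r r'). split; [apply Rmin_pos; auto|]. intros v hv.
  specialize (Hr v ltac:(eapply Rlt_le_trans; [exact hv|apply Rmin_l])).
  specialize (Hr' v ltac:(eapply Rlt_le_trans; [exact hv|apply Rmin_r])).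
  replace (F v + G v - (F w + G w)) with ((F v - F w) + (G v - G w)) by ring.
  eapply Rle_lt_trans; [apply Rabs_triang|]. lra.
Qed.

Lemma cont_comp (g : R -> R) F w : cont F w -> continuity_pt g (F w) -> cont (fun v => g (F v)) w.
Proof.
  intros HF Hg e he. destruct (Hg e he) as [d [hd Hd]].
  destruct (HF d hd) as [r [hr Hr]]. exists r. split; auto. intros v hv.
  destruct (Req_dec (F v) (F w)) as [E|E].
  - rewrite E, Rminus_diag, Rabs_R0. exact he.
  - apply (Hd (F v)). split; [split; [exact I|auto]|]. apply Hr; auto.
Qed.

Lemma cont_scal c F w : cont F w -> cont (fun v => c * F v) w.
Proof.
  intros HF. apply (cont_comp (fun x => c * x) F w HF).
  apply derivable_continuous_pt, derivable_pt_scal, derivable_pt_id.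
Qed.

(** Polarization reduces products to squares, which [cont_comp] handles. *)
Lemma cont_mult F G w : cont F w -> cont G w -> cont (fun v => F v * G v) w.
Proof.
  intros HF HG.
  assert (sq : forall H, cont H w -> cont (fun v => H v * H v) w).
  { intros H HH. apply (cont_comp (fun x => x * x) H w HH). apply derivable_continuous_pt. reg. }
  apply (cont_ext (fun v => /2 * ((F v + G v) * (F v + G v)) + (-/2) * (F v * F v) + (-/2) * (G v * G v))).
  - intros v. field.
  - apply cont_plus; [apply cont_plus|]; apply cont_scal; apply sq; auto. apply cont_plus; auto.
Qed.

Lemma cont_lipschitz F w : (forall v, Rabs (F v - F w) <= Cmod (Cminus v w)) -> cont F w.
Proof. intros H e he. exists e. split; auto. intros v hv. eapply Rle_lt_trans; [apply H|auto]. Qed.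

Lemma Cmod_diff_le (x y : C) : Rabs (Cmod x - Cmod y) <= Cmod (Cminus x y).
Proof.
  apply Rabs_le. pose proof (Cmod_triangle (Cminus x y) y) as H1.
  pose proof (Cmod_triangle (Cminus y x) x) as H2. rewrite (Cmod_minus_sym y x) in H2.
  replace (Cplus (Cminus x y) y) with x in H1 by ring. replace (Cplus (Cminus y x) x) with y in H2 by ring. lra.
Qed.

Lemma cont_Cmod_shift c w : cont (fun v => Cmod (Cminus v c)) w.
Proof.
  apply cont_lipschitz. intros v. eapply Rle_trans; [apply Cmod_diff_le|]. right. f_equal. ring.
Qed.

Lemma cont_Cmod w : cont Cmod w.
Proof. apply cont_lipschitz. intros v. apply Cmod_diff_le. Qed.

Lemma cont_Im w : cont Im w.
Proof. apply cont_lipschitz. intros v. apply (Im_le_Cmod (Cminus v w)). Qed.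

Lemma jet_cont_real (l : C -> R) g w : (forall x y, Rabs (l x - l y) <= Cmod (Cminus x y)) -> jet g w -> cont (fun v => l (g v)) w.
Proof.
  intros Hl Hj e he. destruct (jet_small1 _ _ Hj) as [M [r [hr [hM HM]]]].
  exists (Rmin r (e / (M + 1))).
  assert (0 < e / (M + 1)) by (apply Rdiv_lt_0_compat; lra).
  split; [apply Rmin_pos; auto|]. intros v hv.
  assert (hv1 : Cmod (Cminus v w) < r) by (eapply Rlt_le_trans; [exact hv|apply Rmin_l]).
  assert (hv2 : Cmod (Cminus v w) < e / (M + 1)) by (eapply Rlt_le_trans; [exact hv|apply Rmin_r]).
  specialize (HM _ hv1). replace (Cplus w (Cminus v w)) with v in HM by ring. simpl in HM. rewrite Rmult_1_r in HM.
  eapply Rle_lt_trans; [apply Hl|]. eapply Rle_lt_trans; [exact HM|].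
  pose proof (Cmod_ge_0 (Cminus v w)).
  apply (Rmult_lt_compat_r (M + 1)) in hv2; [|lra]. unfold Rdiv in hv2. rewrite Rmult_assoc, Rinv_l, Rmult_1_r in hv2 by lra. nra.
Qed.

Lemma jet_cont_Cmod g w : jet g w -> cont (fun v => Cmod (g v)) w.
Proof. apply jet_cont_real, Cmod_diff_le. Qed.

Definition good (F : C -> R) (w : C) : Prop := cont F w /\ harm F w.

Lemma good_ext F G w : (forall v, F v = G v) -> good F w -> good G w.
Proof. intros H [a b]. split; [eapply cont_ext|eapply harm_ext]; eauto. Qed.
Lemma good_const c w : good (fun _ => c) w.
Proof. split; [apply cont_const|apply harm_const]. Qed.
Lemma good_plus F G w : good F w -> good G w -> good (fun v => F v + G v) w.
Proof. intros [a b] [a' b']. split; [apply cont_plus|apply harm_plus]; auto. Qed.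
Lemma good_scal c F w : good F w -> good (fun v => c * F v) w.
Proof. intros [a b]. split; [apply cont_scal|apply harm_scal]; auto. Qed.
Lemma good_Im g w : jet g w -> good (fun v => Im (g v)) w.
Proof.
  intros H. split; [|apply harm_Im; auto].
  apply (jet_cont_real Im g w); auto. intros x y. apply (Im_le_Cmod (Cminus x y)).
Qed.
Lemma good_ln_Cmod g w : jet g w -> g w <> RtoC 0 -> good (fun v => ln (Cmod (g v))) w.
Proof.
  intros H h0. split; [|apply harm_ln_Cmod; auto].
  apply (cont_comp ln (fun v => Cmod (g v))); [apply jet_cont_Cmod; auto|].
  apply derivable_continuous_pt. exists (/ Cmod (g w)). apply derivable_pt_lim_ln. apply Cmod_gt_0; auto.
Qed.

Lemma Cmod_lt_of_parts (w : C) d : 0 < d -> Rabs (Re w) < d -> Rabs (Im w) < d -> Cmod w < 2 * d.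
Proof.
  intros hd h1 h2. apply Rsqr_incrst_0; [|apply Cmod_ge_0|lra].
  rewrite !Rsqr_pow2, Cmod2_alt. apply Rabs_lt_between in h1, h2. nra.
Qed.

(** A Lebesgue number argument: a neighbourhood with its own scale at every point yields one scale
    for the whole disc, and monotonicity of [T] allows passing to the smaller scale. The factor [2]
    converts closeness of both coordinates into closeness in modulus. *)
Lemma compact_uniform (T : R -> C -> Prop) (L : R) :
  (forall d d' v, 0 < d' <= d -> T d v -> T d' v) ->
  (forall w, exists d, 0 < d /\ forall v, Cmod (Cminus v w) < 2 * d -> T d v) ->
  exists d, 0 < d /\ forall v, Cmod v <= L -> T d v.
Proof.
  intros Hmono Hloc.
  set (dl := fun x y : R => proj1_sig (constructive_indefinite_description _ (Hloc (x, y)))).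
  assert (Hdl : forall x y, 0 < dl x y /\ forall v, Cmod (Cminus v (x, y)) < 2 * dl x y -> T (dl x y) v)
    by (intros x y; exact (proj2_sig (constructive_indefinite_description _ (Hloc (x, y))))).
  destruct (compactness_value_2d (-L) L (-L) L (fun x y => mkposreal _ (proj1 (Hdl x y)))) as [d Hd].
  exists d. split; [apply cond_pos|]. intros v hv.
  pose proof (re_le_Cmod v) as h1. pose proof (Im_le_Cmod v) as h2.
  apply Rabs_le_between in h1, h2.
  apply NNPP. intros Hn. apply (Hd (Re v) (Im v)); [lra|lra|].
  intros [x [y [_ [_ [H1 [H2 H3]]]]]]. simpl in *. apply Hn.
  apply (Hmono (dl x y)); [split; [apply cond_pos|exact H3]|].
  apply (Hdl x y). apply Cmod_lt_of_parts; auto. apply (Hdl x y).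
Qed.

(** Two uses of compactness. The bound [E v <= / d], monotone in [d], makes [E] bounded on [Om]; if
    the supremum [sp] were not attained, the bound [E v <= sp - d] would hold uniformly and
    contradict its minimality. *)
Lemma max_attained (Om : C -> Prop) (E : C -> R) (L : R) (w0 : C) :
  (forall w, Om w -> Cmod w <= L) ->
  (forall w, ~ Om w -> exists r, 0 < r /\ forall v, Cmod (Cminus v w) < r -> ~ Om v) ->
  (forall w, Om w -> cont E w) -> Om w0 ->
  exists w, Om w /\ forall v, Om v -> E v <= E w.
Proof.
  intros Hb Hc HE H0.
  assert (Hbd : exists B, forall v, Om v -> E v <= B).
  { destruct (compact_uniform (fun d v => Om v -> E v <= / d) L) as [d [hd Hd]].
    - intros d d' v hd H Hv. eapply Rle_trans; [apply H; auto|]. apply Rinv_le_contravar; lra.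
    - intros w. destruct (classic (Om w)) as [hw|hw].
      + destruct (HE w hw 1 Rlt_0_1) as [r [hr Hr]].
        set (B := Rabs (E w) + 1). assert (hB : 0 < B) by (unfold B; pose proof (Rabs_pos (E w)); lra).
        exists (Rmin (r / 2) (/ B)). assert (0 < / B) by (apply Rinv_0_lt_compat; auto).
        split; [apply Rmin_pos; lra|]. intros v hv Hv.
        assert (hv1 : Cmod (Cminus v w) < r) by (pose proof (Rmin_l (r/2) (/ B)); lra).
        specialize (Hr v hv1). apply Rabs_lt_between in Hr. pose proof (Rle_abs (E w)).
        apply Rle_trans with B; [unfold B; lra|].
        rewrite <- (Rinv_inv B) at 1. apply Rinv_le_contravar; [apply Rmin_pos; lra|apply Rmin_r].
      + destruct (Hc w hw) as [r [hr Hr]]. exists (r / 2). split; [lra|]. intros v hv Hv. exfalso.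
        apply (Hr v); auto. lra.
    - exists (/ d). intros v Hv. apply Hd; auto. }
  destruct (completeness (fun x => exists v, Om v /\ E v = x)) as [sp [HS1 HS2]].
  { destruct Hbd as [B HB]. exists B. intros x [v [hv <-]]. auto. }
  { exists (E w0), w0. auto. }
  apply NNPP. intros Hn.
  assert (Hlt : forall w, Om w -> E w < sp).
  { intros w hw. destruct (Rle_lt_or_eq_dec (E w) sp) as [h|h]; auto.
    - apply HS1. exists w; auto.
    - exfalso. apply Hn. exists w. split; auto. intros v hv. rewrite h. apply HS1. exists v; auto. }
  destruct (compact_uniform (fun d v => Om v -> E v <= sp - d) L) as [d [hd Hd]].
  - intros d d' v hd H Hv. specialize (H Hv). lra.
  - intros w. destruct (classic (Om w)) as [hw|hw].
    + specialize (Hlt w hw). destruct (HE w hw ((sp - E w)/2) ltac:(lra)) as [r [hr Hr]].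
      exists (Rmin (r/2) ((sp - E w)/2)). split; [apply Rmin_pos; lra|]. intros v hv Hv.
      pose proof (Rmin_l (r/2) ((sp - E w)/2)). pose proof (Rmin_r (r/2) ((sp - E w)/2)).
      specialize (Hr v ltac:(lra)). apply Rabs_lt_between in Hr. lra.
    + destruct (Hc w hw) as [r [hr Hr]]. exists (r / 2). split; [lra|]. intros v hv Hv. exfalso.
      apply (Hr v); auto. lra.
  - assert (sp <= sp - d); [|lra]. apply HS2. intros x [v [hv <-]]. apply Hd; auto.
Qed.

(** Domains are encoded by lists of continuous functions: the points where all are nonnegative form
    a closed set, and those where all are positive are interior to it. No topological boundary is
    ever needed. *)
Lemma Forall_cont_open (Fs : list (C -> R)) (w : C) :
  (forall F, In F Fs -> forall v, cont F v) -> List.Forall (fun F => 0 < F w) Fs ->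
  exists r, 0 < r /\ forall v, Cmod (Cminus v w) < r -> List.Forall (fun F => 0 <= F v) Fs.
Proof.
  intros HF H. induction H as [|F Fs h0 H IH].
  - exists 1. split; [lra|]. intros; constructor.
  - destruct IH as [r [hr Hr]]; [intros G hG; apply HF; right; auto|].
    destruct (HF F (or_introl eq_refl) w (F w) h0) as [r' [hr' Hr']].
    exists (Rmin r r'). split; [apply Rmin_pos; auto|]. intros v hv. constructor.
    + specialize (Hr' v ltac:(eapply Rlt_le_trans; [exact hv|apply Rmin_r])). apply Rabs_lt_between in Hr'. lra.
    + apply Hr. eapply Rlt_le_trans; [exact hv|apply Rmin_l].
Qed.

Lemma Forall_cont_closed (Fs : list (C -> R)) (w : C) :
  (forall F, In F Fs -> forall v, cont F v) -> ~ List.Forall (fun F => 0 <= F w) Fs ->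
  exists r, 0 < r /\ forall v, Cmod (Cminus v w) < r -> ~ List.Forall (fun F => 0 <= F v) Fs.
Proof.
  intros HF H. apply neg_Forall_Exists_neg in H; [|intros F; destruct (Rle_dec 0 (F w)); auto].
  apply Exists_exists in H. destruct H as [F [hF hw]]. apply Rnot_le_lt in hw.
  destruct (HF F hF w (- F w) ltac:(lra)) as [r [hr Hr]]. exists r. split; auto.
  intros v hv Hv. rewrite Forall_forall in Hv. specialize (Hv F hF). specialize (Hr v hv).
  apply Rabs_lt_between in Hr. lra.
Qed.

Lemma exp_le_compat x y : x <= y -> exp x <= exp y.
Proof. intros [h| ->]; [apply Rlt_le, exp_increasing, h|apply Rle_refl]. Qed.

Lemma cross_sqr w r : cross (fun v => Cmod v ^ 2) w r = 4 * r ^ 2.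
Proof. unfold cross. rewrite !Cmod2_alt. destruct w as [x y]. simpl. ring. Qed.

(** The product [|f| exp Q] makes sense at the zeros of [f], unlike [ln |f| + Q]. Logarithms are
    taken only near a maximum where the product exceeds [1], hence where [f] is nonzero; there
    [cross] of the perturbed function is at most [0] by maximality and at least
    [4 eta r^2 - M r^3 > 0] by the jets. *)
Lemma maximum_principle (f : C -> C) (Q : C -> R) (Fs : list (C -> R)) (L : R) (w0 : C) :
  let Om := fun w => List.Forall (fun F => 0 <= F w) Fs in
  (forall F, In F Fs -> forall v, cont F v) ->
  (forall w, Om w -> Cmod w <= L) ->
  (forall w, Om w -> jet f w /\ good Q w) ->
  (forall w, Om w -> Cmod (f w) * exp (Q w) <= 1 \/ List.Forall (fun F => 0 < F w) Fs) ->
  Om w0 -> Cmod (f w0) * exp (Q w0) <= 1.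
Proof.
  intros Om HFs Hb Hgood Hbdry H0.
  destruct (Rle_dec (Cmod (f w0) * exp (Q w0)) 1) as [h|h]; [exact h|exfalso].
  apply Rnot_le_lt in h.
  assert (hL : 0 <= L) by (eapply Rle_trans; [apply Cmod_ge_0|apply (Hb w0 H0)]).
  set (e0 := Cmod (f w0) * exp (Q w0)) in *.
  (* Adding [eta |w|^2] makes [cross] strictly positive at an interior maximum. *)
  set (eta := ln e0 / (2 * (L ^ 2 + 1))).
  assert (hln : 0 < ln e0) by (rewrite <- ln_1; apply ln_increasing; lra).
  assert (hL2 : 0 <= L ^ 2) by (apply pow_le; auto).
  assert (heta : 0 < eta) by (apply Rdiv_lt_0_compat; lra).
  assert (hetaL : eta * L ^ 2 < ln e0).
  { unfold eta. unfold Rdiv. apply Rmult_lt_reg_r with (2 * (L ^ 2 + 1)); [lra|].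
    replace (ln e0 * / (2 * (L ^ 2 + 1)) * L ^ 2 * (2 * (L ^ 2 + 1))) with (ln e0 * L ^ 2) by (field; lra). nra. }
  (* The shift by [- (eta * L ^ 2)] gives [Q2 <= Q] on [Om], so the bound on the boundary survives,
     while [eta * L ^ 2 < ln e0] keeps the value at [w0] above [1]. *)
  set (Q2 := fun w => Q w + (eta * Cmod w ^ 2 + - (eta * L ^ 2))).
  set (E := fun w => Cmod (f w) * exp (Q2 w)).
  assert (HQ2 : forall w, Om w -> Q2 w <= Q w).
  { intros w hw. unfold Q2. specialize (Hb w hw). pose proof (Cmod_ge_0 w).
    assert (Cmod w ^ 2 <= L ^ 2) by (apply pow_incr; lra). nra. }
  destruct (max_attained Om E L w0 Hb) as [w [hw Hmax]].
  - intros w hw. apply Forall_cont_closed; auto.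
  - intros w hw. destruct (Hgood w hw) as [Hj [HQc _]].
    apply (cont_mult (fun v => Cmod (f v)) (fun v => exp (Q2 v))); [apply jet_cont_Cmod; auto|].
    apply (cont_comp exp); [|apply derivable_continuous_pt, derivable_pt_exp].
    apply cont_plus; [exact HQc|]. apply cont_plus; [|apply cont_const]. apply cont_scal.
    apply (cont_comp (fun x => x ^ 2) Cmod); [apply cont_Cmod|]. apply derivable_continuous_pt, derivable_pt_pow.
  - exact H0.
  - assert (hE0 : 1 < E w0).
    { unfold E, Q2. rewrite exp_plus.
      apply Rlt_le_trans with (e0 * exp (- (eta * L ^ 2))).
      - rewrite <- (exp_ln e0) at 1 by lra. rewrite <- exp_plus. rewrite <- exp_0 at 1. apply exp_increasing. lra.
      - unfold e0. rewrite <- Rmult_assoc. apply Rmult_le_compat_l; [fold e0; lra|].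
        apply exp_le_compat. assert (0 <= Cmod w0 ^ 2) by (apply pow_le, Cmod_ge_0). nra. }
    assert (hEw : 1 < E w) by (specialize (Hmax w0 H0); lra).
    destruct (Hbdry w hw) as [Hle|Hint].
    { assert (E w <= Cmod (f w) * exp (Q w)).
      { unfold E. apply Rmult_le_compat_l; [apply Cmod_ge_0|]. apply exp_le_compat, HQ2, hw. }
      lra. }
    destruct (Forall_cont_open Fs w HFs Hint) as [r0 [hr0 Hr0]].
    destruct (Hgood w hw) as [Hj HQ].
    assert (hf : f w <> RtoC 0).
    { intros Ef. unfold E in hEw. rewrite Ef, Cmod_0 in hEw. lra. }
    assert (hfw : 0 < Cmod (f w)) by (apply Cmod_gt_0; exact hf).
    destruct (jet_cont_Cmod f w Hj (Cmod (f w)) hfw) as [r1 [hr1 Hr1]].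
    destruct (good_plus _ _ _ (good_ln_Cmod f w Hj hf) HQ) as [_ [M [r2 [hr2 [hM HM]]]]].
    set (T := fun v => ln (Cmod (f v)) + Q v) in *.
    (* In turn: the cross stays in the domain, [f] stays nonzero on it, the third-order estimate
       applies, and [M * r < 4 * eta]. *)
    set (r := Rmin (Rmin (r0 / 2) (r1 / 2)) (Rmin (r2 / 2) (eta / (M + 1)))).
    assert (h3 : 0 < eta / (M + 1)) by (apply Rdiv_lt_0_compat; lra).
    assert (hr : 0 < r) by (unfold r; repeat apply Rmin_pos; lra).
    assert (hrr0 : r <= r0 / 2) by (unfold r; eapply Rle_trans; [apply Rmin_l|apply Rmin_l]).
    assert (hrr1 : r <= r1 / 2) by (unfold r; eapply Rle_trans; [apply Rmin_l|apply Rmin_r]).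
    assert (hrr2 : r <= r2 / 2) by (unfold r; eapply Rle_trans; [apply Rmin_r|apply Rmin_l]).
    assert (hrr3 : r <= eta / (M + 1)) by (unfold r; eapply Rle_trans; [apply Rmin_r|apply Rmin_r]).
    specialize (HM r ltac:(lra)).
    set (T2 := fun v => T v + eta * Cmod v ^ 2).
    assert (Hloc : forall v, Cmod (Cminus v w) <= r -> T2 v <= T2 w).
    { intros v hv. assert (hvO : Om v) by (apply Hr0; lra).
      specialize (Hr1 v ltac:(lra)). apply Rabs_lt_between in Hr1.
      specialize (Hmax v hvO). unfold E in Hmax.
      apply ln_le in Hmax; [|apply Rmult_lt_0_compat; [lra|apply exp_pos]].
      rewrite !ln_mult, !ln_exp in Hmax by (auto using exp_pos; lra).
      unfold T2, T. unfold Q2 in Hmax. lra. }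
    assert (Hc : cross T2 w r <= 0).
    { assert (m1 : Cmod (RtoC r) <= r) by (rewrite Cmod_RtoC_pos; lra).
      assert (m3 : Cmod (Cmult Ci (RtoC r)) <= r) by (rewrite Cmod_mult, Cmod_Ci; lra).
      pose proof (Hloc (Cplus w (RtoC r))) as A1. pose proof (Hloc (Cminus w (RtoC r))) as A2.
      pose proof (Hloc (Cplus w (Cmult Ci (RtoC r)))) as A3. pose proof (Hloc (Cminus w (Cmult Ci (RtoC r)))) as A4.
      replace (Cminus (Cplus w (RtoC r)) w) with (RtoC r) in A1 by ring.
      replace (Cminus (Cminus w (RtoC r)) w) with (Copp (RtoC r)) in A2 by ring.
      replace (Cminus (Cplus w (Cmult Ci (RtoC r))) w) with (Cmult Ci (RtoC r)) in A3 by ring.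
      replace (Cminus (Cminus w (Cmult Ci (RtoC r))) w) with (Copp (Cmult Ci (RtoC r))) in A4 by ring.
      rewrite Cmod_opp in A2, A4. specialize (A1 m1). specialize (A2 m1). specialize (A3 m3). specialize (A4 m3).
      unfold cross. lra. }
    assert (Hc2 : cross T2 w r = cross T w r + eta * (4 * r ^ 2)).
    { rewrite <- (cross_sqr w r). unfold T2, cross. ring. }
    apply Rabs_le_between in HM.
    assert (hMr : M * r < 4 * eta).
    { apply (Rmult_le_compat_r (M + 1)) in hrr3; [|lra]. unfold Rdiv in hrr3. rewrite Rmult_assoc, Rinv_l, Rmult_1_r in hrr3 by lra. nra. }
    assert (0 < r ^ 2) by (apply pow_lt; auto).
    assert (M * r ^ 3 < eta * (4 * r ^ 2)).
    { replace (M * r ^ 3) with ((M * r) * r ^ 2) by ring. replace (eta * (4 * r ^ 2)) with ((4 * eta) * r ^ 2) by ring.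
      apply Rmult_lt_compat_r; auto. }
    lra.
Qed.

(** * Green's functions and counting zeros *)

(** Green's function of the half plane [d < Im w] with pole [z]. *)
Definition green (d : R) (z w : C) : R :=
  ln (Cmod (Cminus w (Cplus (Cconj z) (0, 2 * d)))) - ln (Cmod (Cminus w z)).

Lemma Cmod_pos_of_neq (w z : C) : w <> z -> 0 < Cmod (Cminus w z).
Proof.
  intros h. apply Cmod_gt_0. intros E. apply h.
  replace w with (Cplus (Cminus w z) z) by ring. rewrite E. ring.
Qed.

Lemma Cminus_neq_0 (w z : C) : w <> z -> Cminus w z <> RtoC 0.
Proof. intros h. apply Cmod_gt_0, Cmod_pos_of_neq, h. Qed.

(** The point [Cconj z + 2 d i] is the mirror image of [z] in the line [Im w = d]. This identity
    rewrites the Green function as half of [ln (1 + x)], with [x = 0] on that line. *)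
Lemma reflected_distance d (z w : C) :
  Cmod (Cminus w (Cplus (Cconj z) (0, 2 * d))) ^ 2
  = Cmod (Cminus w z) ^ 2 + 4 * ((Im w - d) * (Im z - d)).
Proof. rewrite !Cmod2_alt. destruct w, z. simpl. ring. Qed.

Lemma green_eq d (z w : C) : w <> z -> d <= Im w -> d <= Im z ->
  green d z w = / 2 * ln (1 + 4 * ((Im w - d) * (Im z - d)) / Cmod (Cminus w z) ^ 2).
Proof.
  intros hne hw hz. pose proof (Cmod_pos_of_neq _ _ hne) as h0.
  assert (h2 : 0 < Cmod (Cminus w z) ^ 2) by (apply pow_lt; auto).
  assert (hx : 0 <= (Im w - d) * (Im z - d)) by (apply Rmult_le_pos; lra).
  pose proof (reflected_distance d z w) as E.
  assert (h1 : 0 < Cmod (Cminus w (Cplus (Cconj z) (0, 2 * d)))).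
  { destruct (Cmod_ge_0 (Cminus w (Cplus (Cconj z) (0, 2 * d)))) as [h|h]; [exact h|].
    rewrite <- h in E. simpl in E, h2. lra. }
  replace (1 + 4 * ((Im w - d) * (Im z - d)) / Cmod (Cminus w z) ^ 2)
    with (Cmod (Cminus w (Cplus (Cconj z) (0, 2 * d))) ^ 2 / Cmod (Cminus w z) ^ 2).
  2:{ rewrite E. field. lra. }
  unfold Rdiv. rewrite ln_mult, ln_Rinv; auto using pow_lt, Rinv_0_lt_compat.
  rewrite !ln_pow by auto. unfold green. simpl. field.
Qed.

Lemma green_upper d (z w : C) : w <> z -> d <= Im w -> d <= Im z ->
  green d z w <= 2 * ((Im w - d) * (Im z - d)) / Cmod (Cminus w z) ^ 2.
Proof.
  intros hne hw hz. rewrite green_eq by auto. pose proof (Cmod_pos_of_neq _ _ hne) as h0.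
  assert (h2 : 0 < Cmod (Cminus w z) ^ 2) by (apply pow_lt; auto).
  set (x := 4 * ((Im w - d) * (Im z - d)) / Cmod (Cminus w z) ^ 2).
  assert (hx : 0 <= x).
  { apply Rmult_le_pos; [|apply Rlt_le, Rinv_0_lt_compat; auto].
    apply Rmult_le_pos; [lra|]. apply Rmult_le_pos; lra. }
  assert (ln (1 + x) <= x).
  { pose proof (exp_ineq1_le x). apply ln_le in H; [|lra]. rewrite ln_exp in H. exact H. }
  replace (2 * ((Im w - d) * (Im z - d)) / Cmod (Cminus w z) ^ 2) with (/2 * x) by (unfold x; field; lra).
  lra.
Qed.

(** This is [ln (1 + x) >= x / (1 + x)], obtained from [ln t <= t - 1] at [t = 1 / (1 + x)]. *)
Lemma green_lower d (z w : C) : w <> z -> d <= Im w -> d <= Im z ->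
  2 * ((Im w - d) * (Im z - d)) / (Cmod (Cminus w z) ^ 2 + 4 * ((Im w - d) * (Im z - d))) <= green d z w.
Proof.
  intros hne hw hz. rewrite green_eq by auto. pose proof (Cmod_pos_of_neq _ _ hne) as h0.
  assert (h2 : 0 < Cmod (Cminus w z) ^ 2) by (apply pow_lt; auto).
  set (y := (Im w - d) * (Im z - d)) in *. assert (hy : 0 <= y) by (apply Rmult_le_pos; lra).
  set (D := Cmod (Cminus w z) ^ 2) in *.
  assert (E : 1 + 4 * y / D = / (D / (D + 4 * y))) by (field; lra).
  assert (hD : 0 < D / (D + 4 * y)) by (apply Rdiv_lt_0_compat; lra).
  rewrite E, ln_Rinv by auto.
  assert (ln (D / (D + 4 * y)) <= D / (D + 4 * y) - 1).
  { pose proof (exp_ineq1_le (D / (D + 4 * y) - 1)). apply ln_le in H; [|lra]. rewrite ln_exp in H.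
    replace (1 + (D / (D + 4 * y) - 1)) with (D / (D + 4 * y)) in H by ring. exact H. }
  replace (2 * y / (D + 4 * y)) with (/2 * (1 - D / (D + 4 * y))) by (field; lra). lra.
Qed.

Lemma good_green d (z w : C) : w <> z -> d <= Im w -> d < Im z -> good (green d z) w.
Proof.
  intros hne hw hz.
  apply (good_ext (fun v => ln (Cmod (Cminus v (Cplus (Cconj z) (0, 2 * d)))) + (-1) * ln (Cmod (Cminus v z)))).
  - intros v. unfold green. ring.
  - apply good_plus; [|apply good_scal]; apply good_ln_Cmod; try apply jet_shift; apply Cminus_neq_0; auto.
    intros E. apply (f_equal Im) in E. destruct w, z. simpl in *. lra.
Qed.

Lemma zsum_le (u v : C -> R) zs : (forall p, In p zs -> u (fst p) <= v (fst p)) -> zsum u zs <= zsum v zs.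
Proof.
  induction zs as [|p zs IH]; intros H; simpl; [lra|].
  apply Rplus_le_compat; [apply Rmult_le_compat_l; [apply pos_INR|apply H; left; auto]|].
  apply IH. intros; apply H; right; auto.
Qed.

Lemma zsum_const_0 zs : zsum (fun _ => 0) zs = 0.
Proof. induction zs as [|p zs IH]; simpl; [reflexivity|]. rewrite IH. ring. Qed.

Lemma zsum_scal c (u : C -> R) zs : zsum (fun z => c * u z) zs = c * zsum u zs.
Proof. induction zs as [|p zs IH]; simpl; [ring|]. rewrite IH. ring. Qed.

Lemma good_zsum (g : C -> C -> R) zs w : (forall p, In p zs -> good (g (fst p)) w) ->
  good (fun v => zsum (fun z => g z v) zs) w.
Proof.
  induction zs as [|p zs IH]; intros H; simpl; [apply good_const|].
  apply (good_plus (fun v => INR (snd p) * g (fst p) v)).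
  - apply good_scal, H. left; auto.
  - apply IH. intros; apply H; right; auto.
Qed.

Lemma cont_bounded_above F w : cont F w -> exists D r, 0 < r /\ forall v, Cmod (Cminus v w) < r -> F v <= D.
Proof.
  intros H. destruct (H 1 Rlt_0_1) as [r [hr Hr]]. exists (F w + 1), r. split; auto.
  intros v hv. specialize (Hr v hv). apply Rabs_lt_between in Hr. lra.
Qed.

(** By [NoDup] exactly one summand is singular at [z]; the others, and the logarithm of the distance
    to the mirror image, are continuous there and are absorbed in [D]. *)
Lemma green_sum_near_pole d zs z m : NoDup (map fst zs) -> In (z, m) zs ->
  (forall p, In p zs -> d < Im (fst p)) ->
  exists D r, 0 < r /\ forall w, d <= Im w -> 0 < Cmod (Cminus w z) < r ->
    zsum (fun z' => green d z' w) zs <= D - INR m * ln (Cmod (Cminus w z)).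
Proof.
  induction zs as [|p zs IH]; intros Hnd Hin Hd; [destruct Hin|].
  simpl in Hnd. inversion Hnd as [|? ? Hni Hnd']. subst.
  assert (Hdz : d < Im z) by (apply (Hd (z, m) Hin)).
  destruct Hin as [->|Hin].
  - destruct (cont_bounded_above (fun w => zsum (fun z' => green d z' w) zs) z) as [D [r [hr Hr]]].
    { apply (good_zsum (green d) zs z). intros q hq. apply good_green; [|lra|apply Hd; right; auto].
      intros ->. apply Hni. simpl. apply (in_map fst _ _ hq). }
    destruct (cont_bounded_above (fun w => ln (Cmod (Cminus w (Cplus (Cconj z) (0, 2 * d))))) z) as [D' [r' [hr' Hr']]].
    { apply good_ln_Cmod; [apply jet_shift|]. apply Cminus_neq_0. intros E. apply (f_equal Im) in E.
      destruct z. simpl in *. lra. }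
    exists (INR m * D' + D), (Rmin r r'). split; [apply Rmin_pos; auto|]. intros w hw [h0 h1].
    specialize (Hr w ltac:(eapply Rlt_le_trans; [exact h1|apply Rmin_l])).
    specialize (Hr' w ltac:(eapply Rlt_le_trans; [exact h1|apply Rmin_r])).
    simpl. unfold green at 1. pose proof (pos_INR m).
    rewrite Rmult_minus_distr_l.
    apply (Rmult_le_compat_l (INR m)) in Hr'; [|auto]. lra.
  - destruct (IH Hnd' Hin) as [D [r [hr Hr]]]; [intros q hq; apply Hd; right; auto|].
    destruct (cont_bounded_above (green d (fst p)) z) as [D' [r' [hr' Hr']]].
    { apply good_green; [|lra|apply Hd; left; auto].
      intros E. apply Hni. rewrite <- E. apply (in_map fst _ _ Hin). }
    exists (INR (snd p) * D' + D), (Rmin r r'). split; [apply Rmin_pos; auto|]. intros w hw [h0 h1].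
    assert (h2 : Cmod (Cminus w z) < r) by (eapply Rlt_le_trans; [exact h1|apply Rmin_l]).
    specialize (Hr w hw (conj h0 h2)).
    specialize (Hr' w ltac:(eapply Rlt_le_trans; [exact h1|apply Rmin_r])).
    simpl. apply (Rmult_le_compat_l (INR (snd p))) in Hr'; [|apply pos_INR]. lra.
Qed.

Lemma common_radius {T : Type} (P : T -> R -> Prop) (l : list T) :
  (forall x t t', 0 < t' <= t -> P x t -> P x t') ->
  (forall x, In x l -> exists t, 0 < t /\ P x t) -> exists t, 0 < t /\ forall x, In x l -> P x t.
Proof.
  intros Hm. induction l as [|x l IH]; intros H.
  - exists 1. split; [lra|]. intros x [].
  - destruct IH as [t [ht Ht]]; [intros; apply H; right; auto|].
    destruct (H x (or_introl eq_refl)) as [t' [ht' Ht']].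
    exists (Rmin t t'). assert (0 < Rmin t t') by (apply Rmin_pos; auto). split; [auto|].
    intros y [<-|hy].
    + apply (Hm _ t'); [split; [auto|apply Rmin_r]|auto].
    + apply (Hm _ t); [split; [auto|apply Rmin_l]|auto].
Qed.

(** With [x = |w - z|] the product is at most [c x^(m/2)], and [x^(m/2) <= x^(1/2) <= 1 / (c + 1)]
    as soon as [x <= 1] and [x <= t0]. *)
Lemma zero_absorbs_pole (f : C -> C) z m D r : (1 <= m)%nat -> vanishes_to f z m -> 0 < r ->
  exists t, 0 < t < r /\ forall w, 0 < Cmod (Cminus w z) <= t ->
    Cmod (f w) * exp (/ 2 * (D - INR m * ln (Cmod (Cminus w z)))) <= 1.
Proof.
  intros hm [M [r' [hr' [hM HM]]]] hr.
  set (c := M * exp (/2 * D)).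
  assert (hc : 0 <= c) by (apply Rmult_le_pos; [auto|apply Rlt_le, exp_pos]).
  set (t0 := / (c + 1) ^ 2).
  assert (ht0 : 0 < t0) by (apply Rinv_0_lt_compat, pow_lt; lra).
  exists (Rmin (Rmin (r / 2) (r' / 2)) (Rmin (/2) t0)).
  set (t := Rmin (Rmin (r / 2) (r' / 2)) (Rmin (/2) t0)).
  assert (t <= r / 2 /\ t <= r' / 2 /\ t <= /2 /\ t <= t0 /\ 0 < t) as [h1 [h2 [h3 [h4 h5]]]].
  { unfold t. repeat split.
    - eapply Rle_trans; [apply Rmin_l|apply Rmin_l].
    - eapply Rle_trans; [apply Rmin_l|apply Rmin_r].
    - eapply Rle_trans; [apply Rmin_r|apply Rmin_l].
    - eapply Rle_trans; [apply Rmin_r|apply Rmin_r].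
    - repeat apply Rmin_pos; lra. }
  split; [lra|]. intros w [hw0 hw].
  assert (Hf := HM (Cminus w z) ltac:(lra)).
  replace (Cplus z (Cminus w z)) with w in Hf by ring.
  set (x := Cmod (Cminus w z)) in *.
  assert (hl : ln x <= ln t0) by (apply ln_le; lra).
  assert (hl0 : ln x <= 0) by (rewrite <- ln_1; apply ln_le; lra).
  unfold t0 in hl. rewrite ln_Rinv, ln_pow in hl by (try apply pow_lt; lra). simpl in hl.
  assert (hmI : 1 <= INR m) by (change 1 with (INR 1); apply le_INR; auto).
  eapply Rle_trans; [apply Rmult_le_compat_r; [apply Rlt_le, exp_pos|exact Hf]|].
  assert (E : x ^ m = exp (INR m * ln x)) by (rewrite <- Rpower_pow by auto; reflexivity).
  rewrite E.
  replace (M * exp (INR m * ln x) * exp (/ 2 * (D - INR m * ln x))) with (c * exp (/2 * INR m * ln x)).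
  2:{ unfold c. rewrite !Rmult_assoc, <- !exp_plus. f_equal. f_equal. field. }
  apply Rle_trans with (c * exp (- ln (c + 1))).
  - apply Rmult_le_compat_l; [auto|]. apply exp_le_compat. nra.
  - rewrite exp_Ropp, exp_ln by lra. apply Rmult_le_reg_r with (c + 1); [lra|].
    rewrite Rmult_assoc, Rinv_l by lra. lra.
Qed.

(** A Jensen inequality on a domain without an explicit Green function. The functions
    [green d z - Im z * Bf] are nonpositive on the boundary, so the maximum principle applies to [f]
    times the exponential of half their sum minus [K * U]. Evaluating at [w0], where [|f| = 1],
    gives the bound. *)
Lemma zero_count (f : C -> C) (zs : list (C * nat)) (d K L : R) (Bf U : C -> R) (Gs : list (C -> R)) (w0 : C) :
  let Om := fun w => List.Forall (fun F => 0 <= F w) Gs in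
  0 <= K ->
  (forall w, d <= Im w -> jet f w) ->
  (forall F, In F Gs -> forall v, cont F v) ->
  (forall w, Om w -> Cmod w <= L /\ d <= Im w /\ good Bf w /\ good U w /\ 0 <= Bf w /\ 0 <= U w
      /\ (f w <> RtoC 0 -> ln (Cmod (f w)) <= K * U w)) ->
  (forall w, Om w -> (forall p, In p zs -> w <> fst p -> green d (fst p) w <= Im (fst p) * Bf w)
      \/ List.Forall (fun F => 0 < F w) Gs) ->
  NoDup (map fst zs) ->
  (forall p, In p zs -> (1 <= snd p)%nat /\ vanishes_to f (fst p) (snd p) /\ d < Im (fst p) /\ 0 <= Im (fst p)) ->
  Om w0 -> Cmod (f w0) = 1 ->
  zsum (fun z => green d z w0 - Im z * Bf w0) zs <= 2 * (K * U w0).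
Proof.
  intros Om hK Hjet HGs HOm Hbdry Hnd Hzs H0 Hf0.
  (* With the factor [1/2] the pole of the Green function does not cancel the zero of [f] completely, so the product
     still tends to [0] there and no quotient of power series is needed. *)
  set (Q := fun w => / 2 * zsum (fun z => green d z w - Im z * Bf w) zs + (- K) * U w).
  assert (Ht : exists t, 0 < t /\ forall p, In p zs -> t <= Cmod (Cminus w0 (fst p)) /\
     forall w, Om w -> 0 < Cmod (Cminus w (fst p)) <= t -> Cmod (f w) * exp (Q w) <= 1).
  { apply (common_radius (fun p t => t <= Cmod (Cminus w0 (fst p)) /\
     forall w, Om w -> 0 < Cmod (Cminus w (fst p)) <= t -> Cmod (f w) * exp (Q w) <= 1)).
    { intros p t t' ht [h1 h2]. split; [lra|]. intros w hw hw2. apply h2; auto. lra. }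
    intros p hp. destruct (Hzs p hp) as [hm [hv [hd hi]]].
    assert (hp' : In (fst p, snd p) zs) by (destruct p; exact hp).
    destruct (green_sum_near_pole d zs (fst p) (snd p) Hnd hp') as [D [r [hr Hr]]].
    { intros q hq. apply (Hzs q hq). }
    destruct (zero_absorbs_pole f (fst p) (snd p) D r hm hv hr) as [t [ht Ht]].
    assert (hne : w0 <> fst p).
    { intros E. destruct hv as [M [r1 [hr1 [hM HM]]]]. specialize (HM (RtoC 0) ltac:(rewrite Cmod_0; lra)).
      replace (Cplus (fst p) (RtoC 0)) with w0 in HM by (rewrite E; ring).
      rewrite Cmod_0, pow_i in HM by lia. lra. }
    exists (Rmin t (Cmod (Cminus w0 (fst p)))). split; [apply Rmin_pos; [lra|apply Cmod_pos_of_neq; auto]|].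
    split; [apply Rmin_r|]. intros w hw [hw1 hw2].
    assert (hwt : Cmod (Cminus w (fst p)) <= t) by (eapply Rle_trans; [exact hw2|apply Rmin_l]).
    destruct (HOm w hw) as [_ [hwd [_ [_ [hB [hU _]]]]]].
    eapply Rle_trans; [|apply (Ht w (conj hw1 hwt))].
    apply Rmult_le_compat_l; [apply Cmod_ge_0|]. apply exp_le_compat. unfold Q.
    assert (hwr : Cmod (Cminus w (fst p)) < r) by lra.
    specialize (Hr w hwd (conj hw1 hwr)).
    assert (zsum (fun z => green d z w - Im z * Bf w) zs <= zsum (fun z => green d z w) zs).
    { apply zsum_le. intros q hq. destruct (Hzs q hq) as [_ [_ [_ hq2]]].
      assert (0 <= Im (fst q) * Bf w) by (apply Rmult_le_pos; auto). lra. }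
    assert (0 <= K * U w) by (apply Rmult_le_pos; auto). lra. }
  destruct Ht as [t [ht Ht]].
  (* Discs of radius [t] around the zeros are excised as well, so no pole lies in the domain; on
     their rims the bound is [Ht], and [t] is small enough to leave [w0] outside. *)
  set (Fs := Gs ++ map (fun p w => Cmod (Cminus w (fst p)) + - t) zs).
  assert (HFs : forall (P : R -> Prop) w, List.Forall (fun F => P (F w)) Fs <->
     List.Forall (fun F => P (F w)) Gs /\ forall p, In p zs -> P (Cmod (Cminus w (fst p)) + - t)).
  { intros P w. unfold Fs. rewrite Forall_app, Forall_map, (Forall_forall _ zs). reflexivity. }
  assert (Hmain : Cmod (f w0) * exp (Q w0) <= 1).
  { apply (maximum_principle f Q Fs L w0).
    - intros F hF. apply in_app_or in hF. destruct hF as [hF|hF]; [apply HGs; auto|].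
      apply in_map_iff in hF. destruct hF as [p [<- hp]]. intros v. apply cont_plus; [apply cont_Cmod_shift|apply cont_const].
    - intros w hw. apply HFs in hw. apply HOm, hw.
    - intros w hw. apply HFs in hw. destruct hw as [hw hw2]. destruct (HOm w hw) as [_ [hwd [hB [hU _]]]].
      split; [apply Hjet; auto|]. apply good_plus; [|apply good_scal; auto]. apply good_scal.
      apply (good_zsum (fun z v => green d z v - Im z * Bf v)). intros p hp. destruct (Hzs p hp) as [hm [hv [hd hi]]].
      apply (good_ext (fun v => green d (fst p) v + (- Im (fst p)) * Bf v)); [intros; ring|].
      apply good_plus; [|apply good_scal; auto]. apply good_green; auto.
      intros E. specialize (hw2 p hp). rewrite E in hw2. replace (Cminus (fst p) (fst p)) with (RtoC 0) in hw2 by ring.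
      rewrite Cmod_0 in hw2. lra.
    - intros w hw. apply HFs in hw. destruct hw as [hw hw2].
      destruct (classic (exists p, In p zs /\ Cmod (Cminus w (fst p)) <= t)) as [[p [hp hpt]]|hfar].
      { left. apply (Ht p hp); auto. specialize (hw2 p hp). lra. }
      destruct (Hbdry w hw) as [Hg|Hint].
      + left. destruct (HOm w hw) as [_ [hwd [_ [_ [hB [hU hlog]]]]]].
        assert (hQ : Q w <= - (K * U w)).
        { unfold Q. assert (zsum (fun z => green d z w - Im z * Bf w) zs <= zsum (fun _ => 0) zs).
          { apply zsum_le. intros p hp. assert (w <> fst p).
            { intros E. apply hfar. exists p. split; auto. rewrite E.
              replace (Cminus (fst p) (fst p)) with (RtoC 0) by ring. rewrite Cmod_0. lra. }
            specialize (Hg p hp H). lra. }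
          rewrite zsum_const_0 in H. lra. }
        destruct (Ceq_dec (f w) (RtoC 0)) as [E|E].
        { rewrite E, Cmod_0. lra. }
        specialize (hlog E). apply Cmod_gt_0 in E.
        rewrite <- (exp_ln (Cmod (f w))) by auto. rewrite <- exp_plus, <- exp_0. apply exp_le_compat. lra.
      + right. apply HFs. split; [exact Hint|]. intros p hp.
        destruct (Rle_dec (Cmod (Cminus w (fst p))) t) as [h|h]; [|lra].
        exfalso. apply hfar. exists p; auto.
    - apply HFs. split; [exact H0|]. intros p hp. destruct (Ht p hp) as [h _]. lra. }
  rewrite Hf0, Rmult_1_l in Hmain.
  pose proof (exp_ineq1_le (Q w0)). unfold Q in *. lra.
Qed.

(** Poisson kernel of the half plane [- s < Im w] at the boundary point [(p, - s)]. *)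
Definition pois (p s : R) (w : C) : R := (Im w + s) / Cmod (Cminus w (p, - s)) ^ 2.

(** The kernel is [- Im (1 / (w - p + i s))], the imaginary part of a function with a jet. *)
Lemma good_pois p s w : - s < Im w -> good (pois p s) w.
Proof.
  intros h. assert (hne : w <> (p, - s)) by (intros ->; simpl in h; lra).
  apply (good_ext (fun v => -1 * Im (Cinv (Cminus v (p, - s))))).
  - intros v. unfold pois. rewrite Cmod2_alt. destruct v as [x y]. simpl. unfold Rdiv.
    replace (y + - - s) with (y + s) by ring. ring_simplify. reflexivity.
  - apply good_scal, good_Im. apply jet_inv_comp; [apply jet_shift|apply Cminus_neq_0; auto].
Qed.

Lemma pois_nonneg p s w : - s <= Im w -> 0 <= pois p s w.
Proof.
  (* At the pole itself the quotient has the default value [0]. *)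
  intros h. unfold pois. destruct (Req_dec (Cmod (Cminus w (p, - s)) ^ 2) 0) as [E|E].
  - unfold Rdiv. rewrite E, Rinv_0. lra.
  - apply Rmult_le_pos; [lra|]. apply Rlt_le, Rinv_0_lt_compat.
    assert (0 <= Cmod (Cminus w (p, - s)) ^ 2) by apply pow2_ge_0. lra.
Qed.

(** The distance from [w] to [(p, - s)] is at most [2 * s], while the numerator is at least [s]. *)
Lemma pois_lower p s w : 0 < s -> 0 <= Im w -> Cmod (Cminus w (RtoC p)) <= s -> / 4 <= s * pois p s w.
Proof.
  intros hs hw hv. unfold pois.
  assert (E : Cminus w (p, - s) = Cplus (Cminus w (RtoC p)) (0, s)).
  { destruct w; apply injective_projections; simpl; ring. }
  assert (h1 : Cmod (Cminus w (p, - s)) <= 2 * s).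
  { rewrite E. eapply Rle_trans; [apply Cmod_triangle|].
    assert (Cmod (0, s) = s).
    { replace (0, s) with (Cmult Ci (RtoC s)) by (apply injective_projections; simpl; ring).
      rewrite Cmod_mult, Cmod_Ci, Cmod_RtoC_pos by auto. ring. }
    lra. }
  assert (h0 : s <= Cmod (Cminus w (p, - s))).
  { eapply Rle_trans; [|apply Im_le_Cmod]. destruct w; simpl in *. rewrite Rabs_pos_eq; lra. }
  set (D := Cmod (Cminus w (p, - s))) in *.
  assert (hD : D ^ 2 <= (2 * s) ^ 2) by (apply pow_incr; lra).
  assert (hD0 : 0 < D ^ 2) by (apply pow_lt; lra).
  apply Rmult_le_reg_r with (D ^ 2); [auto|]. unfold Rdiv.
  replace (s * ((Im w + s) * / D ^ 2) * D ^ 2) with (s * (Im w + s)) by (field; lra). nra.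
Qed.

Lemma pois_at_Ci p s : 0 <= s -> pois p s Ci <= 1.
Proof.
  intros hs. unfold pois. rewrite Cmod2_alt. simpl.
  assert (0 <= p * p) by nra.
  apply Rmult_le_reg_r with ((0 + - p) * ((0 + - p) * 1) + (1 + - - s) * ((1 + - - s) * 1)); [nra|].
  unfold Rdiv. rewrite Rmult_assoc, Rinv_l by nra. nra.
Qed.

Lemma rsum_nonneg n u : (forall k, (k < n)%nat -> 0 <= u k) -> 0 <= rsum n u.
Proof. induction n as [|n IH]; intros H; simpl; [lra|]. apply Rplus_le_le_0_compat; [apply IH; intros; apply H; lia|apply H; lia]. Qed.

Lemma rsum_term n u q : (forall k, (k < n)%nat -> 0 <= u k) -> (q < n)%nat -> u q <= rsum n u.
Proof.
  induction n as [|n IH]; intros H hq; [lia|]. simpl.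
  assert (0 <= rsum n u) by (apply rsum_nonneg; intros; apply H; lia).
  destruct (Nat.eq_dec q n) as [->|hne]; [lra|].
  assert (u q <= rsum n u) by (apply IH; [intros; apply H; lia|lia]). specialize (H n ltac:(lia)). lra.
Qed.

Lemma rsum_le_const n u b : (forall k, (k < n)%nat -> u k <= b) -> rsum n u <= INR n * b.
Proof.
  induction n as [|n IH]; intros H; [simpl; lra|]. rewrite S_INR. simpl.
  specialize (IH ltac:(intros; apply H; lia)). specialize (H n ltac:(lia)). lra.
Qed.

Lemma good_rsum n (g : nat -> C -> R) w : (forall k, (k < n)%nat -> good (g k) w) -> good (fun v => rsum n (fun k => g k v)) w.
Proof.
  induction n as [|n IH]; intros H; simpl; [apply good_const|].
  apply (good_plus (fun v => rsum n (fun k => g k v)) (g n)); [apply IH; intros; apply H; lia|apply H; lia].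
Qed.

(** With [coef q] of order [s^-gam], [s = sc / 2^q], a positive harmonic function dominating [|w - p|^-gam] down to
    the scale [sc / 2^n], whose value at [i] is at most the sum of the [s^(1 - gam)]. *)
Definition dyadic_pois (sc p : R) (coef : nat -> R) (n : nat) (w : C) : R :=
  rsum (S n) (fun q => coef q * (sc / 2 ^ q * pois p (sc / 2 ^ q) w)).

(** The alternative [q = n] covers a [v] below the finest scale; each use then compares that scale
    with [v] through its own lower bound on [v]. *)
Lemma dyadic_scale sc n v : 0 < v <= sc -> exists q, (q <= n)%nat /\ v <= sc / 2 ^ q /\ (sc / 2 ^ q <= 2 * v \/ q = n).
Proof.
  intros hv. induction n as [|n IH].
  - exists O. split; [lia|split; [simpl; lra|right; auto]].
  - destruct IH as [q [hq [h1 h2]]].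
    destruct (Rle_dec (sc / 2 ^ q) (2 * v)) as [h|h].
    + exists q. split; [lia|split; [auto|left; auto]].
    + destruct h2 as [h2| ->]; [contradiction|].
      exists (S n). split; [lia|split; [|right; auto]].
      assert (0 < 2 ^ n) by (apply pow_lt; lra).
      replace (sc / 2 ^ S n) with (sc / 2 ^ n / 2) by (simpl; field; lra). lra.
Qed.

Lemma scale_pos sc q : 0 < sc -> 0 < sc / 2 ^ q.
Proof. intros. apply Rdiv_lt_0_compat; [auto|apply pow_lt; lra]. Qed.

Lemma scale_mono sc q n : 0 < sc -> (q <= n)%nat -> sc / 2 ^ n <= sc / 2 ^ q.
Proof.
  intros hs hq. apply Rmult_le_compat_l; [lra|]. apply Rinv_le_contravar; [apply pow_lt; lra|apply Rle_pow; [lra|auto]].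
Qed.

Lemma dyadic_pois_nonneg sc p coef n w : 0 < sc -> (forall q, 0 <= coef q) -> 0 <= Im w -> 0 <= dyadic_pois sc p coef n w.
Proof.
  intros hs hc hw. apply rsum_nonneg. intros k _. pose proof (scale_pos sc k hs).
  apply Rmult_le_pos; [auto|]. apply Rmult_le_pos; [lra|]. apply pois_nonneg. lra.
Qed.

Lemma dyadic_pois_lower sc p coef n q w : 0 < sc -> (forall q, 0 <= coef q) -> 0 <= Im w -> (q <= n)%nat ->
  Cmod (Cminus w (RtoC p)) <= sc / 2 ^ q -> coef q / 4 <= dyadic_pois sc p coef n w.
Proof.
  intros hs hc hw hq hv. unfold dyadic_pois.
  eapply Rle_trans; [|apply (rsum_term (S n) (fun q => coef q * (sc / 2 ^ q * pois p (sc / 2 ^ q) w)) q); [|lia]].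
  - simpl. apply Rmult_le_compat_l; [auto|]. apply pois_lower; auto. apply scale_pos; auto.
  - intros k _. simpl. pose proof (scale_pos sc k hs).
    apply Rmult_le_pos; [auto|]. apply Rmult_le_pos; [lra|]. apply pois_nonneg. lra.
Qed.

Lemma dyadic_pois_at_Ci sc p coef n b : 0 < sc -> (forall q, 0 <= coef q) ->
  (forall q, (q <= n)%nat -> coef q * (sc / 2 ^ q) <= b) -> dyadic_pois sc p coef n Ci <= INR (S n) * b.
Proof.
  intros hs hc hb. apply rsum_le_const. intros k hk.
  eapply Rle_trans; [|apply (hb k); lia]. pose proof (scale_pos sc k hs).
  apply Rmult_le_compat_l; [auto|]. rewrite <- Rmult_1_r. apply Rmult_le_compat_l; [lra|]. apply pois_at_Ci. lra.
Qed.

Lemma good_dyadic_pois sc p coef n w : 0 < sc -> 0 < Im w -> good (dyadic_pois sc p coef n) w.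
Proof.
  intros hs hw. apply (good_rsum (S n) (fun q w => coef q * (sc / 2 ^ q * pois p (sc / 2 ^ q) w))).
  intros k _. apply good_scal, good_scal, good_pois. pose proof (scale_pos sc k hs). lra.
Qed.

(** The constant [8] is the origin of the leading factor of [corrector]. *)
Lemma green_far d (z w : C) D : 0 < d -> d <= Im w -> d <= Im z -> 0 < D -> D / 2 <= Cmod (Cminus w z) ->
  green d z w <= 8 * (Im w * Im z) / D ^ 2.
Proof.
  intros hd hw hz hD h.
  assert (hne : w <> z). { intros ->. replace (Cminus z z) with (RtoC 0) in h by ring. rewrite Cmod_0 in h. lra. }
  eapply Rle_trans; [apply green_upper; auto|].
  assert (hD2 : (D / 2) ^ 2 <= Cmod (Cminus w z) ^ 2) by (apply pow_incr; lra).
  assert (h0 : 0 < (D / 2) ^ 2) by (apply pow_lt; lra).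
  apply Rle_trans with (2 * (Im w * Im z) / (D / 2) ^ 2).
  - apply Rmult_le_compat.
    + apply Rmult_le_pos; [lra|]. apply Rmult_le_pos; lra.
    + apply Rlt_le, Rinv_0_lt_compat; lra.
    + apply Rmult_le_compat_l; [lra|]. apply Rmult_le_compat; lra.
    + apply Rinv_le_contravar; auto.
  - right. field. lra.
Qed.

(** Put [x = (1 - d) (Im z - d)]. Then [x >= 9/16 Im z], and the denominator in [green_lower] is at
    most [4 + 4 x <= 8]. *)
Lemma green_at_Ci d z : 0 < d <= / 4 -> 4 * d <= Im z -> Cmod z <= 1 -> Ci <> z -> Im z / 8 <= green d z Ci.
Proof.
  intros hd hz hm hne.
  eapply Rle_trans; [|apply green_lower; auto; simpl; lra].
  simpl (Im Ci). set (y := Im z) in *.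
  assert (hy1 : y <= 1). { unfold y. pose proof (Im_le_Cmod z). pose proof (Rle_abs (Im z)). lra. }
  assert (hD : Cmod (Cminus Ci z) ^ 2 <= 4).
  { replace 4 with (2 ^ 2) by ring. apply pow_incr. split; [apply Cmod_ge_0|].
    pose proof (Cmod_triangle Ci (Copp z)) as T. rewrite Cmod_opp, Cmod_Ci in T. unfold Cminus. lra. }
  assert (hD0 : 0 < Cmod (Cminus Ci z) ^ 2) by (apply pow_lt, Cmod_pos_of_neq; auto).
  set (D := Cmod (Cminus Ci z) ^ 2) in *.
  assert (hx : 9 / 16 * y <= (1 - d) * (y - d)) by nra.
  assert (hx1 : (1 - d) * (y - d) <= 1) by nra.
  set (x := (1 - d) * (y - d)) in *.
  apply Rmult_le_reg_r with (D + 4 * x); [lra|]. unfold Rdiv. rewrite (Rmult_assoc (2 * x)), Rinv_l by lra. nra.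
Qed.

Lemma rsum_le n u v : (forall k, (k < n)%nat -> u k <= v k) -> rsum n u <= rsum n v.
Proof. induction n as [|n IH]; intros H; simpl; [lra|]. apply Rplus_le_compat; [apply IH; intros; apply H; lia|apply H; lia]. Qed.

Lemma Rpower_pos x y : 0 < Rpower x y.
Proof. apply exp_pos. Qed.

Lemma Rpower_anti x y a : 0 < x <= y -> 0 <= a -> Rpower y (- a) <= Rpower x (- a).
Proof.
  intros hx ha. unfold Rpower. apply exp_le_compat. assert (ln x <= ln y) by (apply ln_le; lra). nra.
Qed.

Lemma Rpower_mono x y a : 0 < x <= y -> 0 <= a -> Rpower x a <= Rpower y a.
Proof.
  intros hx ha. unfold Rpower. apply exp_le_compat. assert (ln x <= ln y) by (apply ln_le; lra). nra.
Qed.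

Lemma Rpower_mult_base x y a : 0 < x -> 0 < y -> Rpower (x * y) a = Rpower x a * Rpower y a.
Proof. intros. unfold Rpower. rewrite ln_mult by auto. rewrite <- exp_plus. f_equal. ring. Qed.

(** * Counting zeros in a box *)

Section Box.
Variables (N i0 n1 : nat) (tau : nat -> R) (L : R).
Let sc := 2 * L.
Let r1 := sc / 2 ^ n1.
Let p := tau i0.
Hypotheses (hL : 32 <= L) (htau : forall j, (j < N)%nat -> Rabs (tau j) <= L) (hi0 : (i0 < N)%nat)
  (hr1 : r1 <= 1).

(** Radius of the discs removed around the other [tau j]. With [32 * (N + 1)] each of their kernels,
    weighted by [(bite / r1) ^ 2], costs at most [1 / (1024 (N + 1))] at [i], hence all together at
    most [1 / 1024]. *)
Definition bite : R := r1 / (32 * INR (S N)).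
(** Normalized by [cone * sc = r1 / 2048]. This puts [i] above the cone and shows that, for
    [n = n1], the cone is nowhere the active boundary. *)
Definition cone : R := r1 / (4096 * L).

(** Multiplied by [Im z], the four summands dominate the Green function with pole [z], respectively, on [|w| = L],
    on the circle around [p], on the circles around the other [tau j], and on the cone. *)
Definition corrector (n : nat) (h : R) (w : C) : R :=
  8 * (/ L ^ 2 * Im w + ((/ 32) ^ 2 * pois p 0 w
   + (rsum N (fun j => (if Nat.eqb j i0 then 0 else (bite / r1) ^ 2) * pois (tau j) 0 w)
   + 2 * (cone / INR (S n) * (h / (sc / 2 ^ n))) * dyadic_pois sc p (fun q => 4 * / (sc / 2 ^ q)) n w))).

Lemma box_consts : 0 < sc /\ 0 < r1 /\ 0 < bite /\ bite <= r1 / 32 /\ 0 < cone /\ cone <= / 4096.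
Proof.
  assert (h0 : 0 < sc) by (unfold sc; lra).
  assert (h1 : 0 < r1) by (apply scale_pos; auto).
  assert (hN : 1 <= INR (S N)) by (rewrite S_INR; pose proof (pos_INR N); lra).
  assert (h2 : 0 < bite) by (apply Rdiv_lt_0_compat; lra).
  assert (h3 : 0 < cone) by (apply Rdiv_lt_0_compat; lra).
  repeat split; auto.
  - unfold bite. apply Rmult_le_compat_l; [lra|]. apply Rinv_le_contravar; lra.
  - unfold cone. apply Rmult_le_reg_r with (4096 * L); [lra|]. unfold Rdiv. rewrite Rmult_assoc, Rinv_l by lra. nra.
Qed.

Lemma corrector_nonneg n h w : 0 < h -> 0 <= Im w -> 0 <= corrector n h w.
Proof.
  intros hh hw. destruct box_consts as [h0 [h1 [h2 [h3 [h4 h5]]]]].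
  pose proof (scale_pos sc n h0) as hs. assert (0 < INR (S n)) by (apply lt_0_INR; lia).
  unfold corrector. apply Rmult_le_pos; [lra|]. repeat apply Rplus_le_le_0_compat.
  - apply Rmult_le_pos; [apply Rlt_le, Rinv_0_lt_compat, pow_lt; lra|auto].
  - apply Rmult_le_pos; [apply pow_le; lra|apply pois_nonneg; lra].
  - apply rsum_nonneg. intros k _. apply Rmult_le_pos; [|apply pois_nonneg; lra].
    destruct (Nat.eqb k i0); [lra|apply pow2_ge_0].
  - apply Rmult_le_pos.
    + apply Rmult_le_pos; [lra|]. apply Rmult_le_pos; apply Rlt_le, Rdiv_lt_0_compat; auto.
    + apply dyadic_pois_nonneg; auto. intros q. pose proof (scale_pos sc q h0).
      apply Rmult_le_pos; [lra|apply Rlt_le, Rinv_0_lt_compat; auto].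
Qed.

Lemma good_corrector n h w : 0 < Im w -> good (corrector n h) w.
Proof.
  intros hw. destruct box_consts as [h0 _]. unfold corrector. apply good_scal.
  apply good_plus; [apply good_scal, (good_Im (fun v => v)), jet_id|].
  apply good_plus; [apply good_scal, good_pois; lra|].
  apply good_plus; [|apply good_scal, good_dyadic_pois; auto].
  apply (good_rsum N (fun j w => (if Nat.eqb j i0 then 0 else (bite / r1) ^ 2) * pois (tau j) 0 w)).
  intros k _. apply good_scal, good_pois. lra.
Qed.

(** The target [/ 16] is half of the lower bound in [green_at_Ci]. In units of [1 / 1024] the
    summands cost at most [1], [1], [1] and [2], and [8 * 5 / 1024 < / 16]. In the last one, [n + 1]
    kernels worth at most [4] each are paid for by the [n + 1] in the slope. *)
Lemma corrector_at_Ci n h : 0 < h <= sc / 2 ^ n -> corrector n h Ci <= / 16.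
Proof.
  intros hh. destruct box_consts as [h0 [h1 [h2 [h3 [h4 h5]]]]].
  pose proof (scale_pos sc n h0) as hs.
  assert (hn : 1 <= INR (S n)) by (rewrite S_INR; pose proof (pos_INR n); lra).
  assert (hN : 1 <= INR (S N)) by (rewrite S_INR; pose proof (pos_INR N); lra).
  unfold corrector. simpl (Im Ci).
  assert (A1 : / L ^ 2 <= / 1024).
  { apply Rinv_le_contravar; [lra|]. replace 1024 with (32 ^ 2) by ring. apply pow_incr; lra. }
  assert (A2 : pois p 0 Ci <= 1) by (apply pois_at_Ci; lra).
  assert (A3 : rsum N (fun j => (if Nat.eqb j i0 then 0 else (bite / r1) ^ 2) * pois (tau j) 0 Ci) <= / 1024).
  { eapply Rle_trans; [apply (rsum_le_const _ _ (/ (1024 * INR (S N))))|].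
    - intros k _. assert (hb : (bite / r1) ^ 2 <= / (1024 * INR (S N))).
      { unfold bite. replace ((r1 / (32 * INR (S N)) / r1) ^ 2) with (/ (1024 * (INR (S N) * INR (S N)))) by (field; lra).
        apply Rinv_le_contravar; [nra|]. nra. }
      assert (hb0 : 0 < / (1024 * INR (S N))) by (apply Rinv_0_lt_compat; lra).
      pose proof (pois_at_Ci (tau k) 0 (Rle_refl 0)).
      assert (0 <= pois (tau k) 0 Ci) by (apply pois_nonneg; simpl; lra).
      destruct (Nat.eqb k i0); [lra|]. rewrite <- (Rmult_1_r (/ (1024 * INR (S N)))).
      apply Rmult_le_compat; auto. apply pow2_ge_0.
    - rewrite S_INR in *. pose proof (pos_INR N). apply Rmult_le_reg_r with (1024 * (INR N + 1)); [lra|].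
      rewrite Rmult_assoc, Rinv_l by lra. lra. }
  assert (A4 : dyadic_pois sc p (fun q => 4 * / (sc / 2 ^ q)) n Ci <= INR (S n) * 4).
  { apply dyadic_pois_at_Ci; auto.
    - intros q. pose proof (scale_pos sc q h0). apply Rmult_le_pos; [lra|apply Rlt_le, Rinv_0_lt_compat; auto].
    - intros q _. pose proof (scale_pos sc q h0). right. set (s := sc / 2 ^ q) in *. field. lra. }
  assert (A5 : cone / INR (S n) * (h / (sc / 2 ^ n)) * dyadic_pois sc p (fun q => 4 * / (sc / 2 ^ q)) n Ci <= / 1024).
  { assert (hq : h / (sc / 2 ^ n) <= 1).
    { apply Rmult_le_reg_r with (sc / 2 ^ n); [auto|]. unfold Rdiv at 1. rewrite Rmult_assoc, Rinv_l by lra. lra. }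
    assert (hq0 : 0 < h / (sc / 2 ^ n)) by (apply Rdiv_lt_0_compat; lra).
    assert (hc0 : 0 < cone / INR (S n)) by (apply Rdiv_lt_0_compat; lra).
    apply Rle_trans with (cone / INR (S n) * 1 * (INR (S n) * 4)).
    - apply Rmult_le_compat; auto.
      + apply Rmult_le_pos; lra.
      + apply dyadic_pois_nonneg; [auto| |simpl; lra]. intros q. pose proof (scale_pos sc q h0).
        apply Rmult_le_pos; [lra|apply Rlt_le, Rinv_0_lt_compat; auto].
      + apply Rmult_le_compat_l; lra.
    - replace (cone / INR (S n) * 1 * (INR (S n) * 4)) with (4 * cone) by (field; lra). lra. }
  set (X := rsum N _) in *. set (Y := dyadic_pois _ _ _ _ _) in *.
  set (Z := cone / INR (S n) * (h / (sc / 2 ^ n))) in *. lra.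
Qed.

(** The floor [h / 4] is the line on which the Green functions used for the box vanish; a zero of
    height at least [h] lies well above it, as [green_at_Ci] requires. *)
Definition constraints (n : nat) (h : R) : list (C -> R) :=
  (fun w => L + -1 * Cmod w) :: (fun w => Im w + - (h / 4)) ::
  (fun w => Cmod (Cminus w (RtoC p)) + - (sc / 2 ^ n / 32)) ::
  (fun w => Im w + - (cone / INR (S n) * (h / (sc / 2 ^ n))) * Cmod (Cminus w (RtoC p))) ::
  map (fun j w => Cmod (Cminus w (RtoC (tau j))) + - bite) (filter (fun j => negb (Nat.eqb j i0)) (seq 0 N)).

(** [P] is taken to be nonnegativity for the domain and positivity for its interior. *)
Lemma constraints_spec (P : R -> Prop) n h w :
  List.Forall (fun F => P (F w)) (constraints n h) <->
  P (L + -1 * Cmod w) /\ P (Im w + - (h / 4)) /\ P (Cmod (Cminus w (RtoC p)) + - (sc / 2 ^ n / 32)) /\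
  P (Im w + - (cone / INR (S n) * (h / (sc / 2 ^ n))) * Cmod (Cminus w (RtoC p))) /\
  forall j, (j < N)%nat -> j <> i0 -> P (Cmod (Cminus w (RtoC (tau j))) + - bite).
Proof.
  unfold constraints. rewrite !Forall_cons_iff, Forall_map, Forall_forall.
  assert (E : forall Q : nat -> Prop, (forall x, In x (filter (fun j => negb (Nat.eqb j i0)) (seq 0 N)) -> Q x) <->
     (forall j, (j < N)%nat -> j <> i0 -> Q j)).
  { intros Q. split.
    - intros H j hj hne. apply H. apply filter_In. split; [apply in_seq; lia|].
      apply Bool.negb_true_iff, Nat.eqb_neq, hne.
    - intros H x hx. apply filter_In in hx. destruct hx as [hx1 hx2]. apply in_seq in hx1.
      apply Bool.negb_true_iff, Nat.eqb_neq in hx2. apply H; [lia|auto]. }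
  rewrite (E (fun j => P (Cmod (Cminus w (RtoC (tau j))) + - bite))). tauto.
Qed.

Lemma constraints_cont n h F : In F (constraints n h) -> forall v, cont F v.
Proof.
  intros hF v. unfold constraints in hF. simpl in hF.
  destruct hF as [<-|[<-|[<-|[<-|hF]]]].
  - apply cont_plus; [apply cont_const|apply cont_scal, cont_Cmod].
  - apply cont_plus; [apply cont_Im|apply cont_const].
  - apply cont_plus; [apply cont_Cmod_shift|apply cont_const].
  - apply cont_plus; [apply cont_Im|apply cont_scal, cont_Cmod_shift].
  - apply in_map_iff in hF. destruct hF as [j [<- _]]. apply cont_plus; [apply cont_Cmod_shift|apply cont_const].
Qed.

Lemma Cmod_sub_ge (w z v : C) : Cmod (Cminus z v) - Cmod (Cminus w v) <= Cmod (Cminus w z).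
Proof. rewrite (Cmod_minus_sym w z). pose proof (Cmod_triangle_minus z w v). lra. Qed.

Lemma pois_zero_width t w : pois t 0 w = Im w / Cmod (Cminus w (RtoC t)) ^ 2.
Proof. unfold pois. rewrite Ropp_0, Rplus_0_r. reflexivity. Qed.

(** One case for each part of the boundary. On the floor the Green function is [0]. On the outer
    circle and on the removed discs [w] is at least half of [L], [rho] or [r1] away from [z], and a
    single summand of [corrector] suffices. On the cone [Im w] is proportional to the distance from
    [p], so the Green function decays like its inverse, which is what the dyadic sum with
    coefficients [4 / s] dominates. *)
Lemma box_boundary n h w z :
  (n1 <= n)%nat -> 0 < h <= sc / 2 ^ n ->
  List.Forall (fun F => 0 <= F w) (constraints n h) ->
  Cmod z <= 1 -> (forall j, (j < N)%nat -> j <> i0 -> r1 <= Cmod (Cminus z (RtoC (tau j)))) ->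
  sc / 2 ^ n <= Cmod (Cminus z (RtoC p)) ->
  (Cmod (Cminus z (RtoC p)) <= 2 * (sc / 2 ^ n) \/ n = n1) -> h <= Im z -> w <> z ->
  ~ List.Forall (fun F => 0 < F w) (constraints n h) ->
  green (h / 4) z w <= Im z * corrector n h w.
Proof.
  intros hn hh Hw hz1 hzt hzp hzp2 hzh hne Hb.
  destruct box_consts as [h0 [h1 [h2 [h3 [h4 h5]]]]].
  pose proof (scale_pos sc n h0) as hs.
  assert (hSn : 1 <= INR (S n)) by (rewrite S_INR; pose proof (pos_INR n); lra).
  apply constraints_spec in Hw. destruct Hw as [w1 [w2 [w3 [w4 w5]]]].
  set (rho := sc / 2 ^ n) in *.
  set (ka := cone / INR (S n) * (h / rho)) in *.
  assert (hka : 0 < ka) by (apply Rmult_lt_0_compat; apply Rdiv_lt_0_compat; lra).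
  assert (T1 : 0 <= / L ^ 2 * Im w).
  { apply Rmult_le_pos; [apply Rlt_le, Rinv_0_lt_compat, pow_lt; lra|lra]. }
  assert (T2 : 0 <= (/32)^2 * pois p 0 w) by (apply Rmult_le_pos; [apply pow_le; lra|apply pois_nonneg; lra]).
  assert (T3' : forall k, (k < N)%nat -> 0 <= (if Nat.eqb k i0 then 0 else (bite / r1) ^ 2) * pois (tau k) 0 w).
  { intros k _. apply Rmult_le_pos; [|apply pois_nonneg; lra]. destruct (Nat.eqb k i0); [lra|apply pow2_ge_0]. }
  assert (T3 := rsum_nonneg N _ T3').
  assert (hcoef : forall q, 0 <= 4 * / (sc / 2 ^ q)).
  { intros q. pose proof (scale_pos sc q h0). apply Rmult_le_pos; [lra|apply Rlt_le, Rinv_0_lt_compat; auto]. }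
  assert (T4 : 0 <= 2 * ka * dyadic_pois sc p (fun q => 4 * / (sc / 2 ^ q)) n w).
  { apply Rmult_le_pos; [lra|]. apply dyadic_pois_nonneg; auto; lra. }
  (* [D] is the length scale of the boundary part at hand; [X] is the summand of [corrector],
     without the factor [8], that pays for it. *)
  assert (hfar : forall D X, 0 < D -> D / 2 <= Cmod (Cminus w z) -> Im w / D ^ 2 <= X -> 8 * X <= corrector n h w ->
     green (h / 4) z w <= Im z * corrector n h w).
  { intros D X hD hDw hX hXc. eapply Rle_trans; [apply (green_far (h/4) z w D); auto; lra|].
    apply Rle_trans with (Im z * (8 * (Im w / D ^ 2))); [right; field; lra|].
    apply Rmult_le_compat_l; lra. }
  unfold corrector in *. fold rho in hfar |- *. fold ka in hfar |- *.
  destruct (Req_dec (Im w) (h / 4)) as [b2|b2].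
  { eapply Rle_trans; [apply green_upper; auto; lra|]. rewrite b2, Rminus_diag, Rmult_0_l, Rmult_0_r.
    unfold Rdiv at 1. rewrite Rmult_0_l. rewrite <- b2. apply Rmult_le_pos; lra. }
  destruct (Req_dec (Cmod w) L) as [b1|b1].
  { apply (hfar L (/ L ^ 2 * Im w)); [lra| |unfold Rdiv; lra|lra].
    pose proof (Cmod_triangle (Cminus w z) z) as T. replace (Cplus (Cminus w z) z) with w in T by ring. lra. }
  destruct (Req_dec (Cmod (Cminus w (RtoC p))) (rho / 32)) as [b3|b3].
  { apply (hfar rho ((/32)^2 * pois p 0 w)); [lra| | |lra].
    - pose proof (Cmod_sub_ge w z (RtoC p)). lra.
    - rewrite pois_zero_width, b3. right. field. lra. }
  destruct (classic (exists j, (j < N)%nat /\ j <> i0 /\ Cmod (Cminus w (RtoC (tau j))) = bite)) as [[j [hj [hji b5]]]|b5].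
  { pose proof (rsum_term N _ j T3' hj) as T3j. simpl in T3j.
    rewrite (proj2 (Nat.eqb_neq j i0) hji) in T3j.
    apply (hfar r1 ((bite / r1) ^ 2 * pois (tau j) 0 w)); [lra| | |simpl in *; lra].
    - pose proof (Cmod_sub_ge w z (RtoC (tau j))). specialize (hzt j hj hji). lra.
    - rewrite pois_zero_width, b5. right. field. lra. }
  set (v := Cmod (Cminus w (RtoC p))) in *.
  assert (hv0 : 0 < v) by lra.
  assert (hvS : v <= sc).
  { unfold v, sc. pose proof (Cmod_triangle w (Copp (RtoC p))) as T. rewrite Cmod_opp, Cmod_R in T.
    specialize (htau i0 hi0). fold p in htau. unfold Cminus. lra. }
  destruct (Req_dec (Im w) (ka * v)) as [b4|b4].
  { assert (hkr : ka * rho = cone / INR (S n) * h) by (unfold ka; field; lra).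
    assert (hc1 : cone / INR (S n) <= cone).
    { apply Rmult_le_reg_r with (INR (S n)); [lra|]. unfold Rdiv. rewrite Rmult_assoc, Rinv_l by lra. nra. }
    (* The cone emerges above the floor only where [v] is large compared with [rho]: there
       [ka * v = Im w >= h / 4]. Such points are far from a box of size [rho]. *)
    assert (hv1 : rho <= 4 * cone * v).
    { apply Rmult_le_reg_l with ka; [auto|]. rewrite hkr. apply Rle_trans with (cone * h); [apply Rmult_le_compat_r; lra|].
      replace (ka * (4 * cone * v)) with (4 * cone * (ka * v)) by ring. rewrite <- b4.
      assert (cone * (h / 4) <= cone * Im w) by (apply Rmult_le_compat_l; lra). lra. }
    destruct hzp2 as [hzp2|E].
    - assert (hv2 : 4 * rho <= v) by nra.
      apply (hfar v (2 * ka * dyadic_pois sc p (fun q => 4 * / (sc / 2 ^ q)) n w)); [lra| | |lra].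
      + pose proof (Cmod_sub_ge z w (RtoC p)). rewrite (Cmod_minus_sym z w) in H. fold v in H. lra.
      + destruct (dyadic_scale sc n v (conj hv0 hvS)) as [q [hq [hq1 hq2]]].
        assert (hw0 : 0 <= Im w) by lra.
        pose proof (dyadic_pois_lower sc p (fun q => 4 * / (sc / 2 ^ q)) n q w h0 hcoef hw0 hq hq1) as HL.
        simpl in HL. pose proof (scale_pos sc q h0) as hsq.
        assert (hq3 : sc / 2 ^ q <= 2 * v) by (destruct hq2 as [hq2| ->]; [auto|fold rho; lra]).
        assert (hi : / (2 * v) <= / (sc / 2 ^ q)) by (apply Rinv_le_contravar; auto).
        rewrite b4. replace (ka * v / v ^ 2) with (2 * ka * / (2 * v)) by (field; lra).
        apply Rmult_le_compat_l; lra.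
    (* For [n = n1] the distance from [z] to [p] has no upper bound in terms of [rho], but then
       [rho = r1] and [v <= sc] make [hv1] impossible. *)
    - exfalso. unfold rho in hv1. rewrite E in hv1. fold r1 in hv1. unfold cone in hv1.
      assert (r1 / (4096 * L) * v <= r1 / 2048).
      { apply Rle_trans with (r1 / (4096 * L) * (2 * L)); [apply Rmult_le_compat_l; [fold cone; lra|exact hvS]|]. right. field. lra. }
      lra. }
  exfalso. apply Hb. apply constraints_spec. fold rho ka v. repeat split; try lra.
  intros j hj hji. specialize (w5 j hj hji).
  destruct (Req_dec (Cmod (Cminus w (RtoC (tau j)))) bite) as [E|E]; [|lra].
  exfalso. apply b5. exists j; auto.
Qed.

Definition majorant (a gam : R) (n : nat) (h : R) (w : C) : R :=
  Rpower (cone / INR (S n) * (h / (sc / 2 ^ n))) (- a) *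
  dyadic_pois sc p (fun q => 4 * Rpower (sc / 2 ^ q) (- gam)) n w.

(** The cone turns [(Im w) ^ - a] into [ka ^ - a v ^ - a]. As [v <= sc], the power [v ^ (u - a)] is
    at most [sc ^ (gam - (a - u)) v ^ - gam]. The disc removed around [p] has radius [rho / 32], so
    some dyadic scale between [v] and [32 * v] is available; hence [Rpower 32 gam]. *)
Lemma majorant_lower a u gam n h w : 0 <= a -> 1 <= gam -> a - u <= gam -> 0 < h ->
  List.Forall (fun F => 0 <= F w) (constraints n h) ->
  Rpower (Im w) (- a) * Rpower (Cmod (Cminus w (RtoC p))) u
  <= Rpower sc (gam - (a - u)) * Rpower 32 gam * majorant a gam n h w.
Proof.
  intros ha hg hu hh Hw. destruct box_consts as [h0 [h1 [h2 [h3 [h4 h5]]]]].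
  pose proof (scale_pos sc n h0) as hs.
  assert (hSn : 1 <= INR (S n)) by (rewrite S_INR; pose proof (pos_INR n); lra).
  apply constraints_spec in Hw. destruct Hw as [w1 [w2 [w3 [w4 w5]]]]. unfold majorant.
  set (rho := sc / 2 ^ n) in *. set (ka := cone / INR (S n) * (h / rho)) in *.
  assert (hka : 0 < ka) by (apply Rmult_lt_0_compat; apply Rdiv_lt_0_compat; lra).
  set (v := Cmod (Cminus w (RtoC p))) in *.
  assert (hv0 : 0 < v) by lra.
  assert (hvS : v <= sc).
  { unfold v, sc. pose proof (Cmod_triangle w (Copp (RtoC p))) as T. rewrite Cmod_opp, Cmod_R in T.
    specialize (htau i0 hi0). fold p in htau. unfold Cminus. lra. }
  destruct (dyadic_scale sc n v (conj hv0 hvS)) as [q [hq [hq1 hq2]]].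
  pose proof (scale_pos sc q h0) as hsq.
  assert (hq3 : sc / 2 ^ q <= 32 * v) by (destruct hq2 as [hq2| ->]; [|fold rho]; lra).
  assert (hcoef : forall q, 0 <= 4 * Rpower (sc / 2 ^ q) (- gam)).
  { intros k. pose proof (Rpower_pos (sc / 2 ^ k) (- gam)). lra. }
  assert (hw0 : 0 <= Im w) by lra.
  pose proof (dyadic_pois_lower sc p _ n q w h0 hcoef hw0 hq hq1) as HL. simpl in HL.
  set (Dy := dyadic_pois _ _ _ _ _) in *.
  assert (HD : Rpower (32 * v) (- gam) <= Dy).
  { pose proof (Rpower_anti (sc / 2 ^ q) (32 * v) gam (conj hsq hq3)). lra. }
  assert (Hy : Rpower (Im w) (- a) <= Rpower ka (- a) * Rpower v (- a)).
  { rewrite <- Rpower_mult_base by auto. apply Rpower_anti; [|auto]. split; [apply Rmult_lt_0_compat; auto|lra]. }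
  apply Rle_trans with (Rpower ka (- a) * (Rpower v (- a) * Rpower v u)).
  { rewrite <- Rmult_assoc. apply Rmult_le_compat_r; [apply Rlt_le, Rpower_pos|auto]. }
  replace (Rpower sc (gam - (a - u)) * Rpower 32 gam * (Rpower ka (- a) * Dy))
    with (Rpower ka (- a) * (Rpower sc (gam - (a - u)) * (Rpower 32 gam * Dy))) by ring.
  apply Rmult_le_compat_l; [apply Rlt_le, Rpower_pos|].
  rewrite <- Rpower_plus. replace (- a + u) with ((gam - (a - u)) + - gam) by ring. rewrite Rpower_plus.
  apply Rmult_le_compat; try apply Rlt_le, Rpower_pos.
  - apply Rpower_mono; [lra|lra].
  - apply Rle_trans with (Rpower 32 gam * Rpower (32 * v) (- gam)).
    + right. rewrite Rpower_mult_base by lra. rewrite <- Rmult_assoc, <- Rpower_plus.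
      replace (gam + - gam) with 0 by ring. rewrite Rpower_O by lra. ring.
    + apply Rmult_le_compat_l; [apply Rlt_le, Rpower_pos|auto].
Qed.

(** Since [gam >= 1], among the values [4 s ^ (1 - gam)] the one at the finest scale [rho] is the
    largest, and there are [n + 1] of them. Together with the [(n + 1) ^ a] from the slope of the
    cone this yields the exponent [1 + a]. *)
Lemma majorant_at_Ci a gam n h : 0 <= a -> 1 <= gam -> 0 < h ->
  majorant a gam n h Ci <= Rpower cone (- a) *
    (4 * (Rpower (INR (S n)) (1 + a) * (Rpower (h / (sc / 2 ^ n)) (- a) * Rpower (sc / 2 ^ n) (1 - gam)))).
Proof.
  intros ha hg hh. destruct box_consts as [h0 [h1 [h2 [h3 [h4 h5]]]]].
  pose proof (scale_pos sc n h0) as hs. unfold majorant.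
  assert (hSn : 1 <= INR (S n)) by (rewrite S_INR; pose proof (pos_INR n); lra).
  set (rho := sc / 2 ^ n) in *.
  assert (HD : dyadic_pois sc p (fun q => 4 * Rpower (sc / 2 ^ q) (- gam)) n Ci <= INR (S n) * (4 * Rpower rho (1 - gam))).
  { apply dyadic_pois_at_Ci; auto.
    - intros k. pose proof (Rpower_pos (sc / 2 ^ k) (- gam)). lra.
    - intros q hq. pose proof (scale_pos sc q h0). rewrite Rmult_assoc. apply Rmult_le_compat_l; [lra|].
      rewrite <- (Rpower_1 (sc / 2 ^ q)) at 2 by auto. rewrite <- Rpower_plus.
      replace (- gam + 1) with (- (gam - 1)) by ring. replace (1 - gam) with (- (gam - 1)) by ring.
      apply Rpower_anti; [|lra]. split; [auto|]. apply scale_mono; auto. }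
  assert (E : Rpower (cone / INR (S n) * (h / rho)) (- a) = Rpower cone (- a) * (Rpower (INR (S n)) a * Rpower (h / rho) (- a))).
  { assert (0 < h / rho) by (apply Rdiv_lt_0_compat; lra). unfold Rdiv at 1.
    rewrite !Rpower_mult_base; auto; try apply Rmult_lt_0_compat; auto; try (apply Rinv_0_lt_compat; lra).
    rewrite Rmult_assoc. f_equal. f_equal. unfold Rpower. f_equal. rewrite ln_Rinv by lra. ring. }
  rewrite E. eapply Rle_trans; [apply Rmult_le_compat_l; [|exact HD]|].
  - pose proof (Rpower_pos cone (- a)). pose proof (Rpower_pos (INR (S n)) a). pose proof (Rpower_pos (h / rho) (- a)).
    apply Rlt_le. repeat apply Rmult_lt_0_compat; auto.
  - right. rewrite Rpower_plus, Rpower_1 by lra. ring.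
Qed.

(** Each zero contributes at least [Im z / 8 - Im z / 16 >= h / 16] at [i]. The constant [128] is
    [16 * 2 * 4]: this [16], the [2] from using half of the potential, and the [4] in the
    coefficients of [majorant]. *)
Lemma box_count (f : C -> C) (K A a u gam : R) (n : nat) (h : R) (zs : list (C * nat)) :
  0 <= K -> 0 <= A -> 0 <= a -> 1 <= gam -> a - u <= gam -> (n1 <= n)%nat -> 0 < h <= sc / 2 ^ n ->
  (forall w, 0 < Im w -> jet f w) -> Cmod (f Ci) = 1 ->
  (forall w, 0 < Im w -> Cmod w <= L ->
     (forall j, (j < N)%nat -> j <> i0 -> bite <= Cmod (Cminus w (RtoC (tau j)))) -> f w <> RtoC 0 ->
     ln (Cmod (f w)) <= K * (A * (Rpower (Im w) (- a) * Rpower (Cmod (Cminus w (RtoC p))) u))) ->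
  NoDup (map fst zs) ->
  (forall q, In q zs -> (1 <= snd q)%nat /\ vanishes_to f (fst q) (snd q) /\ Cmod (fst q) <= 1 /\
     (forall j, (j < N)%nat -> j <> i0 -> r1 <= Cmod (Cminus (fst q) (RtoC (tau j)))) /\
     sc / 2 ^ n <= Cmod (Cminus (fst q) (RtoC p)) /\
     (Cmod (Cminus (fst q) (RtoC p)) <= 2 * (sc / 2 ^ n) \/ n = n1) /\ h <= Im (fst q)) ->
  h * zsum (fun _ => 1) zs <=
   (128 * A * (Rpower sc (gam - (a - u)) * Rpower 32 gam) * Rpower cone (- a)) * K *
    (Rpower (INR (S n)) (1 + a) * (Rpower (h / (sc / 2 ^ n)) (- a) * Rpower (sc / 2 ^ n) (1 - gam))).
Proof.
  intros hK hA ha hg hu hn hh Hjet Hf Hlog Hnd Hzs.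
  destruct box_consts as [h0 [h1 [h2 [h3 [h4 h5]]]]].
  pose proof (scale_pos sc n h0) as hs.
  assert (hSn : 1 <= INR (S n)) by (rewrite S_INR; pose proof (pos_INR n); lra).
  set (A2 := Rpower sc (gam - (a - u)) * Rpower 32 gam).
  assert (hA2 : 0 < A2) by (apply Rmult_lt_0_compat; apply Rpower_pos).
  assert (hrn : sc / 2 ^ n <= r1) by (apply scale_mono; auto).
  assert (HCi : forall x : R, 1 <= Cmod (Cminus Ci (RtoC x))).
  { intros x. eapply Rle_trans; [|apply Im_le_Cmod]. simpl. rewrite Ropp_0, Rplus_0_r, Rabs_R1. lra. }
  assert (Hmain := zero_count f zs (h / 4) K L (corrector n h) (fun w => A * A2 * majorant a gam n h w) (constraints n h) Ci hK).
  assert (Hconcl : zsum (fun z => green (h / 4) z Ci - Im z * corrector n h Ci) zs <= 2 * (K * (A * A2 * majorant a gam n h Ci))).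
  { apply Hmain; auto.
    - intros w hw. apply Hjet. lra.
    - intros F hF. apply (constraints_cont n h F hF).
    - intros w Hw. pose proof (majorant_lower a u gam n h w ha hg hu (proj1 hh) Hw) as HU. fold A2 in HU.
      pose proof Hw as Hw'. apply constraints_spec in Hw'. destruct Hw' as [w1 [w2 [w3 [w4 w5]]]].
      assert (hw0 : 0 < Im w) by lra.
      assert (hcoef : forall q, 0 <= 4 * Rpower (sc / 2 ^ q) (- gam)).
      { intros k. pose proof (Rpower_pos (sc / 2 ^ k) (- gam)). lra. }
      split; [lra|split; [lra|split; [apply good_corrector; auto|split; [|split; [|split]]]]].
      + apply good_scal. unfold majorant. apply good_scal, good_dyadic_pois; auto.
      + apply corrector_nonneg; lra.
      + apply Rmult_le_pos; [apply Rmult_le_pos; lra|]. apply Rmult_le_pos; [apply Rlt_le, Rpower_pos|].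
        apply dyadic_pois_nonneg; auto; lra.
      + intros hf. eapply Rle_trans; [apply Hlog; auto|].
        * lra.
        * intros j hj hji. specialize (w5 j hj hji). lra.
        * apply Rmult_le_compat_l; [auto|]. rewrite Rmult_assoc. apply Rmult_le_compat_l; auto.
    - intros w Hw. destruct (classic (List.Forall (fun F => 0 < F w) (constraints n h))) as [hi|hb]; [right; auto|left].
      intros q hq hne. destruct (Hzs q hq) as [q1 [q2 [q3 [q4 [q5 [q6 q7]]]]]].
      apply box_boundary; auto.
    - intros q hq. destruct (Hzs q hq) as [q1 [q2 [q3 [q4 [q5 [q6 q7]]]]]]. repeat split; auto; lra.
    - apply constraints_spec. rewrite Cmod_Ci. simpl (Im Ci).
      repeat split; try (pose proof (HCi p); lra).
      + set (v := Cmod (Cminus Ci (RtoC p))).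
        assert (hvS : v <= sc).
        { unfold v, sc. pose proof (Cmod_triangle Ci (Copp (RtoC p))) as T. rewrite Cmod_opp, Cmod_R, Cmod_Ci in T.
          specialize (htau i0 hi0). fold p in htau. unfold Cminus. lra. }
        assert (hc1 : cone / INR (S n) <= cone).
        { apply Rmult_le_reg_r with (INR (S n)); [lra|]. unfold Rdiv. rewrite Rmult_assoc, Rinv_l by lra. nra. }
        assert (hc0 : 0 < cone / INR (S n)) by (apply Rdiv_lt_0_compat; lra).
        assert (hq : h / (sc / 2 ^ n) <= 1).
        { apply Rmult_le_reg_r with (sc / 2 ^ n); [auto|]. unfold Rdiv at 1. rewrite Rmult_assoc, Rinv_l by lra. lra. }
        assert (hq0 : 0 < h / (sc / 2 ^ n)) by (apply Rdiv_lt_0_compat; lra).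
        assert (cone / INR (S n) * (h / (sc / 2 ^ n)) * v <= cone * 1 * sc).
        { apply Rmult_le_compat; [apply Rlt_le, Rmult_lt_0_compat; auto|apply Cmod_ge_0| |auto].
          apply Rmult_le_compat; lra. }
        assert (cone * 1 * sc = r1 / 2048) by (unfold cone, sc; field; lra). lra.
      + intros j hj hji. pose proof (HCi (tau j)). lra. }
  assert (hlow : (h / 16) * zsum (fun _ => 1) zs <= zsum (fun z => green (h / 4) z Ci - Im z * corrector n h Ci) zs).
  { rewrite <- zsum_scal. apply zsum_le. intros q hq. destruct (Hzs q hq) as [q1 [q2 [q3 [q4 [q5 [q6 q7]]]]]].
    assert (hne : Ci <> fst q).
    { intros E. destruct q2 as [M [r2 [hr2 [hM HM]]]]. specialize (HM (RtoC 0) ltac:(rewrite Cmod_0; lra)).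
      replace (Cplus (fst q) (RtoC 0)) with Ci in HM by (rewrite E; ring).
      rewrite Cmod_0, pow_i in HM by lia. lra. }
    pose proof (green_at_Ci (h / 4) (fst q)) as HG. 
    pose proof (corrector_at_Ci n h hh) as HC.
    assert (Im (fst q) / 8 <= green (h / 4) (fst q) Ci) by (apply HG; auto; lra).
    assert (Im (fst q) * corrector n h Ci <= Im (fst q) * / 16) by (apply Rmult_le_compat_l; lra). lra. }
  pose proof (majorant_at_Ci a gam n h ha hg (proj1 hh)) as HU.
  set (X := Rpower (INR (S n)) (1 + a) * (Rpower (h / (sc / 2 ^ n)) (- a) * Rpower (sc / 2 ^ n) (1 - gam))) in *.
  assert (K * (A * A2 * majorant a gam n h Ci) <= K * (A * A2 * (Rpower cone (- a) * (4 * X)))).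
  { apply Rmult_le_compat_l; [auto|]. apply Rmult_le_compat_l; [|auto]. apply Rmult_le_pos; lra. }
  replace (128 * A * A2 * Rpower cone (- a) * K * X) with (16 * (2 * (K * (A * A2 * (Rpower cone (- a) * (4 * X)))))) by ring.
  lra.
Qed.
End Box.

(** * Summation over boxes *)

Lemma rsum_geometric x n : 0 <= x < 1 -> rsum n (fun k => x ^ k) <= / (1 - x).
Proof.
  intros hx. assert (E : rsum n (fun k => x ^ k) * (1 - x) = 1 - x ^ n).
  { induction n as [|n IH]; simpl; [ring|]. rewrite Rmult_plus_distr_r, IH. ring. }
  assert (0 <= x ^ n) by (apply pow_le; lra).
  apply Rmult_le_reg_r with (1 - x); [lra|]. rewrite E, Rinv_l by lra. lra.
Qed.

Lemma rsum_scal c n u : rsum n (fun k => c * u k) = c * rsum n u.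
Proof. induction n as [|n IH]; simpl; [ring|]. rewrite IH. ring. Qed.

(** Write [y = exp (- 2 lam)]. Half of the decay absorbs the power, since [ln k <= th k - 1 - ln th]
    with [al th <= lam]; the other half is summed as a geometric series. *)
Lemma rsum_poly_geometric al y : 0 <= al -> 0 < y < 1 ->
  exists G, 0 < G /\ forall X, rsum X (fun n => Rpower (INR (S n)) al * y ^ n) <= G.
Proof.
  intros ha hy. set (lam := - ln y / 2).
  assert (hl : 0 < lam). { unfold lam. assert (ln y < 0) by (rewrite <- ln_1; apply ln_increasing; lra). lra. }
  set (th := lam / (al + 1)). assert (hth : 0 < th) by (apply Rdiv_lt_0_compat; lra).
  assert (hal : al * th <= lam).
  { unfold th. apply Rmult_le_reg_r with (al + 1); [lra|]. unfold Rdiv.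
    replace (al * (lam * / (al + 1)) * (al + 1)) with (al * lam) by (field; lra). nra. }
  set (G0 := exp (lam + al * (- 1 - ln th))). set (x := exp (- lam)).
  assert (hx : 0 < x < 1). { split; [apply exp_pos|]. unfold x. rewrite <- exp_0. apply exp_increasing. lra. }
  exists (G0 * / (1 - x)). split.
  { apply Rmult_lt_0_compat; [apply exp_pos|apply Rinv_0_lt_compat; lra]. }
  intros X. apply Rle_trans with (rsum X (fun n => G0 * x ^ n)).
  2:{ rewrite rsum_scal. apply Rmult_le_compat_l; [apply Rlt_le, exp_pos|]. apply rsum_geometric. lra. }
  apply rsum_le. intros n _.
  assert (hn : 1 <= INR (S n)) by (rewrite S_INR; pose proof (pos_INR n); lra).
  assert (hln : ln (INR (S n)) <= th * INR (S n) - 1 - ln th).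
  { assert (h1 : 0 < th * INR (S n)) by (apply Rmult_lt_0_compat; lra).
    pose proof (exp_ineq1_le (th * INR (S n) - 1)) as T.
    replace (1 + (th * INR (S n) - 1)) with (th * INR (S n)) in T by ring.
    apply ln_le in T; [|auto]. rewrite ln_exp, ln_mult in T by lra. lra. }
  assert (Ey : y ^ n = exp (- (2 * lam) * INR n)).
  { rewrite <- (Rpower_pow n y) by lra. unfold Rpower. f_equal. unfold lam. field. }
  assert (Ex : x ^ n = exp (- lam * INR n)).
  { rewrite <- (Rpower_pow n x) by lra. unfold Rpower, x. rewrite ln_exp. f_equal. ring. }
  rewrite Ey, Ex. unfold Rpower, G0. rewrite <- !exp_plus. apply exp_le_compat.
  apply (Rmult_le_compat_l al) in hln; [|auto].
  assert (al * th * INR (S n) <= lam * INR (S n)) by (apply Rmult_le_compat_r; lra).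
  rewrite S_INR in *. nra.
Qed.

Lemma rsum_update X (s : nat -> R) k c : (k < X)%nat ->
  rsum X (fun j => (if Nat.eqb k j then c else 0) + s j) = c + rsum X s.
Proof.
  assert (E : forall Y, (Y <= k)%nat -> rsum Y (fun j => (if Nat.eqb k j then c else 0) + s j) = rsum Y s).
  { induction Y as [|Y IH]; intros hY; simpl; [reflexivity|]. rewrite IH by lia.
    rewrite (proj2 (Nat.eqb_neq k Y)) by lia. ring. }
  induction X as [|X IH]; intros hk; [lia|]. simpl.
  destruct (Nat.eq_dec k X) as [->|hne].
  - rewrite E, Nat.eqb_refl by lia. ring.
  - rewrite IH by lia. rewrite (proj2 (Nat.eqb_neq k X)) by lia. ring.
Qed.

Lemma rsum_ext n u v : (forall k, u k = v k) -> rsum n u = rsum n v.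
Proof. intros E. induction n as [|n IH]; simpl; [reflexivity|]. rewrite IH, E. reflexivity. Qed.

Lemma rsum_zero n : rsum n (fun _ => 0) = 0.
Proof. induction n as [|n IH]; simpl; [reflexivity|]. rewrite IH. ring. Qed.

Lemma rsum_support N u X : (forall k, 0 <= u k) -> (forall k, (N <= k)%nat -> u k = 0) -> rsum X u <= rsum N u.
Proof.
  intros h0 hN.
  assert (H1 : forall a b, rsum a u <= rsum (a + b) u).
  { intros a b. induction b as [|b IH]; [rewrite Nat.add_0_r; lra|].
    rewrite Nat.add_succ_r. simpl. specialize (h0 (a + b)%nat). lra. }
  assert (H2 : forall b, rsum (N + b) u = rsum N u).
  { induction b as [|b IH]; [rewrite Nat.add_0_r; reflexivity|].
    rewrite Nat.add_succ_r. simpl. rewrite IH, hN by lia. ring. }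
  eapply Rle_trans; [apply (H1 X N)|]. rewrite Nat.add_comm, H2. lra.
Qed.

(** Summation over the fibres of [key]. The bound on all partial sums of [b] takes the place of an
    infinite series, because the number of occupied layers depends on the list. *)
Lemma zsum_layers (key : C -> nat) (F : C -> R) (zs : list (C * nat)) (b : nat -> R) (B : R) :
  (forall k, zsum F (filter (fun p => Nat.eqb (key (fst p)) k) zs) <= b k) ->
  (forall X, rsum X b <= B) -> zsum F zs <= B.
Proof.
  intros Hk HB.
  assert (HX : exists X, forall p, In p zs -> (key (fst p) < X)%nat).
  { clear. induction zs as [|p zs [X HX]]; [exists O; intros p []|].
    exists (Nat.max X (S (key (fst p)))). intros q [<-|hq]; [lia|]. specialize (HX q hq). lia. }
  destruct HX as [X HX].
  assert (E : zsum F zs = rsum X (fun k => zsum F (filter (fun p => Nat.eqb (key (fst p)) k) zs))).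
  { clear Hk. revert HX. induction zs as [|p zs IH]; intros HX.
    - simpl. rewrite rsum_zero. reflexivity.
    - simpl. rewrite IH by (intros; apply HX; right; auto).
      rewrite <- (rsum_update X _ (key (fst p)) (INR (snd p) * F (fst p))) by (apply HX; left; auto).
      apply rsum_ext. intros k. destruct (Nat.eqb (key (fst p)) k); simpl; ring. }
  rewrite E. eapply Rle_trans; [|apply (HB X)]. apply rsum_le. intros k _. apply Hk.
Qed.

Lemma NoDup_map_filter {S T : Type} (g : S -> T) (P : S -> bool) l : NoDup (map g l) -> NoDup (map g (filter P l)).
Proof.
  induction l as [|x l IH]; intros Hl; simpl in *; [exact Hl|]. inversion Hl as [|? ? h1 h2]; subst.
  destruct (P x); simpl; [|auto]. constructor; [|auto]. intros hin. apply h1.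
  apply in_map_iff in hin. destruct hin as [y [E hy]]. apply filter_In in hy. rewrite <- E. apply in_map, hy.
Qed.

(** * Finite products, dyadic scales and separation of the boundary points *)

Lemma rprod_nonneg n u : (forall k, (k < n)%nat -> 0 <= u k) -> 0 <= rprod n u.
Proof. induction n as [|n IH]; intros H; simpl; [lra|]. apply Rmult_le_pos; [apply IH; intros; apply H; lia|apply H; lia]. Qed.

Lemma rprod_pos n u : (forall k, (k < n)%nat -> 0 < u k) -> 0 < rprod n u.
Proof. induction n as [|n IH]; intros H; simpl; [lra|]. apply Rmult_lt_0_compat; [apply IH; intros; apply H; lia|apply H; lia]. Qed.

Lemma rprod_le n u v : (forall k, (k < n)%nat -> 0 <= u k <= v k) -> rprod n u <= rprod n v.
Proof.
  induction n as [|n IH]; intros H; simpl; [lra|].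
  apply Rmult_le_compat; [apply rprod_nonneg; intros; apply H; lia|apply H; lia|apply IH; intros; apply H; lia|apply H; lia].
Qed.

Lemma rprod_ext n u v : (forall k, (k < n)%nat -> u k = v k) -> rprod n u = rprod n v.
Proof. induction n as [|n IH]; intros H; simpl; [reflexivity|]. rewrite IH by (intros; apply H; lia). rewrite H by lia. reflexivity. Qed.

Lemma rprod_isolate n i x (u : nat -> R) : (i < n)%nat ->
  rprod n (fun j => if Nat.eqb j i then x else u j) = x * rprod n (fun j => if Nat.eqb j i then 1 else u j).
Proof.
  intros hi. induction n as [|n IH]; [lia|]. simpl.
  destruct (Nat.eq_dec n i) as [->|hne].
  - rewrite !Nat.eqb_refl. rewrite (rprod_ext i (fun j => if Nat.eqb j i then x else u j) (fun j => if Nat.eqb j i then 1 else u j)).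
    + ring.
    + intros k hk. rewrite (proj2 (Nat.eqb_neq k i)) by lia. reflexivity.
  - rewrite (proj2 (Nat.eqb_neq n i)) by auto. rewrite IH by lia. ring.
Qed.

(** The sum of both endpoint values serves either sign of [e]. *)
Lemma Rpower_between lo x hi e : 0 < lo <= x -> x <= hi -> Rpower x e <= Rpower lo e + Rpower hi e.
Proof.
  intros h1 h2. pose proof (Rpower_pos lo e). pose proof (Rpower_pos hi e).
  destruct (Rle_dec 0 e) as [he|he].
  - assert (Rpower x e <= Rpower hi e) by (apply Rpower_mono; lra). lra.
  - replace e with (- - e) at 1 by ring.
    assert (Rpower x (- - e) <= Rpower lo (- - e)) by (apply Rpower_anti; lra).
    replace (- - e) with e in * by ring. lra.
Qed.

(** Away from the other [tau j] only the factor at [i] can degenerate. *)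
Lemma rprod_dominated N i (tau e : nat -> R) lo hi : (i < N)%nat -> 0 < lo ->
  exists W, 0 < W /\ forall z, 0 < Im z ->
    (forall j, (j < N)%nat -> j <> i -> lo <= Cmod (Cminus z (RtoC (tau j)))) ->
    (forall j, (j < N)%nat -> Cmod (Cminus z (RtoC (tau j))) <= hi) ->
    rprod N (fun j => Rpower (Cmod (Cminus z (RtoC (tau j)))) (e j))
      <= W * Rpower (Cmod (Cminus z (RtoC (tau i)))) (e i).
Proof.
  intros hi0 hlo.
  exists (rprod N (fun j => if Nat.eqb j i then 1 else Rpower lo (e j) + Rpower hi (e j))). split.
  - apply rprod_pos. intros k _. pose proof (Rpower_pos lo (e k)). pose proof (Rpower_pos hi (e k)).
    destruct (Nat.eqb k i); lra.
  - intros z hz h1 h2. rewrite Rmult_comm, <- rprod_isolate by auto. apply rprod_le. intros k hk.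
    split; [apply Rlt_le, Rpower_pos|]. destruct (Nat.eqb_spec k i) as [->|hne]; [lra|].
    apply Rpower_between; auto.
Qed.

Lemma dyadic_bracket c v : 0 < v <= c -> exists m, c / 2 ^ m <= v <= 2 * (c / 2 ^ m).
Proof.
  intros hv.
  assert (Hn : exists n, c / 2 ^ n <= v).
  { destruct (Pow_x_infinity 2 ltac:(rewrite Rabs_pos_eq; lra) (c / v)) as [n Hn].
    exists n. specialize (Hn n (le_n n)). assert (h2 : 0 < 2 ^ n) by (apply pow_lt; lra).
    rewrite Rabs_pos_eq in Hn by lra. apply Rmult_le_reg_r with (2 ^ n); [auto|].
    unfold Rdiv. rewrite Rmult_assoc, Rinv_l by lra. apply Rge_le in Hn.
    apply (Rmult_le_compat_r v) in Hn; [|lra]. unfold Rdiv in Hn. rewrite Rmult_assoc, Rinv_l in Hn by lra. lra. }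
  destruct Hn as [n Hn]. induction n as [|n IH].
  - exists O. simpl in *. lra.
  - destruct (Rle_dec (c / 2 ^ n) v) as [h|h]; [apply IH; auto|].
    exists (S n). split; [auto|]. assert (0 < 2 ^ n) by (apply pow_lt; lra).
    replace (2 * (c / 2 ^ S n)) with (c / 2 ^ n) by (simpl; field; lra). lra.
Qed.

Lemma half_power_small c r : 0 < c -> 0 < r -> exists n, c / 2 ^ n <= r.
Proof.
  intros hc hr. destruct (Rle_dec c r) as [h|h].
  - exists O. simpl. lra.
  - destruct (dyadic_bracket c r) as [m [hm _]]; [lra|]. exists m. exact hm.
Qed.

Lemma finite_upper_bound n (u : nat -> R) b0 : exists b, b0 <= b /\ forall k, (k < n)%nat -> u k <= b.
Proof.
  induction n as [|n [b [hb IH]]]; [exists b0; split; [lra|intros; lia]|].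
  exists (Rmax b (u n)). split; [eapply Rle_trans; [exact hb|apply Rmax_l]|]. intros k hk.
  destruct (Nat.eq_dec k n) as [->|hne]; [apply Rmax_r|]. eapply Rle_trans; [apply IH; lia|apply Rmax_l].
Qed.

Lemma separation N (tau : nat -> R) :
  (forall i j, (i < N)%nat -> (j < N)%nat -> tau i = tau j -> i = j) ->
  exists g, 0 < g <= 1 /\ forall i j, (i < N)%nat -> (j < N)%nat -> i <> j -> g <= Rabs (tau i - tau j).
Proof.
  intros hd. 
  assert (H : forall n, (n <= N)%nat -> exists g, 0 < g <= 1 /\ forall i j, (i < n)%nat -> (j < N)%nat -> i <> j -> g <= Rabs (tau i - tau j)).
  { induction n as [|n IH]; intros hn.
    - exists 1. split; [lra|]. intros; lia.
    - destruct (IH ltac:(lia)) as [g [hg Hg]].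
      assert (H1 : forall m, (m <= N)%nat -> exists g, 0 < g <= 1 /\ forall j, (j < m)%nat -> n <> j -> g <= Rabs (tau n - tau j)).
      { induction m as [|m IHm]; intros hm; [exists 1; split; [lra|intros; lia]|].
        destruct (IHm ltac:(lia)) as [g' [hg' Hg']].
        destruct (Nat.eq_dec n m) as [E|E].
        - exists g'. split; auto. intros j hj hne. apply Hg'; lia.
        - assert (0 < Rabs (tau n - tau m)).
          { apply Rabs_pos_lt. intros E'. apply E. apply hd; [lia|lia|lra]. }
          exists (Rmin g' (Rabs (tau n - tau m))). split.
          + split; [apply Rmin_pos; lra|]. eapply Rle_trans; [apply Rmin_l|lra].
          + intros j hj hne. destruct (Nat.eq_dec j m) as [->|hjm]; [apply Rmin_r|].
            eapply Rle_trans; [apply Rmin_l|apply Hg'; lia]. }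
      destruct (H1 N (le_n N)) as [g' [hg' Hg']].
      exists (Rmin g g'). split; [split; [apply Rmin_pos; lra|eapply Rle_trans; [apply Rmin_l|lra]]|].
      intros i j hi hj hne. destruct (Nat.eq_dec i n) as [->|hin].
      + eapply Rle_trans; [apply Rmin_r|apply Hg'; auto].
      + eapply Rle_trans; [apply Rmin_l|apply Hg; lia]. }
  apply (H N (le_n N)).
Qed.

Lemma Im_le_dist_real (z : C) (t : R) : Im z <= Cmod (Cminus z (RtoC t)).
Proof.
  eapply Rle_trans; [|apply Im_le_Cmod]. eapply Rle_trans; [|apply Rle_abs]. destruct z; simpl; lra.
Qed.

(** [n] is the dyadic scale of the distance to [tau i], [l] that of the height relative to it. The
    box with [n = n1] also takes the zeros far from every [tau j]; their height may exceed [r1], and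
    the factor [2 / r1] in the last condition leaves room for it. *)
Definition in_box (N i n1 : nat) (tau : nat -> R) (L : R) (n l : nat) (z : C) : Prop :=
  let rho := 2 * L / 2 ^ n in
  (i < N)%nat /\ (n1 <= n)%nat /\
  (forall j, (j < N)%nat -> j <> i -> 2 * L / 2 ^ n1 <= Cmod (Cminus z (RtoC (tau j)))) /\
  rho <= Cmod (Cminus z (RtoC (tau i))) /\
  (Cmod (Cminus z (RtoC (tau i))) <= 2 * rho \/ n = n1) /\
  rho / 2 ^ l <= Im z /\ Im z <= 2 / (2 * L / 2 ^ n1) * (rho / 2 ^ l).

(** A point closer than [r1] to [tau i] is at least [r1] away from the others because they are
    [2 * r1] apart; bracketing its distance by halvings of [r1] gives [n = n1 + m]. Any other point
    goes to the box with [i = 0] and [n = n1]. *)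
Lemma in_box_exists N n1 tau L z : (0 < N)%nat -> 0 < L -> 2 * L / 2 ^ n1 <= 1 ->
  (forall i j, (i < N)%nat -> (j < N)%nat -> i <> j -> 2 * (2 * L / 2 ^ n1) <= Rabs (tau i - tau j)) ->
  0 < Im z -> Cmod z <= 1 -> exists i n l, in_box N i n1 tau L n l z.
Proof.
  intros hN hL hr1 hsep hz hz1. set (r1 := 2 * L / 2 ^ n1) in *.
  assert (h1 : 0 < r1) by (apply scale_pos; lra).
  assert (hI : Im z <= 1) by (pose proof (Im_le_Cmod z); pose proof (Rle_abs (Im z)); lra).
  assert (hr12 : 2 <= 2 / r1).
  { apply Rmult_le_reg_r with r1; [auto|]. unfold Rdiv. rewrite Rmult_assoc, Rinv_l by lra. lra. }
  assert (Hl : forall rho, 0 < rho -> Im z <= 2 / r1 * rho -> exists l, rho / 2 ^ l <= Im z /\ Im z <= 2 / r1 * (rho / 2 ^ l)).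
  { intros rho hrho hIr. destruct (Rle_dec rho (Im z)) as [h|h].
    - exists O. simpl. rewrite Rdiv_1_r. lra.
    - destruct (dyadic_bracket rho (Im z)) as [l [hl1 hl2]]; [lra|]. exists l. split; [auto|].
      assert (0 < rho / 2 ^ l) by (apply scale_pos; auto).
      eapply Rle_trans; [exact hl2|]. apply Rmult_le_compat_r; lra. }
  destruct (classic (exists i, (i < N)%nat /\ Cmod (Cminus z (RtoC (tau i))) < r1)) as [[i [hi hv]]|hfar].
  - pose proof (Im_le_dist_real z (tau i)) as hIv.
    set (v := Cmod (Cminus z (RtoC (tau i)))) in *.
    destruct (dyadic_bracket r1 v) as [m [hm1 hm2]]; [lra|].
    assert (E : 2 * L / 2 ^ (n1 + m) = r1 / 2 ^ m).
    { unfold r1. rewrite pow_add. field. split; apply pow_nonzero; lra. }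
    assert (hrho : 0 < r1 / 2 ^ m) by (apply scale_pos; auto).
    destruct (Hl (r1 / 2 ^ m) hrho) as [l [hl1 hl2]].
    { apply Rle_trans with (2 * (r1 / 2 ^ m)); [lra|]. apply Rmult_le_compat_r; lra. }
    exists i, (n1 + m)%nat, l. unfold in_box. rewrite E. fold r1 v.
    repeat split; auto; try lia.
    intros j hj hji. specialize (hsep i j hi hj (not_eq_sym hji)).
    pose proof (Cmod_triangle_minus (RtoC (tau i)) z (RtoC (tau j))) as T.
    rewrite (Cmod_minus_sym (RtoC (tau i)) z) in T. fold v in T.
    replace (Cminus (RtoC (tau i)) (RtoC (tau j))) with (RtoC (tau i - tau j)) in T
      by (rewrite RtoC_minus; reflexivity).
    rewrite Cmod_R in T. lra.
  - assert (hfar' : forall j, (j < N)%nat -> r1 <= Cmod (Cminus z (RtoC (tau j)))).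
    { intros j hj. apply Rnot_lt_le. intros h. apply hfar. exists j; auto. }
    destruct (Hl r1 h1) as [l [hl1 hl2]].
    { unfold Rdiv. rewrite Rmult_assoc, Rinv_l by lra. lra. }
    exists O, n1, l. unfold in_box. fold r1. repeat split; auto.
Qed.

(** [Cst] is fixed before [f], [K] and the zeros. Confining the zeros to the unit disc keeps the
    work inside [|w| <= L], where [(1 + |w|) ^ E] is merely a constant; the zeros near infinity are
    brought here by an inversion. *)
Lemma half_plane_zeros (N : nat) (tau u e : nat -> R) (a q E A0 : R) :
  (0 < N)%nat -> (forall i j, (i < N)%nat -> (j < N)%nat -> tau i = tau j -> i = j) ->
  0 <= a -> 1 + a < q -> (forall j, (j < N)%nat -> 1 < q + e j /\ a - u j < q + e j) ->
  0 <= E -> 0 <= A0 ->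
  exists Cst, 0 < Cst /\ forall (f : C -> C) (K : R), 0 < K ->
    (forall w, 0 < Im w -> jet f w) -> Cmod (f Ci) = 1 ->
    (forall w, 0 < Im w -> f w <> RtoC 0 -> ln (Cmod (f w)) <=
       K * (A0 * (Rpower (Im w) (- a) * Rpower (1 + Cmod w) E *
         rprod N (fun j => Rpower (Cmod (Cminus w (RtoC (tau j)))) (u j))))) ->
    forall zs : list (C * nat), NoDup (map fst zs) ->
    (forall p, In p zs -> (1 <= snd p)%nat /\ vanishes_to f (fst p) (snd p) /\ 0 < Im (fst p) /\ Cmod (fst p) <= 1) ->
    zsum (fun z => Rpower (Im z) q * rprod N (fun j => Rpower (Cmod (Cminus z (RtoC (tau j)))) (e j))) zs <= Cst * K.
Proof.
  intros hN hd ha hq he hE hA0.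
  destruct (finite_upper_bound N (fun j => Rabs (tau j)) 32) as [L [hL htau]].
  destruct (separation N tau hd) as [g [hg Hg]].
  destruct (half_power_small (2 * L) (g / 2)) as [n1 hn1]; [lra|lra|].
  set (r1 := 2 * L / 2 ^ n1) in *.
  assert (h1 : 0 < r1) by (apply scale_pos; lra).
  assert (hr1 : r1 <= 1) by lra.
  set (W := fun z => Rpower (Im z) q * rprod N (fun j => Rpower (Cmod (Cminus z (RtoC (tau j)))) (e j))).
  assert (Hup : forall z j, (j < N)%nat -> Cmod z <= L -> Cmod (Cminus z (RtoC (tau j))) <= 2 * L).
  { intros z j hj hz. pose proof (Cmod_triangle z (Copp (RtoC (tau j)))) as T. rewrite Cmod_opp, Cmod_R in T.
    specialize (htau j hj). simpl in htau. unfold Cminus. lra. }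
  set (hyp := fun (f : C -> C) (K : R) => 0 < K /\ (forall w, 0 < Im w -> jet f w) /\ Cmod (f Ci) = 1 /\
    (forall w, 0 < Im w -> f w <> RtoC 0 -> ln (Cmod (f w)) <=
       K * (A0 * (Rpower (Im w) (- a) * Rpower (1 + Cmod w) E *
         rprod N (fun j => Rpower (Cmod (Cminus w (RtoC (tau j)))) (u j)))))).
  set (zok := fun (f : C -> C) (zs : list (C * nat)) => NoDup (map fst zs) /\
    (forall p, In p zs -> (1 <= snd p)%nat /\ vanishes_to f (fst p) (snd p) /\ 0 < Im (fst p) /\ Cmod (fst p) <= 1)).
  assert (zok_filter : forall f P zs, zok f zs -> zok f (filter P zs)).
  { intros f P zs [z1 z2]. split; [apply NoDup_map_filter; auto|]. intros p hp. apply filter_In in hp. apply z2, hp. }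
  assert (Hi : forall i, (i < N)%nat -> exists Ci0, 0 < Ci0 /\ forall f K, hyp f K -> forall zs, zok f zs ->
     (forall p, In p zs -> exists n l, in_box N i n1 tau L n l (fst p)) -> zsum W zs <= Ci0 * K).
  { intros i hi. destruct (he i hi) as [he1 he2].
    set (gam := Rmax 1 (a - u i)).
    assert (hg1 : 1 <= gam) by apply Rmax_l. assert (hg2 : a - u i <= gam) by apply Rmax_r.
    assert (hg3 : gam < q + e i) by (apply Rmax_lub_lt; auto).
    assert (hb : 0 < bite N n1 L).
    { apply Rdiv_lt_0_compat; [exact h1|]. assert (0 < INR (S N)) by (apply lt_0_INR; lia). lra. }
    destruct (rprod_dominated N i tau u (bite N n1 L) (2 * L) hi hb) as [Wu [hWu HWu]].
    destruct (rprod_dominated N i tau e r1 (2 * L) hi h1) as [We [hWe HWe]].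
    set (A := A0 * Rpower (1 + L) E * Wu).
    assert (hA : 0 <= A).
    { apply Rmult_le_pos; [apply Rmult_le_pos; [auto|apply Rlt_le, Rpower_pos]|lra]. }
    set (C1 := 128 * A * (Rpower (2 * L) (gam - (a - u i)) * Rpower 32 gam) * Rpower (cone n1 L) (- a)).
    assert (hC1 : 0 <= C1).
    { unfold C1. repeat apply Rmult_le_pos; try lra; apply Rlt_le, Rpower_pos. }
    set (Xr := 2 * L / r1).
    assert (hXr : 2 <= Xr).
    { unfold Xr. apply Rmult_le_reg_r with r1; [auto|]. unfold Rdiv. rewrite Rmult_assoc, Rinv_l by lra. lra. }
    (* Within a box the height exceeds [h] by at most the factor [2 / r1], and the distance to
       [tau i] exceeds [rho] by at most [Xr]. [Rabs (e i)] covers both signs of the exponent. *)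
    set (Cw := Rpower (2 / r1) q * We * Rpower Xr (Rabs (e i))).
    assert (hCw : 0 < Cw) by (repeat apply Rmult_lt_0_compat; auto using Rpower_pos).
    set (x := Rpower 2 (- (q - 1 - a))). set (y := Rpower 2 (- (q + e i - gam))).
    assert (hpow : forall t, 0 < t -> 0 < Rpower 2 (- t) < 1).
    { intros t ht. split; [apply Rpower_pos|]. rewrite <- (Rpower_O 2) by lra. apply Rpower_lt; lra. }
    assert (hx : 0 < x < 1) by (apply hpow; lra). assert (hy : 0 < y < 1) by (apply hpow; lra).
    destruct (rsum_poly_geometric (1 + a) y) as [Gc [hGc HGc]]; [lra|auto|].
    set (C2 := Cw * C1 * Rpower (2 * L) (q + e i - gam)).
    assert (hC2 : 0 <= C2) by (repeat apply Rmult_le_pos; try lra; apply Rlt_le, Rpower_pos).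
    (* [C2] vanishes when [A0 = 0]; adding [1] keeps the constant positive. *)
    exists (C2 * / (1 - x) * Gc + 1).
    assert (hix : 0 < / (1 - x)) by (apply Rinv_0_lt_compat; lra).
    assert (hpos : 0 <= C2 * / (1 - x) * Gc) by (repeat first [lra | apply Rmult_le_pos]).
    split; [lra|]. intros f K [hK [Hjet [Hf Hlog]]] zs Hzs Hbox.
    assert (Hch : exists key : C -> nat * nat, forall p, In p zs -> in_box N i n1 tau L (fst (key (fst p))) (snd (key (fst p))) (fst p)).
    { exists (fun z => epsilon (inhabits (O, O)) (fun nl => in_box N i n1 tau L (fst nl) (snd nl) z)).
      intros p hp. apply (epsilon_spec (inhabits (O, O)) (fun nl => in_box N i n1 tau L (fst nl) (snd nl) (fst p))).
      destruct (Hbox p hp) as [n [l hnl]]. exists (n, l). exact hnl. }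
    destruct Hch as [key Hkey].
    assert (Hnl : forall n l zs', zok f zs' -> (forall p, In p zs' -> in_box N i n1 tau L n l (fst p)) ->
      zsum W zs' <= C2 * K * (Rpower (INR (S n)) (1 + a) * y ^ n) * x ^ l).
    { intros n l zs' [z1 z2] Hb.
      (* The condition [n1 <= n] of [box_count] is read off from a member of the layer, so the empty
         layer is treated apart. *)
      destruct zs' as [|p0 zs'].
      { simpl. repeat first [lra | apply Rlt_le, Rpower_pos | apply pow_le; lra | apply Rmult_le_pos]. }
      destruct (Hb p0 (or_introl eq_refl)) as [_ [hn _]].
      set (rho := 2 * L / 2 ^ n) in *. set (h := rho / 2 ^ l) in *.
      assert (hrho : 0 < rho) by (apply scale_pos; lra). assert (hh : 0 < h) by (apply scale_pos; auto).
      assert (hhr : h <= rho).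
      { unfold h. rewrite <- (Rdiv_1_r rho) at 2. apply (scale_mono rho 0 l); [auto|lia]. }
      assert (Hcount := box_count N i n1 tau L hL htau hi hr1 f K A a (u i) gam n h (p0 :: zs')
        (Rlt_le _ _ hK) hA ha hg1 hg2 hn (conj hh hhr) Hjet Hf).
      fold r1 rho C1 in Hcount.
      assert (Hcount' : h * zsum (fun _ => 1) (p0 :: zs') <= C1 * K * (Rpower (INR (S n)) (1 + a) * (Rpower (h / rho) (- a) * Rpower rho (1 - gam)))).
      { apply Hcount; auto.
        - intros w hw hwL hwb hfw. eapply Rle_trans; [apply Hlog; auto|]. apply Rmult_le_compat_l; [lra|].
          unfold A. rewrite !Rmult_assoc. apply Rmult_le_compat_l; [auto|].
          rewrite <- (Rmult_assoc (Rpower (1 + L) E)), (Rmult_comm (Rpower (1 + L) E * Wu)).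
          rewrite !Rmult_assoc. apply Rmult_le_compat_l; [apply Rlt_le, Rpower_pos|].
          rewrite (Rmult_comm (Rpower _ (u i))), Rmult_assoc.
          apply Rmult_le_compat; [apply Rlt_le, Rpower_pos|apply rprod_nonneg; intros; apply Rlt_le, Rpower_pos| |].
          + apply Rpower_mono; [|auto]. pose proof (Cmod_ge_0 w). lra.
          + apply HWu; auto.
        - intros p hp. destruct (z2 p hp) as [p1 [p2 [p3 p4]]].
          destruct (Hb p hp) as [b1 [b2 [b3 [b4 [b5 [b6 b7]]]]]]. fold r1 in b3, b7; fold rho in b4, b5, b6, b7; fold h in b6, b7. repeat split; auto. }
      assert (HW : zsum W (p0 :: zs') <= zsum (fun _ => (Cw * (Rpower h q * Rpower rho (e i))) * 1) (p0 :: zs')).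
      { apply zsum_le. intros p hp. destruct (z2 p hp) as [p1 [p2 [p3 p4]]].
        destruct (Hb p hp) as [b1 [b2 [b3 [b4 [b5 [b6 b7]]]]]]. fold r1 in b3, b7; fold rho in b4, b5, b6, b7; fold h in b6, b7.
        set (v := Cmod (Cminus (fst p) (RtoC (tau i)))) in *.
        assert (hv2L : v <= 2 * L) by (apply Hup; auto; lra).
        assert (A1 : Rpower (Im (fst p)) q <= Rpower (2 / r1) q * Rpower h q).
        { rewrite <- Rpower_mult_base; [|apply Rdiv_lt_0_compat; lra|auto]. apply Rpower_mono; lra. }
        assert (A2 : rprod N (fun j => Rpower (Cmod (Cminus (fst p) (RtoC (tau j)))) (e j)) <= We * Rpower v (e i)).
        { apply HWe; auto. intros j hj. apply Hup; auto. lra. }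
        assert (A3 : Rpower v (e i) <= Rpower Xr (Rabs (e i)) * Rpower rho (e i)).
        { assert (hxv : 1 <= v / rho <= Xr).
          { split; apply Rmult_le_reg_r with rho; auto; unfold Rdiv at 1; rewrite Rmult_assoc, Rinv_l by lra; [lra|].
            rewrite Rmult_1_r. destruct b5 as [b5|b5].
            - apply Rle_trans with (2 * rho); [auto|apply Rmult_le_compat_r; lra].
            - unfold rho. rewrite b5. fold r1. unfold Xr. unfold Rdiv. rewrite Rmult_assoc, Rinv_l by lra. lra. }
          replace v with (v / rho * rho) at 1 by (field; lra). rewrite Rpower_mult_base by lra.
          apply Rmult_le_compat_r; [apply Rlt_le, Rpower_pos|]. unfold Rpower. apply exp_le_compat.
          assert (0 <= ln (v / rho)) by (rewrite <- ln_1; apply ln_le; lra).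
          assert (ln (v / rho) <= ln Xr) by (apply ln_le; lra).
          apply Rle_trans with (Rabs (e i) * ln (v / rho)).
          - apply Rmult_le_compat_r; [auto|apply Rle_abs].
          - apply Rmult_le_compat_l; [apply Rabs_pos|auto]. }
        unfold W, Cw. rewrite Rmult_1_r.
        apply Rle_trans with ((Rpower (2 / r1) q * Rpower h q) * (We * (Rpower Xr (Rabs (e i)) * Rpower rho (e i)))).
        - apply Rmult_le_compat; auto; [apply Rlt_le, Rpower_pos|apply rprod_nonneg; intros; apply Rlt_le, Rpower_pos|].
          eapply Rle_trans; [exact A2|]. apply Rmult_le_compat_l; lra.
        - right. ring. }
      rewrite zsum_scal in HW. eapply Rle_trans; [exact HW|].
      (* One factor [h] of the weight is spent on [h] times the number of zeros, which is what
         [box_count] controls. *)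
      assert (Eq : Rpower h q = Rpower h (q - 1) * h).
      { rewrite <- (Rpower_1 h) at 3 by auto. rewrite <- Rpower_plus. f_equal. ring. }
      rewrite Eq.
      replace (Cw * (Rpower h (q - 1) * h * Rpower rho (e i)) * zsum (fun _ => 1) (p0 :: zs'))
        with (Cw * (Rpower h (q - 1) * Rpower rho (e i)) * (h * zsum (fun _ => 1) (p0 :: zs'))) by ring.
      eapply Rle_trans.
      { apply Rmult_le_compat_l; [|exact Hcount'].
        pose proof (Rpower_pos h (q - 1)). pose proof (Rpower_pos rho (e i)).
        apply Rmult_le_pos; [lra|]. apply Rmult_le_pos; lra. }
      right.
      assert (Ehr : h = Rpower 2 (- INR l) * rho).
      { unfold h, Rdiv. rewrite Rpower_Ropp, Rpower_pow by lra. ring. }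
      assert (Erho : rho = 2 * L * Rpower 2 (- INR n)).
      { unfold rho, Rdiv. rewrite Rpower_Ropp, Rpower_pow by lra. ring. }
      assert (E1 : Rpower h (q - 1) * Rpower (h / rho) (- a) = x ^ l * Rpower rho (q - 1)).
      { assert (Eh2 : h / rho = Rpower 2 (- INR l)) by (rewrite Ehr; field; lra).
        rewrite Eh2. rewrite Ehr. rewrite Rpower_mult_base by (auto using Rpower_pos).
        rewrite <- (Rpower_pow l x) by lra. unfold x. rewrite !Rpower_mult.
        rewrite (Rmult_comm _ (Rpower rho (q - 1))), Rmult_assoc, <- Rpower_plus, Rmult_comm. f_equal. f_equal. ring. }
      assert (E2 : Rpower rho (q - 1) * Rpower rho (e i) * Rpower rho (1 - gam) = Rpower (2 * L) (q + e i - gam) * y ^ n).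
      { rewrite <- !Rpower_plus. replace (q - 1 + e i + (1 - gam)) with (q + e i - gam) by ring.
        rewrite Erho. rewrite Rpower_mult_base by (auto using Rpower_pos; lra). f_equal.
        rewrite <- (Rpower_pow n y) by lra. unfold y. rewrite !Rpower_mult. f_equal. ring. }
      unfold C2.
      replace (Cw * (Rpower h (q - 1) * Rpower rho (e i)) * (C1 * K * (Rpower (INR (S n)) (1 + a) * (Rpower (h / rho) (- a) * Rpower rho (1 - gam)))))
       with (Cw * C1 * K * Rpower (INR (S n)) (1 + a) * ((Rpower h (q - 1) * Rpower (h / rho) (- a)) * (Rpower rho (e i) * Rpower rho (1 - gam)))) by ring.
      rewrite E1.
      replace (x ^ l * Rpower rho (q - 1) * (Rpower rho (e i) * Rpower rho (1 - gam)))
        with (x ^ l * (Rpower rho (q - 1) * Rpower rho (e i) * Rpower rho (1 - gam))) by ring.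
      rewrite E2. ring. }
    apply Rle_trans with (C2 * / (1 - x) * Gc * K); [|apply Rmult_le_compat_r; lra].
    apply (zsum_layers (fun z => fst (key z)) W zs (fun n => C2 * K * / (1 - x) * (Rpower (INR (S n)) (1 + a) * y ^ n))).
    - intros n. apply (zsum_layers (fun z => snd (key z)) W _ (fun l => C2 * K * (Rpower (INR (S n)) (1 + a) * y ^ n) * x ^ l)).
      + intros l. apply Hnl; [apply zok_filter, zok_filter; auto|].
        intros p hp. apply filter_In in hp. destruct hp as [hp hl]. apply filter_In in hp. destruct hp as [hp hn].
        apply Nat.eqb_eq in hl, hn. rewrite <- hl, <- hn. apply Hkey; auto.
      + intros X. rewrite rsum_scal. set (c0 := Rpower (INR (S n)) (1 + a) * y ^ n).
        assert (0 <= c0) by (apply Rmult_le_pos; [apply Rlt_le, Rpower_pos|apply pow_le; lra]).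
        replace (C2 * K * / (1 - x) * c0) with (C2 * K * c0 * / (1 - x)) by ring.
        apply Rmult_le_compat_l; [repeat first [lra | apply Rmult_le_pos]|]. apply rsum_geometric. lra.
    - intros X. rewrite rsum_scal. replace (C2 * / (1 - x) * Gc * K) with (C2 * K * / (1 - x) * Gc) by ring.
      apply Rmult_le_compat_l; [repeat first [lra | apply Rmult_le_pos]|]. apply HGc. }
  assert (Hex : exists cs : nat -> R, forall i, 0 < cs i /\ ((i < N)%nat -> forall f K, hyp f K -> forall zs, zok f zs ->
     (forall p, In p zs -> exists n l, in_box N i n1 tau L n l (fst p)) -> zsum W zs <= cs i * K)).
  { exists (fun i => epsilon (inhabits 0) (fun c => 0 < c /\ ((i < N)%nat -> forall f K, hyp f K -> forall zs, zok f zs ->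
     (forall p, In p zs -> exists n l, in_box N i n1 tau L n l (fst p)) -> zsum W zs <= c * K))).
    intros i. apply epsilon_spec. destruct (lt_dec i N) as [hi|hi].
    - destruct (Hi i hi) as [c [hc Hc]]. exists c. split; auto.
    - exists 1. split; [lra|]. intros; contradiction. }
  destruct Hex as [cs Hcs].
  exists (rsum N cs). split.
  { apply Rlt_le_trans with (cs O); [apply Hcs|]. apply (rsum_term N cs O); [intros; apply Rlt_le, Hcs|auto]. }
  intros f K hK Hjet Hf Hlog zs Hnd Hzs.
  assert (Hh : hyp f K) by (repeat split; auto). assert (Hz : zok f zs) by (split; auto).
  assert (Hsep2 : forall i j, (i < N)%nat -> (j < N)%nat -> i <> j -> 2 * r1 <= Rabs (tau i - tau j)).
  { intros i j hi hj hne. specialize (Hg i j hi hj hne). lra. }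
  set (key := fun z => epsilon (inhabits O) (fun i => exists n l, in_box N i n1 tau L n l z)).
  assert (Hkey : forall p, In p zs -> exists n l, in_box N (key (fst p)) n1 tau L n l (fst p)).
  { intros p hp. destruct (Hzs p hp) as [p1 [p2 [p3 p4]]].
    apply (epsilon_spec (inhabits O) (fun i => exists n l, in_box N i n1 tau L n l (fst p))).
    apply in_box_exists; auto; lra. }
  apply (zsum_layers key W zs (fun i => if lt_dec i N then cs i * K else 0)).
  - intros i. destruct (lt_dec i N) as [hi|hi].
    + apply (proj2 (Hcs i) hi f K Hh); [apply zok_filter; auto|].
      intros p hp. apply filter_In in hp. destruct hp as [hp hk]. apply Nat.eqb_eq in hk. rewrite <- hk. apply Hkey; auto.
    + destruct (filter _ zs) as [|p l] eqn:Ef; [simpl; lra|exfalso].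
      assert (hp : In p (filter (fun p => Nat.eqb (key (fst p)) i) zs)) by (rewrite Ef; left; auto).
      apply filter_In in hp. destruct hp as [hp hk]. apply Nat.eqb_eq in hk.
      destruct (Hkey p hp) as [n [l0 [hb _]]]. lia.
  - intros X. rewrite Rmult_comm, <- rsum_scal.
    assert (hnn : forall i, 0 <= (if lt_dec i N then cs i * K else 0)).
    { intros i. destruct (lt_dec i N); [|lra]. apply Rmult_le_pos; [apply Rlt_le, Hcs|lra]. }
    assert (Hall : forall X, rsum X (fun i => if lt_dec i N then cs i * K else 0) <= rsum N (fun i => if lt_dec i N then cs i * K else 0)).
    { intros Y. apply rsum_support; auto. intros k hk. destruct (lt_dec k N); [lia|reflexivity]. }
    eapply Rle_trans; [apply Hall|]. apply rsum_le. intros k hk. destruct (lt_dec k N); [lra|lia].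
Qed.

(** * Transfer to the slit plane *)

Definition glue {T : Type} (k : nat) (u v : nat -> T) (j : nat) : T := if lt_dec j k then u j else v (j - k)%nat.

Lemma glue_l {T} k (u v : nat -> T) j : (j < k)%nat -> glue k u v j = u j.
Proof. intros h. unfold glue. destruct (lt_dec j k); [reflexivity|lia]. Qed.

Lemma glue_r {T} k (u v : nat -> T) j : glue k u v (k + j) = v j.
Proof. unfold glue. destruct (lt_dec (k + j) k); [lia|]. f_equal. lia. Qed.

Lemma rprod_add k l u : rprod (k + l) u = rprod k u * rprod l (fun j => u (k + j)%nat).
Proof.
  induction l as [|l IH]; [rewrite Nat.add_0_r; simpl; ring|].
  rewrite Nat.add_succ_r. simpl. rewrite IH. ring.
Qed.

Lemma rsum_add k l u : rsum (k + l) u = rsum k u + rsum l (fun j => u (k + j)%nat).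
Proof.
  induction l as [|l IH]; [rewrite Nat.add_0_r; simpl; ring|].
  rewrite Nat.add_succ_r. simpl. rewrite IH. ring.
Qed.

Lemma rsum_ext_lt n u v : (forall k, (k < n)%nat -> u k = v k) -> rsum n u = rsum n v.
Proof. induction n as [|n IH]; intros H; simpl; [reflexivity|]. rewrite IH by (intros; apply H; lia). rewrite H by lia. reflexivity. Qed.

Lemma rprod_glue (P : R -> R -> R) k l x x' y y' :
  rprod (k + l) (fun j => P (glue k x x' j) (glue k y y' j)) = rprod k (fun j => P (x j) (y j)) * rprod l (fun j => P (x' j) (y' j)).
Proof.
  rewrite rprod_add. f_equal; apply rprod_ext; intros j hj.
  - rewrite !glue_l by auto. reflexivity.
  - rewrite !glue_r. reflexivity.
Qed.

Lemma rsum_glue k l u v : rsum (k + l) (glue k u v) = rsum k u + rsum l v.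
Proof.
  rewrite rsum_add. f_equal; apply rsum_ext_lt; intros j hj; [apply glue_l; auto|apply glue_r].
Qed.

Lemma rprod_mult n u v : rprod n (fun j => u j * v j) = rprod n u * rprod n v.
Proof. induction n as [|n IH]; simpl; [ring|]. rewrite IH. ring. Qed.

Lemma rprod_inv n u : / rprod n u = rprod n (fun j => / u j).
Proof. induction n as [|n IH]; simpl; [apply Rinv_1|]. rewrite Rinv_mult, IH. reflexivity. Qed.

Lemma rprod_Rpower_const x n (e : nat -> R) : 0 < x -> rprod n (fun j => Rpower x (e j)) = Rpower x (rsum n e).
Proof. intros hx. induction n as [|n IH]; simpl; [rewrite Rpower_O; auto|]. rewrite IH, Rpower_plus. reflexivity. Qed.

Lemma glue_inj k l (u v : nat -> R) :
  (forall i j, (i < k)%nat -> (j < k)%nat -> u i = u j -> i = j) ->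
  (forall i j, (i < l)%nat -> (j < l)%nat -> v i = v j -> i = j) ->
  (forall i j, (i < k)%nat -> (j < l)%nat -> u i <> v j) ->
  forall i j, (i < k + l)%nat -> (j < k + l)%nat -> glue k u v i = glue k u v j -> i = j.
Proof.
  intros hu hv huv i j hi hj E. unfold glue in E.
  destruct (lt_dec i k), (lt_dec j k).
  - apply hu; auto.
  - exfalso. apply (huv i (j - k)%nat); [auto|lia|auto].
  - exfalso. apply (huv j (i - k)%nat); [auto|lia|auto].
  - assert ((i - k)%nat = (j - k)%nat) by (apply hv; auto; lia). lia.
Qed.

Lemma glue_forall k l {T : Type} (P : T -> Prop) (u v : nat -> T) :
  (forall j, (j < k)%nat -> P (u j)) -> (forall j, (j < l)%nat -> P (v j)) -> forall j, (j < k + l)%nat -> P (glue k u v j).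
Proof. intros hu hv j hj. unfold glue. destruct (lt_dec j k); [auto|apply hv; lia]. Qed.

Lemma sqr_minus_real (w : C) g : 0 < g ->
  Cmod (Cminus (Cmult w w) (RtoC g)) = Cmod (Cminus w (RtoC (sqrt g))) * Cmod (Cminus w (RtoC (- sqrt g))).
Proof.
  intros hg. rewrite <- Cmod_mult. f_equal. rewrite RtoC_opp.
  rewrite <- (sqrt_sqrt g) at 1 by lra. rewrite RtoC_mult. ring.
Qed.

(** The boundary points [0], [sqrt (g j)], [- sqrt (g j)] of the half plane lie over [0] and [g j] under squaring. *)
Lemma half_plane_zeros_sqr (m : nat) (g u e : nat -> R) (u0 e0 a q E A0 : R) :
  (forall j, (j < m)%nat -> 0 < g j) ->
  (forall i j, (i < m)%nat -> (j < m)%nat -> g i = g j -> i = j) ->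
  0 <= a -> 1 + a < q -> (forall j, (j < m)%nat -> 1 < q + e j /\ a - u j < q + e j) ->
  1 < q + e0 /\ a - u0 < q + e0 -> 0 <= E -> 0 <= A0 ->
  exists Cst, 0 < Cst /\ forall (f : C -> C) (K : R), 0 < K ->
    (forall w, 0 < Im w -> jet f w) -> Cmod (f Ci) = 1 ->
    (forall w, 0 < Im w -> f w <> RtoC 0 -> ln (Cmod (f w)) <=
       K * (A0 * (Rpower (Im w) (- a) * Rpower (1 + Cmod w) E *
         (Rpower (Cmod w) u0 * rprod m (fun j => Rpower (Cmod (Cminus (Cmult w w) (RtoC (g j)))) (u j)))))) ->
    forall zs : list (C * nat), NoDup (map fst zs) ->
    (forall p, In p zs -> (1 <= snd p)%nat /\ vanishes_to f (fst p) (snd p) /\ 0 < Im (fst p) /\ Cmod (fst p) <= 1) ->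
    zsum (fun z => Rpower (Im z) q * (Rpower (Cmod z) e0 *
      rprod m (fun j => Rpower (Cmod (Cminus (Cmult z z) (RtoC (g j)))) (e j)))) zs <= Cst * K.
Proof.
  intros hg hd ha hq he he0 hE hA0.
  set (tau := glue 1 (fun _ => 0) (glue m (fun j => sqrt (g j)) (fun j => - sqrt (g j)))).
  set (uu := glue 1 (fun _ => u0) (glue m u u)). set (ee := glue 1 (fun _ => e0) (glue m e e)).
  assert (hsq : forall j, (j < m)%nat -> 0 < sqrt (g j)) by (intros; apply sqrt_lt_R0; auto).
  assert (Hprod : forall (x : nat -> R) x0 z, 0 < Im z ->
     rprod (1 + (m + m)) (fun j => Rpower (Cmod (Cminus z (RtoC (tau j)))) (glue 1 (fun _ => x0) (glue m x x) j))
     = Rpower (Cmod z) x0 * rprod m (fun j => Rpower (Cmod (Cminus (Cmult z z) (RtoC (g j)))) (x j))).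
  { intros x x0 z hz.
    assert (hp : forall t, 0 < Cmod (Cminus z (RtoC t))) by (intros t; pose proof (Im_le_dist_real z t); lra).
    unfold tau. rewrite (rprod_glue (fun s t => Rpower (Cmod (Cminus z (RtoC s))) t) 1 (m + m)).
    rewrite (rprod_glue (fun s t => Rpower (Cmod (Cminus z (RtoC s))) t) m m).
    rewrite <- rprod_mult. simpl. rewrite Rmult_1_l. f_equal.
    - f_equal. f_equal. ring.
    - apply rprod_ext. intros j hj. rewrite sqr_minus_real, Rpower_mult_base by auto. reflexivity. }
  destruct (half_plane_zeros (1 + (m + m)) tau uu ee a q E A0) as [Cst [hC HC]]; auto; try lia.
  - apply glue_inj.
    + intros; lia.
    + apply glue_inj.
      * intros i j hi hj Es. apply hd; auto. apply sqrt_inj; auto; apply Rlt_le; auto.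
      * intros i j hi hj Es. apply hd; auto. apply sqrt_inj; auto; try (apply Rlt_le; auto). lra.
      * intros i j hi hj. pose proof (hsq i hi). pose proof (hsq j hj). lra.
    + intros i j _ hj. apply (glue_forall m m (fun x => 0 <> x)); auto; intros k hk; pose proof (hsq k hk); lra.
  - intros j hj. unfold uu, ee, glue. destruct (lt_dec j 1); [auto|].
    destruct (lt_dec (j - 1) m); apply he; lia.
  - exists Cst. split; [auto|]. intros f K hK Hj Hf Hlog zs Hnd Hzs.
    eapply Rle_trans; [|apply (HC f K hK Hj Hf)]; [|intros w hw hf0; unfold uu; rewrite Hprod by auto; auto|exact Hnd|exact Hzs].
    apply zsum_le. intros p hp. unfold ee. rewrite Hprod; [lra|]. apply Hzs; auto.
Qed.

Lemma sqr_not_in_Rplus (v : C) : 0 < Im v -> ~ in_Rplus (Cmult v v).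
Proof.
  destruct v as [x y]. intros hy [h1 h2]. simpl in *.
  assert (h3 : y * x = 0) by lra. apply Rmult_integral in h3. destruct h3 as [h3|h3]; [lra|subst; nra].
Qed.

(** Half-angle formulas. Off the slit [r - x > 0], so the imaginary part is strictly positive; the
    sign of [y] decides that of the real part. *)
Lemma slit_sqrt (l : C) : ~ in_Rplus l -> exists v, 0 < Im v /\ Cmult v v = l.
Proof.
  destruct l as [x y]. intros hl. set (r := Cmod (x, y)).
  assert (hr : 0 <= r) by apply Cmod_ge_0.
  assert (hr2 : r * r = x * x + y * y).
  { pose proof (Cmod2_alt (x, y)) as T. fold r in T. simpl in T. lra. }
  assert (hrx : 0 < r - x).
  { destruct (Rlt_dec 0 (r - x)) as [h|h]; [auto|exfalso]. apply hl. split; simpl; [|lra]. nra. }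
  assert (hrx2 : 0 <= r + x) by nra.
  set (p := sqrt ((r + x) / 2)). set (s := sqrt ((r - x) / 2)).
  assert (hp : p * p = (r + x) / 2) by (apply sqrt_sqrt; lra).
  assert (hs : s * s = (r - x) / 2) by (apply sqrt_sqrt; lra).
  assert (hp0 : 0 <= p) by apply sqrt_pos. assert (hs0 : 0 < s) by (apply sqrt_lt_R0; lra).
  assert (hps : (2 * (p * s)) * (2 * (p * s)) = y * y).
  { replace ((2 * (p * s)) * (2 * (p * s))) with (4 * (p * p) * (s * s)) by ring. rewrite hp, hs. nra. }
  assert (hps0 : 0 <= p * s) by (apply Rmult_le_pos; lra).
  destruct (Rle_dec 0 y) as [hy|hy].
  - exists (p, s). split; [exact hs0|]. apply injective_projections; simpl; [lra|].
    assert (2 * (p * s) = y) by nra. lra.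
  - exists (- p, s). split; [exact hs0|]. apply injective_projections; simpl; [lra|].
    assert (2 * (p * s) = - y) by nra. lra.
Qed.

(** Write [v = x + i y], [r = |v|]. If [|x| >= y], the distance is [2 |x| y] and
    [r <= 2 |x| <= 2 r]; otherwise it is [r^2] and [y <= r <= 2 y]. Thus the distance to the slit is
    comparable to [|v| Im v], which governs all exponents below. *)
Lemma dist_sqr_bounds (v : C) : 0 < Im v ->
  Cmod v * Im v <= dist_Rplus (Cmult v v) <= 2 * (Cmod v * Im v).
Proof.
  destruct v as [x y]. intros hy. simpl in hy. set (r := Cmod (x, y)).
  assert (hr : 0 <= r) by apply Cmod_ge_0.
  assert (hr2 : r * r = x * x + y * y).
  { pose proof (Cmod2_alt (x, y)) as T. fold r in T. simpl in T. lra. }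
  assert (hx : 0 <= Rabs x) by apply Rabs_pos.
  assert (hxx : Rabs x * Rabs x = x * x) by (rewrite <- Rabs_mult; apply Rabs_pos_eq; nra).
  unfold dist_Rplus. simpl (Im (x, y)). destruct (Rle_dec 0 (Re (Cmult (x, y) (x, y)))) as [h|h]; simpl in h.
  - replace (Im (Cmult (x, y) (x, y))) with (2 * x * y) by (simpl; ring).
    rewrite !Rabs_mult, (Rabs_pos_eq 2), (Rabs_pos_eq y) by lra.
    assert (r <= 2 * Rabs x) by nra. assert (Rabs x <= r) by nra. nra.
  - rewrite Cmod_mult. fold r. assert (y <= r) by nra. assert (r <= 2 * y) by nra. nra.
Qed.

Lemma Cmod_sqr_pos (v : C) : 0 < Im v -> 0 < Cmod v.
Proof. intros h. pose proof (Im_le_Cmod v). pose proof (Rle_abs (Im v)). lra. Qed.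

Lemma Rpower_sqr x e : 0 < x -> Rpower (x * x) e = Rpower x (2 * e).
Proof. intros h. rewrite Rpower_mult_base, <- Rpower_plus by auto. f_equal. ring. Qed.

Lemma sqr_minus_real_pos (v : C) t : 0 < Im v -> 0 < t -> 0 < Cmod (Cminus (Cmult v v) (RtoC t)).
Proof.
  intros hv ht. rewrite sqr_minus_real by auto.
  apply Rmult_lt_0_compat; eapply Rlt_le_trans; try apply Im_le_dist_real; exact hv.
Qed.

Lemma zsum_transport (phi : C -> C) (W F : C -> R) (zs : list (C * nat)) c :
  (forall p, In p zs -> W (fst p) <= c * F (phi (fst p))) ->
  zsum W zs <= c * zsum F (map (fun p => (phi (fst p), snd p)) zs).
Proof.
  intros H. induction zs as [|p zs IH]; simpl; [lra|].
  specialize (IH ltac:(intros; apply H; right; auto)). specialize (H p (or_introl eq_refl)).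
  apply (Rmult_le_compat_l (INR (snd p))) in H; [|apply pos_INR]. lra.
Qed.

Lemma NoDup_transport (phi psi : C -> C) (zs : list (C * nat)) :
  (forall p, In p zs -> psi (phi (fst p)) = fst p) -> NoDup (map fst zs) ->
  NoDup (map fst (map (fun p => (phi (fst p), snd p)) zs)).
Proof.
  intros H Hnd. rewrite map_map. simpl.
  assert (E : map psi (map (fun p : C * nat => phi (fst p)) zs) = map fst zs).
  { rewrite map_map. apply map_ext_in. exact H. }
  apply (NoDup_map_inv psi). rewrite E. exact Hnd.
Qed.

Lemma zsum_filter (W : C -> R) (P : C * nat -> bool) zs :
  zsum W zs = zsum W (filter P zs) + zsum W (filter (fun p => negb (P p)) zs).
Proof.
  induction zs as [|p zs IH]; simpl; [ring|]. rewrite IH. destruct (P p); simpl; ring.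
Qed.

(** From [1 / w^2 - t = - t (w^2 - 1 / t) / w^2]: the inversion moves the singular point [t] to
    [/ t]. *)
Lemma sqr_neg_inv_minus (w : C) t : 0 < Im w -> 0 < t ->
  Cmod (Cminus (Cmult (Copp (Cinv w)) (Copp (Cinv w))) (RtoC t))
  = t * (Cmod (Cminus (Cmult w w) (RtoC (/ t))) * (/ Cmod w * / Cmod w)).
Proof.
  intros hw ht. assert (h0 := Cmod_sqr_pos w hw). assert (hne : w <> RtoC 0) by (apply Cmod_gt_0; auto).
  rewrite <- Cmod_inv by auto. rewrite <- (Cmod_RtoC_pos t) at 2 by auto. rewrite <- !Cmod_mult.
  rewrite <- Cmod_opp. f_equal. rewrite RtoC_inv by lra. field. split; [auto|].
  intros E. apply RtoC_inj in E. lra.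
Qed.

Lemma Cinv_upper (w : C) : 0 < Im w -> Im (Copp (Cinv w)) = Im w * (/ Cmod w * / Cmod w).
Proof.
  intros hw. assert (h0 := Cmod_sqr_pos w hw). pose proof (Cmod2_alt w) as E.
  destruct w as [x y]. simpl in *. set (r := Cmod (x, y)) in *.
  rewrite <- Rinv_mult. replace (r * r) with (x * (x * 1) + y * (y * 1)) by lra. unfold Rdiv. ring.
Qed.

Lemma Rpower_inv_base x e : 0 < x -> Rpower (/ x) e = Rpower x (- e).
Proof. intros h. unfold Rpower. rewrite ln_Rinv by auto. f_equal. ring. Qed.

Lemma rprod_neg_inv (w : C) m (g u : nat -> R) : 0 < Im w -> (forall j, (j < m)%nat -> 0 < g j) ->
  rprod m (fun j => Rpower (Cmod (Cminus (Cmult (Copp (Cinv w)) (Copp (Cinv w))) (RtoC (g j)))) (u j))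
  = rprod m (fun j => Rpower (g j) (u j)) *
    (rprod m (fun j => Rpower (Cmod (Cminus (Cmult w w) (RtoC (/ g j)))) (u j)) * Rpower (Cmod w) (- 2 * rsum m u)).
Proof.
  intros hw hg. assert (h0 := Cmod_sqr_pos w hw).
  rewrite <- rsum_scal, <- rprod_Rpower_const, <- !rprod_mult by auto.
  apply rprod_ext. intros j hj. specialize (hg j hj).
  assert (hi : 0 < / g j) by (apply Rinv_0_lt_compat; auto).
  pose proof (sqr_minus_real_pos w (/ g j) hw hi) as hp. assert (0 < / Cmod w) by (apply Rinv_0_lt_compat; auto).
  rewrite sqr_neg_inv_minus by auto.
  rewrite !Rpower_mult_base; auto; try (repeat apply Rmult_lt_0_compat; auto; fail).
  rewrite !Rpower_inv_base, <- Rpower_plus by auto. f_equal. f_equal. f_equal. ring.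
Qed.

(** * Growth bound and weight under squaring and inversion *)

Definition slit_growth (m : nat) (g u : nat -> R) (a b r : R) (l : C) : R :=
  Rpower (Cmod l) (- r) * (Rpower (1 + Cmod l) b * (Rpower (dist_Rplus l) (- a) *
    rprod m (fun j => Rpower (Cmod (Cminus l (RtoC (g j)))) (u j)))).

Definition slit_weight (m : nat) (g e : nat -> R) (q s1 s2 : R) (l : C) : R :=
  Rpower (dist_Rplus l) q * (Rpower (Cmod l) s1 * (Rpower (1 + Cmod l) (- s2) *
    rprod m (fun j => Rpower (Cmod (Cminus l (RtoC (g j)))) (e j)))).

(** The exponent [- 2 r - a] at the origin collects [|v| ^ (- 2 r)] from [|l| ^ - r] and [|v| ^ - a]
    from the distance. *)
Lemma slit_growth_sqr m g u a b r v : 0 <= a -> 0 <= b -> 0 < Im v ->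
  slit_growth m g u a b r (Cmult v v) <= 1 * (Rpower (Im v) (- a) * Rpower (1 + Cmod v) (2 * b) *
    (Rpower (Cmod v) (- 2 * r - a) * rprod m (fun j => Rpower (Cmod (Cminus (Cmult v v) (RtoC (g j)))) (u j)))).
Proof.
  intros ha hb hv. assert (h0 := Cmod_sqr_pos v hv). unfold slit_growth.
  set (P := rprod m _). assert (hP : 0 <= P) by (apply rprod_nonneg; intros; apply Rlt_le, Rpower_pos).
  destruct (dist_sqr_bounds v hv) as [d1 _].
  assert (hd0 : 0 < Cmod v * Im v) by (apply Rmult_lt_0_compat; auto).
  rewrite Cmod_mult, Rpower_sqr by auto.
  assert (B1 : Rpower (1 + Cmod v * Cmod v) b <= Rpower (1 + Cmod v) (2 * b)).
  { rewrite <- Rpower_sqr by lra. apply Rpower_mono; [nra|auto]. }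
  assert (B2 : Rpower (dist_Rplus (Cmult v v)) (- a) <= Rpower (Cmod v) (- a) * Rpower (Im v) (- a)).
  { rewrite <- Rpower_mult_base by auto. apply Rpower_anti; auto. }
  replace (- 2 * r - a) with (2 * - r + - a) by ring. rewrite (Rpower_plus (2 * - r)).
  apply Rle_trans with (Rpower (Cmod v) (2 * - r) * (Rpower (1 + Cmod v) (2 * b) *
    ((Rpower (Cmod v) (- a) * Rpower (Im v) (- a)) * P))).
  - apply Rmult_le_compat_l; [apply Rlt_le, Rpower_pos|].
    apply Rmult_le_compat; [apply Rlt_le, Rpower_pos|apply Rmult_le_pos; [apply Rlt_le, Rpower_pos|auto]|auto|].
    apply Rmult_le_compat_r; auto.
  - right. ring.
Qed.

(** With [x = |w|] the exponent at infinity collects [x ^ (2 r)] from [|l| ^ - r], [x ^ (- 2 b)]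
    from [(1 + |l|) ^ b], [x ^ (3 a)] from a distance of at least [x ^ - 3 Im w], and
    [x ^ (- 2 u j)] from each factor. This is the parameter [s] of the theorem. *)
Lemma slit_growth_neg_inv m g u a b r w : 0 <= a -> 0 <= b -> 0 < Im w -> (forall j, (j < m)%nat -> 0 < g j) ->
  slit_growth m g u a b r (Cmult (Copp (Cinv w)) (Copp (Cinv w))) <=
   rprod m (fun j => Rpower (g j) (u j)) * (Rpower (Im w) (- a) * Rpower (1 + Cmod w) (2 * b) *
    (Rpower (Cmod w) (3 * a - 2 * b + 2 * r - 2 * rsum m u) *
     rprod m (fun j => Rpower (Cmod (Cminus (Cmult w w) (RtoC (/ g j)))) (u j)))).
Proof.
  intros ha hb hw hg. assert (h0 := Cmod_sqr_pos w hw). unfold slit_growth.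
  assert (hne : w <> RtoC 0) by (apply Cmod_gt_0; auto).
  assert (hi : 0 < / Cmod w) by (apply Rinv_0_lt_compat; auto).
  rewrite rprod_neg_inv by auto.
  set (P := rprod m (fun j => Rpower (Cmod _) (u j))). set (P0 := rprod m (fun j => Rpower (g j) (u j))).
  assert (hP : 0 <= P) by (apply rprod_nonneg; intros; apply Rlt_le, Rpower_pos).
  assert (hP0 : 0 <= P0) by (apply rprod_nonneg; intros; apply Rlt_le, Rpower_pos).
  pose proof (Cinv_upper w hw) as hIv.
  assert (hv : 0 < Im (Copp (Cinv w))) by (rewrite hIv; repeat apply Rmult_lt_0_compat; auto).
  destruct (dist_sqr_bounds _ hv) as [d1 _].
  assert (hmv : Cmod (Copp (Cinv w)) = / Cmod w) by (rewrite Cmod_opp, Cmod_inv; auto).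
  rewrite hIv, hmv in d1. rewrite Cmod_mult, hmv.
  set (x := Cmod w) in *. set (y := Im w) in *.
  set (D := dist_Rplus _) in *.
  assert (B1 : Rpower (1 + / x * / x) b <= Rpower (1 + x) (2 * b) * Rpower x (- (2 * b))).
  { rewrite <- (Rpower_inv_base x), <- !Rpower_sqr, <- Rpower_mult_base by (try apply Rmult_lt_0_compat; lra).
    apply Rpower_mono; [|auto]. split; [assert (0 < / x * / x) by (apply Rmult_lt_0_compat; auto); lra|].
    assert (E : (1 + x) * (1 + x) * (/ x * / x) = 1 + / x * / x + 2 * / x) by (field; lra). lra. }
  assert (B2 : Rpower D (- a) <= Rpower y (- a) * Rpower x (3 * a)).
  { apply Rle_trans with (Rpower (/ x * (y * (/ x * / x))) (- a)).
    - apply Rpower_anti; auto. split; [|auto]. repeat apply Rmult_lt_0_compat; auto.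
    - right. rewrite !Rpower_mult_base, !Rpower_inv_base by (repeat apply Rmult_lt_0_compat; auto).
      replace (3 * a) with (- - a + (- - a + - - a)) by ring. rewrite !Rpower_plus. ring. }
  rewrite Rpower_mult_base, Rpower_inv_base, <- Rpower_plus by auto.
  replace (3 * a - 2 * b + 2 * r - 2 * rsum m u) with ((- - r + - - r) + (- (2 * b) + (3 * a + - 2 * rsum m u))) by ring.
  rewrite !(Rpower_plus _ _ x).
  set (Xu := Rpower x (-2 * rsum m u)). assert (hXu : 0 < Xu) by apply Rpower_pos.
  apply Rle_trans with (Rpower x (- - r) * Rpower x (- - r) * ((Rpower (1 + x) (2 * b) * Rpower x (- (2 * b))) *
    ((Rpower y (- a) * Rpower x (3 * a)) * (P0 * (P * Xu))))).
  - assert (0 <= P0 * (P * Xu)) by (repeat apply Rmult_le_pos; lra).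
    apply Rmult_le_compat_l; [apply Rmult_le_pos; apply Rlt_le, Rpower_pos|].
    apply Rmult_le_compat; [apply Rlt_le, Rpower_pos|apply Rmult_le_pos; [apply Rlt_le, Rpower_pos|auto]|auto|].
    apply Rmult_le_compat_r; auto.
  - right. ring.
Qed.

(** [(e0 - q) / 2] is chosen so that [|v| ^ (e0 - q)] and the [|v| ^ q] from the distance combine to
    [|v| ^ e0]. On the unit disc [1 + |v|^2] lies between [1] and [2]. *)
Lemma slit_weight_sqr m g e q e0 s2 v : 0 < q -> 0 < Im v -> Cmod v <= 1 ->
  slit_weight m g e q ((e0 - q) / 2) s2 (Cmult v v) <=
   Rpower 2 q * (Rpower 1 (- s2) + Rpower 2 (- s2)) * (Rpower (Im v) q * (Rpower (Cmod v) e0 *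
     rprod m (fun j => Rpower (Cmod (Cminus (Cmult v v) (RtoC (g j)))) (e j)))).
Proof.
  intros hq hv h1. assert (h0 := Cmod_sqr_pos v hv). unfold slit_weight.
  set (P := rprod m _). assert (hP : 0 <= P) by (apply rprod_nonneg; intros; apply Rlt_le, Rpower_pos).
  destruct (dist_sqr_bounds v hv) as [d1 d2].
  assert (hd0 : 0 < Cmod v * Im v) by (apply Rmult_lt_0_compat; auto).
  rewrite Cmod_mult, Rpower_sqr by auto.
  assert (B1 : Rpower (1 + Cmod v * Cmod v) (- s2) <= Rpower 1 (- s2) + Rpower 2 (- s2)).
  { apply Rpower_between; nra. }
  assert (B2 : Rpower (dist_Rplus (Cmult v v)) q <= Rpower 2 q * (Rpower (Cmod v) q * Rpower (Im v) q)).
  { rewrite <- !Rpower_mult_base by (auto; lra). apply Rpower_mono; lra. }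
  replace (2 * ((e0 - q) / 2)) with (- q + e0) by field. rewrite Rpower_plus.
  set (x := Cmod v) in *.
  apply Rle_trans with ((Rpower 2 q * (Rpower x q * Rpower (Im v) q)) * (Rpower x (- q) * Rpower x e0 * ((Rpower 1 (- s2) + Rpower 2 (- s2)) * P))).
  - assert (hx : 0 <= Rpower x (- q) * Rpower x e0) by (apply Rmult_le_pos; apply Rlt_le, Rpower_pos).
    apply Rmult_le_compat; [apply Rlt_le, Rpower_pos| |auto|].
    + apply Rmult_le_pos; [auto|]. apply Rmult_le_pos; [apply Rlt_le, Rpower_pos|auto].
    + apply Rmult_le_compat_l; [auto|]. apply Rmult_le_compat_r; auto.
  - assert (E : Rpower x q * Rpower x (- q) = 1).
    { rewrite <- Rpower_plus. replace (q + - q) with 0 by ring. apply Rpower_O; auto. }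
    right. transitivity ((Rpower x q * Rpower x (- q)) * (Rpower 2 q * (Rpower 1 (- s2) + Rpower 2 (- s2)) * (Rpower (Im v) q * (Rpower x e0 * P)))); [ring|].
    rewrite E. ring.
Qed.

(** The total exponent of [|w|] is [- 3 q + (q - e0) + 2 s2 - 2 rsum m e]; the value of [s2] makes
    it equal to [e1]. *)
Lemma slit_weight_neg_inv m g e q e0 e1 w : 0 < q -> 0 < Im w -> Cmod w <= 1 -> (forall j, (j < m)%nat -> 0 < g j) ->
  let s2 := q + (e0 + e1) / 2 + rsum m e in
  slit_weight m g e q ((e0 - q) / 2) s2 (Cmult (Copp (Cinv w)) (Copp (Cinv w))) <=
   Rpower 2 q * (Rpower 1 (- s2) + Rpower 2 (- s2)) * rprod m (fun j => Rpower (g j) (e j)) *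
   (Rpower (Im w) q * (Rpower (Cmod w) e1 *
     rprod m (fun j => Rpower (Cmod (Cminus (Cmult w w) (RtoC (/ g j)))) (e j)))).
Proof.
  intros hq hw h1 hg s2. assert (h0 := Cmod_sqr_pos w hw). unfold slit_weight.
  assert (hne : w <> RtoC 0) by (apply Cmod_gt_0; auto).
  assert (hi : 0 < / Cmod w) by (apply Rinv_0_lt_compat; auto).
  rewrite rprod_neg_inv by auto.
  set (P := rprod m (fun j => Rpower (Cmod _) (e j))). set (P0 := rprod m (fun j => Rpower (g j) (e j))).
  assert (hP : 0 <= P) by (apply rprod_nonneg; intros; apply Rlt_le, Rpower_pos).
  assert (hP0 : 0 <= P0) by (apply rprod_nonneg; intros; apply Rlt_le, Rpower_pos).
  pose proof (Cinv_upper w hw) as hIv.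
  assert (hv : 0 < Im (Copp (Cinv w))) by (rewrite hIv; repeat apply Rmult_lt_0_compat; auto).
  destruct (dist_sqr_bounds _ hv) as [d1 d2].
  assert (hmv : Cmod (Copp (Cinv w)) = / Cmod w) by (rewrite Cmod_opp, Cmod_inv; auto).
  rewrite hIv, hmv in d1, d2. rewrite Cmod_mult, hmv.
  set (x := Cmod w) in *. set (y := Im w) in *.
  set (D := dist_Rplus _) in *.
  assert (hy0 : 0 < / x * (y * (/ x * / x))) by (repeat apply Rmult_lt_0_compat; auto).
  assert (B1 : Rpower (1 + / x * / x) (- s2) <= (Rpower 1 (- s2) + Rpower 2 (- s2)) * Rpower x (2 * s2)).
  { assert (E : 1 + / x * / x = (1 + x * x) * (/ x * / x)) by (field; lra).
    rewrite E, !Rpower_mult_base by (try apply Rmult_lt_0_compat; nra).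
    rewrite !Rpower_inv_base, <- Rpower_plus by auto. replace (- - s2 + - - s2) with (2 * s2) by ring.
    apply Rmult_le_compat_r; [apply Rlt_le, Rpower_pos|]. apply Rpower_between; nra. }
  assert (B2 : Rpower D q <= Rpower 2 q * (Rpower y q * Rpower x (- 3 * q))).
  { apply Rle_trans with (Rpower (2 * (/ x * (y * (/ x * / x)))) q).
    - apply Rpower_mono; lra.
    - right. rewrite !Rpower_mult_base, !Rpower_inv_base by (repeat apply Rmult_lt_0_compat; auto; lra).
      replace (- 3 * q) with (- q + (- q + - q)) by ring. rewrite !Rpower_plus. ring. }
  rewrite Rpower_mult_base, Rpower_inv_base, <- Rpower_plus by auto.
  replace (- ((e0 - q) / 2) + - ((e0 - q) / 2)) with (q - e0) by field.
  set (S0 := Rpower 1 (- s2) + Rpower 2 (- s2)) in *.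
  assert (hS0 : 0 < S0) by (unfold S0; pose proof (Rpower_pos 1 (- s2)); pose proof (Rpower_pos 2 (- s2)); lra).
  pose proof (Rpower_pos x (- 2 * rsum m e)) as hX.
  apply Rle_trans with ((Rpower 2 q * (Rpower y q * Rpower x (- 3 * q))) * (Rpower x (q - e0) * ((S0 * Rpower x (2 * s2)) *
     (P0 * (P * Rpower x (- 2 * rsum m e)))))).
  - assert (hPP : 0 <= P0 * (P * Rpower x (- 2 * rsum m e))) by (repeat apply Rmult_le_pos; lra).
    apply Rmult_le_compat; [apply Rlt_le, Rpower_pos| |auto|].
    + apply Rmult_le_pos; [apply Rlt_le, Rpower_pos|]. apply Rmult_le_pos; [apply Rlt_le, Rpower_pos|auto].
    + apply Rmult_le_compat_l; [apply Rlt_le, Rpower_pos|]. apply Rmult_le_compat_r; auto.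
  - right. transitivity (Rpower 2 q * S0 * P0 * (Rpower y q * ((Rpower x (- 3 * q) * (Rpower x (q - e0) * (Rpower x (2 * s2) * Rpower x (- 2 * rsum m e)))) * P))); [ring|].
    rewrite <- !Rpower_plus. replace (- 3 * q + (q - e0 + (2 * s2 + - 2 * rsum m e))) with e1; [reflexivity|].
    unfold s2. field.
Qed.

(** Zeros with modulus at most [1] are pulled back by [w * w], the others by [1 / (w * w)], so that
    both kinds land in the unit disc; [e0] is the exponent at the origin and [e1] at infinity. The
    point [i] lies over [-1] and is fixed by [w := - 1 / w], so one normalization serves both
    halves. *)
Lemma slit_zeros (m : nat) (g u e : nat -> R) (a b r q e0 e1 : R) :
  (forall j, (j < m)%nat -> 0 < g j) ->
  (forall i j, (i < m)%nat -> (j < m)%nat -> g i = g j -> i = j) ->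
  0 <= a -> 0 <= b -> 1 + a < q -> (forall j, (j < m)%nat -> 1 < q + e j /\ a - u j < q + e j) ->
  1 < q + e0 /\ a - (- 2 * r - a) < q + e0 ->
  1 < q + e1 /\ a - (3 * a - 2 * b + 2 * r - 2 * rsum m u) < q + e1 ->
  exists Cst, 0 < Cst /\ forall (h : C -> C) (K : R), 0 < K ->
    (forall l, ~ in_Rplus l -> jet h l) -> Cmod (h (RtoC (-1))) = 1 ->
    (forall l, ~ in_Rplus l -> h l <> RtoC 0 -> ln (Cmod (h l)) <= K * slit_growth m g u a b r l) ->
    forall zs : list (C * nat), NoDup (map fst zs) ->
    (forall p, In p zs -> ~ in_Rplus (fst p) /\ (1 <= snd p)%nat /\ vanishes_to h (fst p) (snd p)) ->
    zsum (slit_weight m g e q ((e0 - q) / 2) (q + (e0 + e1) / 2 + rsum m e)) zs <= Cst * K.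
Proof.
  intros hg hd ha hb hq he he0 he1.
  set (s2 := q + (e0 + e1) / 2 + rsum m e).
  set (P0 := rprod m (fun j => Rpower (g j) (u j))).
  assert (hP0 : 0 <= P0) by (apply rprod_nonneg; intros; apply Rlt_le, Rpower_pos).
  set (P1 := rprod m (fun j => Rpower (g j) (e j))).
  assert (hP1 : 0 < P1) by (apply rprod_pos; intros; apply Rpower_pos).
  destruct (half_plane_zeros_sqr m g u e (- 2 * r - a) e0 a q (2 * b) 1) as [C1 [hC1 HC1]]; auto; try lra.
  destruct (half_plane_zeros_sqr m (fun j => / g j) u e (3 * a - 2 * b + 2 * r - 2 * rsum m u) e1 a q (2 * b) P0)
    as [C2 [hC2 HC2]]; auto; try lra.
  { intros j hj. apply Rinv_0_lt_compat; auto. }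
  { intros i j hi hj E. apply hd; auto. rewrite <- (Rinv_inv (g i)), E, Rinv_inv. reflexivity. }
  set (c0 := Rpower 2 q * (Rpower 1 (- s2) + Rpower 2 (- s2))).
  assert (hc0 : 0 < c0).
  { apply Rmult_lt_0_compat; [apply Rpower_pos|]. pose proof (Rpower_pos 1 (- s2)). pose proof (Rpower_pos 2 (- s2)). lra. }
  exists (c0 * C1 + c0 * P1 * C2). split.
  { apply Rplus_lt_0_compat; repeat first [assumption | apply Rmult_lt_0_compat]. }
  intros h K hK Hj Hh Hlog zs Hnd Hzs.
  set (W := slit_weight _ _ _ _ _ _).
  set (sq := fun l => epsilon (inhabits Ci) (fun v => 0 < Im v /\ Cmult v v = l)).
  assert (Hsq : forall l, ~ in_Rplus l -> 0 < Im (sq l) /\ Cmult (sq l) (sq l) = l).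
  { intros l hl. apply (epsilon_spec (inhabits Ci) (fun v => 0 < Im v /\ Cmult v v = l)), slit_sqrt, hl. }
  set (f := fun w => h (Cmult w w)). set (ni := fun w => Copp (Cinv w)).
  assert (Hf : forall w, 0 < Im w -> jet f w).
  { intros w hw. apply (jet_comp h (fun w => Cmult w w)); [apply jet_mult; apply jet_id|].
    apply Hj, sqr_not_in_Rplus, hw. }
  assert (Hni : forall w, 0 < Im w -> 0 < Im (ni w) /\ jet ni w /\ Cmod (ni w) = / Cmod w /\ ni (ni w) = w).
  { intros w hw. assert (h0 := Cmod_sqr_pos w hw). assert (hne : w <> RtoC 0) by (apply Cmod_gt_0; auto).
    repeat split.
    - unfold ni. rewrite Cinv_upper by auto. repeat apply Rmult_lt_0_compat; auto; apply Rinv_0_lt_compat; auto.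
    - apply (jet_ext (fun w => Cmult (RtoC (-1)) (Cinv w))).
      + intros v. unfold ni. apply injective_projections; simpl; ring.
      + apply jet_mult; [apply jet_const|apply jet_inv; auto].
    - unfold ni. rewrite Cmod_opp, Cmod_inv; auto.
    - unfold ni. field. auto. }
  assert (Efi : f Ci = h (RtoC (-1))).
  { unfold f. f_equal. apply injective_projections; simpl; ring. }
  assert (Hfv : forall p, In p zs -> vanishes_to f (sq (fst p)) (snd p)).
  { intros p hp. destruct (Hzs p hp) as [p1 [p2 p3]]. apply (vanishes_to_comp h (fun w => Cmult w w)).
    - apply jet_mult; apply jet_id.
    - rewrite (proj2 (Hsq _ p1)). exact p3. }
  assert (Hmod : forall p, In p zs -> Cmod (fst p) = Cmod (sq (fst p)) * Cmod (sq (fst p))).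
  { intros p hp. destruct (Hzs p hp) as [p1 _]. rewrite <- (proj2 (Hsq _ p1)) at 1. apply Cmod_mult. }
  set (sm := fun p : C * nat => if Rle_dec (Cmod (fst p)) 1 then true else false).
  rewrite (zsum_filter W sm zs), Rmult_plus_distr_r. apply Rplus_le_compat.
  - set (z1 := filter sm zs).
    assert (Hz1 : forall p, In p z1 -> In p zs /\ Cmod (fst p) <= 1).
    { intros p hp. apply filter_In in hp. destruct hp as [hp hs]. split; auto. unfold sm in hs.
      destruct (Rle_dec (Cmod (fst p)) 1); [auto|discriminate]. }
    assert (Hz1' : forall p, In p z1 -> Cmod (sq (fst p)) <= 1).
    { intros p hp. destruct (Hz1 p hp) as [hp1 hp2]. rewrite (Hmod p hp1) in hp2.
      pose proof (Cmod_ge_0 (sq (fst p))). nra. }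
    eapply Rle_trans; [apply (zsum_transport sq W (fun v => Rpower (Im v) q * (Rpower (Cmod v) e0 *
      rprod m (fun j => Rpower (Cmod (Cminus (Cmult v v) (RtoC (g j)))) (e j)))) z1 c0)|].
    + intros p hp. destruct (Hz1 p hp) as [hp1 hp2]. destruct (Hzs p hp1) as [p1 _].
      destruct (Hsq _ p1) as [q1 q2].
      pose proof (slit_weight_sqr m g e q e0 s2 (sq (fst p)) ltac:(lra) q1 (Hz1' p hp)) as HW.
      fold c0 in HW. unfold W. rewrite <- q2 at 1. exact HW.
    + rewrite Rmult_assoc. apply Rmult_le_compat_l; [lra|]. apply (HC1 f K); auto.
      * rewrite Efi. exact Hh.
      * intros w hw hf0. eapply Rle_trans; [apply Hlog; [apply sqr_not_in_Rplus; auto|exact hf0]|].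
        apply Rmult_le_compat_l; [lra|]. apply slit_growth_sqr; auto.
      * apply (NoDup_transport sq (fun v => Cmult v v)); [|apply NoDup_map_filter; auto].
        intros p hp. apply Hsq, Hzs, Hz1, hp.
      * intros p hp. apply in_map_iff in hp. destruct hp as [p' [<- hp]]. simpl.
        destruct (Hz1 p' hp) as [hp1 hp2]. destruct (Hzs p' hp1) as [p1 [p2 p3]]. repeat split; auto. apply Hsq; auto.
  - set (z1 := filter (fun p => negb (sm p)) zs).
    assert (Hz1 : forall p, In p z1 -> In p zs /\ 1 < Cmod (fst p)).
    { intros p hp. apply filter_In in hp. destruct hp as [hp hs]. split; auto. unfold sm in hs.
      destruct (Rle_dec (Cmod (fst p)) 1); [discriminate|lra]. }
    assert (Hz1' : forall p, In p z1 -> Cmod (ni (sq (fst p))) <= 1).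
    { intros p hp. destruct (Hz1 p hp) as [hp1 hp2]. rewrite (Hmod p hp1) in hp2.
      pose proof (Cmod_ge_0 (sq (fst p))). destruct (Hzs p hp1) as [p1 _].
      destruct (Hni (sq (fst p)) (proj1 (Hsq _ p1))) as [_ [_ [En _]]]. rewrite En.
      rewrite <- Rinv_1. apply Rinv_le_contravar; [lra|]. nra. }
    set (psi := fun w => Cmult (ni w) (ni w)).
    assert (Hpsi : forall l, ~ in_Rplus l -> 0 < Im (ni (sq l)) /\ psi (ni (sq l)) = l).
    { intros l hl. destruct (Hsq l hl) as [q1 q2]. destruct (Hni _ q1) as [n1 [n2 [n3 n4]]]. split; auto.
      unfold psi. rewrite n4. exact q2. }
    eapply Rle_trans; [apply (zsum_transport (fun l => ni (sq l)) W (fun v => Rpower (Im v) q * (Rpower (Cmod v) e1 *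
      rprod m (fun j => Rpower (Cmod (Cminus (Cmult v v) (RtoC (/ g j)))) (e j)))) z1 (c0 * P1))|].
    + intros p hp. destruct (Hz1 p hp) as [hp1 hp2]. destruct (Hzs p hp1) as [p1 _].
      destruct (Hpsi _ p1) as [q1 q2].
      pose proof (slit_weight_neg_inv m g e q e0 e1 (ni (sq (fst p))) ltac:(lra) q1 (Hz1' p hp) hg) as HW.
      unfold W. rewrite <- q2 at 1. exact HW.
    + rewrite (Rmult_assoc (c0 * P1) C2 K). apply Rmult_le_compat_l; [apply Rmult_le_pos; lra|]. apply (HC2 (fun w => f (ni w)) K); auto.
      * intros w hw. destruct (Hni w hw) as [n1 [n2 _]]. apply jet_comp; auto.
      * replace (ni Ci) with Ci; [rewrite Efi; exact Hh|]. unfold ni. rewrite Ci_inv. ring.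
      * intros w hw hf0. destruct (Hni w hw) as [n1 [n2 _]].
        eapply Rle_trans; [apply Hlog; [apply sqr_not_in_Rplus; auto|exact hf0]|].
        apply Rmult_le_compat_l; [lra|]. apply slit_growth_neg_inv; auto.
      * apply (NoDup_transport (fun l => ni (sq l)) psi); [|apply NoDup_map_filter; auto].
        intros p hp. apply Hpsi, Hzs, Hz1, hp.
      * intros p hp. apply in_map_iff in hp. destruct hp as [p' [<- hp]]. simpl.
        destruct (Hz1 p' hp) as [hp1 hp2]. destruct (Hzs p' hp1) as [p1 [p2 p3]]. destruct (Hpsi _ p1) as [q1 q2].
        destruct (Hsq _ p1) as [t1 t2]. destruct (Hni _ t1) as [n1 [n2 [n3 n4]]]. destruct (Hni _ n1) as [m1 [m2 _]].
        repeat split; auto. apply vanishes_to_comp; [auto|]. rewrite n4. auto.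
Qed.

(** * Matching the exponents of the theorem *)

(** For [u >= 0] the bracket subtracts [min a u], which leaves at least [1 + eps] and at least
    [a - u + 1 + eps]. For [u < 0] the term [(- u - 1 + eps)_+] lifts the total to at least
    [a - u + 2 eps], and it exceeds [1] anyway. *)
Lemma brace_admissible u a eps : 0 <= a -> 0 < eps ->
  1 < a + 1 + eps + brace u a eps /\ a - u < a + 1 + eps + brace u a eps.
Proof.
  intros ha he. unfold brace, ppart, npart, Rmax, Rmin. repeat destruct Rle_dec; lra.
Qed.

(** Numerator and denominator factors merge into one family in which each [t' k] carries the
    negative exponent [- d k]. *)
Lemma growth_bound_slit n m t t' c d a b r K l :
  growth_bound n m t t' c d a b r K l =
  K * slit_growth (n + m) (glue n t t') (glue n c (fun k => - d k)) a b r l.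
Proof.
  unfold growth_bound, slit_growth.
  rewrite (rprod_glue (fun s e => Rpower (Cmod (Cminus l (RtoC s))) e) n m t t' c (fun k => - d k)).
  unfold Rdiv. rewrite rprod_inv, !Rpower_Ropp.
  rewrite (rprod_ext m (fun j => Rpower (Cmod (Cminus l (RtoC (t' j)))) (- d j))
      (fun j => / Rpower (Cmod (Cminus l (RtoC (t' j)))) (d j))) by (intros; apply Rpower_Ropp).
  ring.
Qed.

Lemma zero_weight_slit n m t t' c d a b r eps z :
  zero_weight n m t t' c d a b r eps z =
  slit_weight (n + m) (glue n t t') (glue n (fun j => - Rmin a (c j)) (fun k => ppart (d k - 1 + eps)))
    (a + 1 + eps) (s1_par a r eps) (s2_par n m c d a b r eps) z.
Proof.
  unfold zero_weight, slit_weight.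
  rewrite (rprod_glue (fun s e => Rpower (Cmod (Cminus z (RtoC s))) e) n m t t').
  unfold Rdiv. rewrite rprod_inv, !Rpower_Ropp.
  rewrite (rprod_ext n (fun j => Rpower (Cmod (Cminus z (RtoC (t j)))) (- Rmin a (c j)))
      (fun j => / Rpower (Cmod (Cminus z (RtoC (t j)))) (Rmin a (c j)))) by (intros; apply Rpower_Ropp).
  ring.
Qed.

Lemma rsum_opp n u : rsum n (fun j => - u j) = - rsum n u.
Proof. induction n as [|n IH]; simpl; [ring|]. rewrite IH. ring. Qed.

Theorem theorem4p5 (n m : nat) (t t' c d : nat -> R) (a b r eps : R) :
  (forall j, (j < n)%nat -> 0 < t j) ->
  (forall k, (k < m)%nat -> 0 < t' k) ->
  (forall i j, (i < n)%nat -> (j < n)%nat -> t i = t j -> i = j) ->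
  (forall i k, (i < m)%nat -> (k < m)%nat -> t' i = t' k -> i = k) ->
  (forall j k, (j < n)%nat -> (k < m)%nat -> t j <> t' k) ->
  0 <= a -> 0 <= b ->
  (forall j, (j < n)%nat -> 0 <= c j) ->
  (forall k, (k < m)%nat -> 0 <= d k) ->
  0 < eps ->
  exists Cst : R, 0 < Cst /\
    forall (h : C -> C) (K : R),
      0 < K ->
      analytic_on_slit h ->
      Cmod (h (RtoC (-1))) = 1 ->
      (forall l : C, ~ in_Rplus l -> h l <> RtoC 0 ->
         ln (Cmod (h l)) <= growth_bound n m t t' c d a b r K l) ->
      forall zs : list (C * nat),
        NoDup (map fst zs) ->
        (forall p, In p zs -> ~ in_Rplus (fst p) /\ (1 <= snd p)%nat /\
                              zero_order h (fst p) (snd p)) ->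
        zsum (zero_weight n m t t' c d a b r eps) zs <= Cst * K.
Proof.
  intros ht ht' hti hti' htt ha hb hc hd he.
  set (g := glue n t t'). set (u := glue n c (fun k => - d k)).
  set (e := glue n (fun j => - Rmin a (c j)) (fun k => ppart (d k - 1 + eps))).
  assert (hs : 3 * a - 2 * b + 2 * r - 2 * rsum (n + m) u = s_par n m c d a b r).
  { unfold u, s_par. rewrite rsum_glue, rsum_opp. ring. }
  destruct (slit_zeros (n + m) g u e a b r (a + 1 + eps) (brace (- 2 * r - a) a eps) (brace (s_par n m c d a b r) a eps))
    as [Cst [hC HC]]; auto; try lra.
  - apply (glue_forall n m (fun x => 0 < x)); auto.
  - apply glue_inj; auto.
  (* At [t j] the total [1 + eps + a - min a (c j)] exceeds both [1] and [a - c j]. At [t' k] the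
     positive part gives at least [a + d k + 2 eps], against the required [a + d k]. *)
  - intros j hj. unfold u, e, glue. destruct (lt_dec j n) as [h|h].
    + specialize (hc j h). unfold Rmin. destruct Rle_dec; lra.
    + specialize (hd (j - n)%nat ltac:(lia)). unfold ppart, Rmax. destruct Rle_dec; lra.
  - apply brace_admissible; auto.
  - rewrite hs. apply brace_admissible; auto.
  - exists Cst. split; [auto|]. intros h K hK Hh H1 Hlog zs Hnd Hzs.
    eapply Rle_trans; [|apply (HC h K hK) with (zs := zs); auto].
    + apply zsum_le. intros p _. rewrite zero_weight_slit. right. f_equal.
      * unfold s1_par. field.
      * unfold s2_par, e. rewrite rsum_glue, rsum_opp. ring.
    + intros l hl. apply analytic_jet; auto.
    + intros l hl hl0. unfold g, u. rewrite <- growth_bound_slit. auto.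
    + intros p hp. destruct (Hzs p hp) as [p1 [p2 p3]]. repeat split; auto. apply zero_order_vanishes; auto.
Qed.
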